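(* In the setting below, there exist nonnegative weights $\xi_0$, $\{\xi^x_i\}_{i=1}^k$, $\{\xi^y_j\}_{j=1}^c$ summing to one (functions of the data) such that for every measurable $C\subseteq\mathbb{X}$ $$\mathbb{P}\big(X_{n+1}\in C\mid (X_i)_{i=1}^n,(Y_j)_{j=1}^m\big)=\xi_0P_0(C)+\sum_{i=1}^k\xi^x_i\delta_{X_i^*}(C)+\sum_{j=1}^c\xi^y_jR_{Y_j^*}(C).$$ Analogously there exist nonnegative weights $\eta_0$, $\{\eta^y_j\}_{j=1}^c$, $\{\eta^x_i\}_{i=1}^k$ summing to one such that $$\mathbb{P}\big(Y_{m+1}\in C\mid (X_i)_{i=1}^n,(Y_j)_{j=1}^m\big)=\eta_0P_0(C)+\sum_{j=1}^c\eta^y_j\delta_{Y_j^*}(C)+\sum_{i=1}^k\eta^x_iQ_{X_i^*}(C).$$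
   Context: FuRBI setup. $\mathbb{X}$ is a Polish space, $\theta>0$, $G_0$ a non-atomic probability measure on $\mathbb{X}^2$ with both marginals equal to $P_0$; $\rho$ a measure on $[0,\infty)^2\setminus\{(0,0)\}$ with $\int\min\{1,s_1+s_2\}\rho(\mathrm{d}s)<\infty$ whose two marginal jump measures on $(0,\infty)$ coincide and have infinite mass. $(\mu_1,\mu_2)$ is a completely random vector on $\mathbb{X}^2$ (independent evaluations on pairwise disjoint sets), with no fixed atoms or deterministic part and Lévy intensity $\theta\rho(\mathrm{d}s_1,\mathrm{d}s_2)G_0(\mathrm{d}x)$. The n-FuRBI are $\tilde p_1(A)=\mu_1(A\times\mathbb{X})/\mu_1(\mathbb{X}^2)$ and $\tilde p_2(B)=\mu_2(\mathbb{X}\times B)/\mu_2(\mathbb{X}^2)$. $G_0$ has density $g_0$ w.r.t. $\lambda\otimes\lambda$ for a σ-finite $\lambda$, $P_0$ has density $p_0$ w.r.t. $\lambda$; $Q_x(\mathrm{d}y)=g_0(x,y)\lambda(\mathrm{d}y)/p_0(x)$ (law of second coordinate given first $=x$ under $G_0$) and $R_y(\mathrm{d}x)=g_0(x,y)\lambda(\mathrm{d}x)/p_0(y)$ (law of first coordinate given second $=y$). Conditionally on $(\tilde p_1,\tilde p_2)$, $X_1,X_2,\dots$ are i.i.d. $\tilde p_1$ and $Y_1,Y_2,\dots$ i.i.d. $\tilde p_2$, independent. Given $n,m\ge1$, $X^*_1,\dots,X^*_k$ are the distinct values among $X_1,\dots,X_n$ and $Y^*_1,\dots,Y^*_c$ the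 distinct values among $Y_1,\dots,Y_m$. *)

(* Defs.v *)
From mathcomp Require Import all_boot all_algebra.
From mathcomp Require Import all_classical all_reals all_analysis measurable_realfun.
Import GRing.Theory Num.Theory.

Set Implicit Arguments.
Unset Strict Implicit.
Unset Printing Implicit Defensive.

Local Open Scope classical_set_scope.
Local Open Scope ring_scope.

Section FuRBI_defs.
Variable R : realType.

Definition dist_ball {T : Type} (dist : T -> T -> R) (x : T) (e : R) : set T :=
  [set y | dist x y < e].

Definition dist_open {T : Type} (dist : T -> T -> R) (A : set T) : Prop :=
  forall x, A x -> exists2 e : R, 0 < e & dist_ball dist x e `<=` A.

Definition polish_space (d : measure_display) (X : measurableType d) : Prop :=
  exists dist : X -> X -> R,
  [/\ (forall x y, dist x y = 0 <-> x = y) /\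
      (forall x y, dist x y = dist y x),
      (forall x y z, dist x z <= dist x y + dist y z),
      (forall u : nat -> X,
         (forall e : R, 0 < e -> exists N, forall p q, (N <= p)%N -> (N <= q)%N ->
            dist (u p) (u q) < e) ->
         exists l : X, forall e : R, 0 < e -> exists N, forall p, (N <= p)%N ->
            dist (u p) l < e),
      (exists D : nat -> X, forall x (e : R), 0 < e -> exists k, dist x (D k) < e) &
      (@measurable _ X = <<s dist_open dist >>)].

Definition sigma_gen_seq (dO : measure_display) (Omega : measurableType dO)
  (d : measure_display) (X : measurableType d) (Z : nat -> Omega -> X) (n : nat)
  : set (set Omega) :=
  \bigcup_(i in `I_n) preimage_set_system setT (Z i) measurable.

(* sigma-algebra generated by X_1..X_n and Y_1..Y_m (0-based: X 0 .. X (n-1)) *)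
Definition sigma_data (dO : measure_display) (Omega : measurableType dO)
  (d : measure_display) (X : measurableType d) (Xs Ys : nat -> Omega -> X) (n m : nat)
  : set (set Omega) :=
  <<s sigma_gen_seq Xs n `|` sigma_gen_seq Ys m >>.

Definition measurable_wrt (dO : measure_display) (Omega : measurableType dO)
  (F : set (set Omega)) (f : Omega -> R) : Prop :=
  forall B : set R, measurable B -> F (f @^-1` B).

Definition ptilde1 (dO : measure_display) (Omega : measurableType dO)
  (d : measure_display) (X : measurableType d)
  (mu1 : Omega -> {measure set (X * X)%type -> \bar R}) (w : Omega) (A : set X) : R :=
  fine (mu1 w (A `*` setT)) / fine (mu1 w setT).

Definition ptilde2 (dO : measure_display) (Omega : measurableType dO)
  (d : measure_display) (X : measurableType d)
  (mu2 : Omega -> {measure set (X * X)%type -> \bar R}) (w : Omega) (B : set X) : R :=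
  fine (mu2 w (setT `*` B)) / fine (mu2 w setT).

Definition sigma_ptilde (dO : measure_display) (Omega : measurableType dO)
  (d : measure_display) (X : measurableType d)
  (mu1 mu2 : Omega -> {measure set (X * X)%type -> \bar R}) : set (set Omega) :=
  <<s [set E | exists A (B : set R), [/\ measurable A, measurable B &
          (E = [set w | B (ptilde1 mu1 w A)] \/ E = [set w | B (ptilde2 mu2 w A)])]] >>.

Definition expmE (x : \bar R) : R :=
  match x with
  | EFin r => expR (- r)
  | _ => 0
  end.

(* (i) random measures: each evaluation mu_i(A) is a random variable;
   (ii) independence of (mu1(A_i), mu2(A_i)) over pairwise disjoint A_1..A_N;
   (iii) the law of (mu1(A), mu2(A)) is given by the Levy intensity
         theta rho(ds1,ds2) G0(dx) (no fixed atoms, no deterministic part):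
         E[e^{-l1 mu1(A) - l2 mu2(A)}]
           = exp(- theta G0(A) \int (1 - e^{-l1 s1 - l2 s2}) rho(ds)). *)
Definition completely_random_vector (dO : measure_display) (Omega : measurableType dO)
  (P : probability Omega R) (d : measure_display) (X : measurableType d)
  (theta : R) (rho : {measure set (measurableTypeR R * measurableTypeR R)%type -> \bar R})
  (G0 : probability (X * X)%type R)
  (mu1 mu2 : Omega -> {measure set (X * X)%type -> \bar R}) : Prop :=
  [/\ (forall A, measurable A ->
         measurable_fun setT (fun w => mu1 w A) /\ measurable_fun setT (fun w => mu2 w A)),
      (forall (N : nat) (A : nat -> set (X * X)%type) (B : nat -> set (\bar R * \bar R)%type),
         (forall i, (i < N)%N -> measurable (A i) /\ measurable (B i)) ->
         (forall i j, (i < N)%N -> (j < N)%N -> i <> j -> A i `&` A j = set0) ->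
         P (\bigcap_(i in `I_N) [set w | B i (mu1 w (A i), mu2 w (A i))]) =
         (\prod_(i < N) P [set w | B i (mu1 w (A i), mu2 w (A i))])%E) &
      (forall (A : set (X * X)%type) (l1 l2 : R), measurable A -> 0 <= l1 -> 0 <= l2 ->
         (\int[P]_w (expmE (l1%:E * mu1 w A + l2%:E * mu2 w A)%E)%:E)%E =
         (expR (- (theta * fine (G0 A) *
            fine (\int[rho]_s (1 - expR (- (l1 * s.1 + l2 * s.2)))%:E)%E)))%:E)].

(* Given (ptilde1, ptilde2), the X_i are i.i.d. ptilde1, the Y_j i.i.d. ptilde2,
   and the two sequences are independent: for every event E in sigma(ptilde1, ptilde2),
   P(E, X_0 in A_0, ..., X_{n-1} in A_{n-1}, Y_0 in B_0, ..., Y_{m-1} in B_{m-1})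
     = E[ 1_E prod_i ptilde1(A_i) prod_j ptilde2(B_j) ]. *)
Definition cond_iid (dO : measure_display) (Omega : measurableType dO)
  (P : probability Omega R) (d : measure_display) (X : measurableType d)
  (mu1 mu2 : Omega -> {measure set (X * X)%type -> \bar R})
  (Xs Ys : nat -> Omega -> X) : Prop :=
  (forall i, measurable_fun setT (Xs i)) /\ (forall j, measurable_fun setT (Ys j)) /\
  forall (n m : nat) (A B : nat -> set X) (E : set Omega),
    (forall i, measurable (A i)) -> (forall j, measurable (B j)) ->
    sigma_ptilde mu1 mu2 E ->
    P (E `&` (\bigcap_(i in `I_n) (Xs i @^-1` A i))
         `&` (\bigcap_(j in `I_m) (Ys j @^-1` B j))) =
    (\int[P]_(w in E)
       ((\prod_(i < n) ptilde1 mu1 w (A i)) * (\prod_(j < m) ptilde2 mu2 w (B j)))%:E)%E.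

Definition Qker (d : measure_display) (X : measurableType d)
  (lam : {measure set X -> \bar R}) (g0 : X * X -> R) (p0 : X -> R) (x : X) (C : set X)
  : \bar R :=
  ((\int[lam]_(y in C) (g0 (x, y))%:E) * ((p0 x)^-1)%:E)%E.

Definition Rker (d : measure_display) (X : measurableType d)
  (lam : {measure set X -> \bar R}) (g0 : X * X -> R) (p0 : X -> R) (y : X) (C : set X)
  : \bar R :=
  ((\int[lam]_(x in C) (g0 (x, y))%:E) * ((p0 y)^-1)%:E)%E.

Definition distinct_vals (dO : measure_display) (Omega : measurableType dO)
  (d : measure_display) (X : measurableType d) (Z : nat -> Omega -> X) (n : nat)
  (w : Omega) : seq X :=
  undup [seq Z i w | i <- iota 0 n].

End FuRBI_defs.

(* Main.v *)
(** Differentiating the Laplace functional of the completely random vector once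
    per observation expresses the mixed moments of the masses as a sum over set
    partitions of the observations; integrating against u^(n1-1) v^(n2-1) turns
    the damping exp(- u T_1 - v T_2) into the normalisations T_1^-n1 T_2^-n2.
    Hence the law of X_1..X_n, Y_1..Y_m and the next item is a mixture over set
    partitions, and in each component the blocks have independent locations of
    law G_0, each item showing one coordinate of the location of its block.
    Within a component the next item is alone in its block (law P_0), or shares
    it with an item of its own kind (a Dirac mass), or only with items of the
    other kind (the conditional law of G_0).  The posterior weights are the
    densities of the components with respect to the law of the data, pooled over
    equal observations; the diagonal is measurable because X is Polish. *)

From HB Require Import structures.
Require Import Defs.
From mathcomp Require Import all_boot all_order all_algebra.
From mathcomp Require Import all_classical all_reals all_analysis measurable_realfun.
From mathcomp Require Import ring lra zify.
Import Order.TTheory GRing.Theory Num.Theory.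
Import numFieldNormedType.Exports.
Set Implicit Arguments.
Unset Strict Implicit.
Unset Printing Implicit Defensive.
Local Open Scope classical_set_scope.
Local Open Scope ring_scope.

(** * One-sided derivatives as limits of difference quotients *)

Section difference_quotients.
Context {R : realType}.
Implicit Types (f g : R -> R) (l : R).

(** The Laplace functional is known at nonnegative parameters only, so every derivative is one-sided
    and sampled along 1/(p+1); this suffices, as functions that agree on [0, oo) have the same
    quotients. Two obstacles shape the rest. The masses need not have moments, and the jump measure
    is infinite near the origin: the damping with u, v > 0 makes moments exist, and a block integral
    converges once its block is nonempty, a jump factor compensating the many small jumps. Moreover
    observations are tested on arbitrary sets, which overlap, whereas independence is given for
    disjoint sets and the Laplace exponent for one set at a time: the space is cut into the atoms of
    the generated algebra before anything is differentiated. Normalising requires total masses that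
    are positive and finite; this is extracted from the sampling scheme, which gives the whole space
    probability 1. Divisions by zero and null sets are settled by conventions (0^-1 = 0, [fine] of
    infinity is 0), and the weights are corrected on a null set so as to sum to one everywhere. *)

Definition dquot f (p : nat) : R := p.+1%:R * (f 0 - f (p.+1%:R^-1)).

(** The limit is minus the right derivative at 0, taken along the points 1/(p+1): with this sign a
    Laplace transform has a nonnegative value. *)
Definition dq f l := dquot f @ \oo --> l.

Lemma dq_cvg0 f l : dq f l -> f (p.+1%:R^-1) @[p --> \oo] --> f 0.
Proof.
move=> dqf.
have -> : (fun p : nat => f p.+1%:R^-1) = (fun p => f 0 - p.+1%:R^-1 * dquot f p).
  by apply/funext => p; rewrite /dquot mulKf ?pnatr_eq0//; ring.
rewrite -[X in _ --> X]subr0; apply: cvgB; first exact: cvg_cst.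
rewrite -[X in _ --> X](mul0r l); apply: cvgM => //; exact: cvg_harmonic.
Qed.

Lemma dq_cst (a : R) : dq (fun=> a) 0.
Proof.
rewrite /dq (_ : dquot _ = fun=> 0); first exact: cvg_cst.
by apply/funext => p; rewrite /dquot subrr mulr0.
Qed.

Lemma dqM f g l l' : dq f l -> dq g l' ->
  dq (fun s => f s * g s) (l * g 0 + f 0 * l').
Proof.
move=> df dg; rewrite /dq.
have -> : dquot (fun s => f s * g s) =
    (fun p => dquot f p * g 0 + f (p.+1%:R^-1) * dquot g p).
  by apply/funext => p; rewrite /dquot; ring.
apply: cvgD; first by apply: cvgM => //; exact: cvg_cst.
by apply: cvgM => //; exact: dq_cvg0 df.
Qed.

Lemma dqD f g l l' : dq f l -> dq g l' -> dq (fun s => f s + g s) (l + l').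
Proof.
move=> df dg; rewrite /dq.
have -> : dquot (fun s => f s + g s) = (fun p => dquot f p + dquot g p).
  by apply/funext => p; rewrite /dquot; ring.
exact: cvgD.
Qed.

Lemma dqZ (a : R) f l : dq f l -> dq (fun s => a * f s) (a * l).
Proof.
move=> df; have := dqM (dq_cst a) df.
by rewrite mul0r add0r.
Qed.

Lemma dq_sum (I : eqType) (s : seq I) (f : I -> R -> R) (l : I -> R) :
  {in s, forall i, dq (f i) (l i)} ->
  dq (fun t => \sum_(i <- s) f i t) (\sum_(i <- s) l i).
Proof.
elim: s => [|i s ih] fl.
  rewrite big_nil (_ : (fun _ => _) = fun=> 0); first exact: dq_cst.
  by apply/funext => t; rewrite big_nil.
rewrite big_cons (_ : (fun _ => _) = fun t => f i t + \sum_(i <- s) f i t).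
  apply: dqD; first by apply: fl; rewrite mem_head.
  by apply: ih => j js; apply: fl; rewrite inE js orbT.
by apply/funext => t; rewrite big_cons.
Qed.

(** Both bounds are instances of 1 + y <= exp y, at y = x and y = - x. The upper one serves as
    domination, the pair as a squeeze. *)
Lemma expRN_bounds (x : R) : 0 <= x ->
  x / (1 + x) <= 1 - expR (- x) /\ 1 - expR (- x) <= x.
Proof.
move=> x0; split; last by have := expR_ge1Dx (- x); lra.
have x1 : 0 < 1 + x by lra.
have := expR_ge1Dx x; rewrite expRN => h.
have : (expR x)^-1 <= (1 + x)^-1 by rewrite lef_pV2// posrE expR_gt0.
suff -> : x / (1 + x) = 1 - (1 + x)^-1 by lra.
by field; rewrite lt0r_neq0.
Qed.

Lemma cvg_expRN (u : nat -> R) (l : R) : (forall p, 0 <= u p) ->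
  (fun p => p.+1%:R * u p) @ \oo --> l ->
  (fun p => p.+1%:R * (1 - expR (- u p))) @ \oo --> l.
Proof.
move=> u0 ul.
have u_0 : u @ \oo --> 0.
  rewrite (_ : u = fun p => p.+1%:R^-1 * (p.+1%:R * u p)); last first.
    by apply/funext => p; rewrite mulKf ?pnatr_eq0.
  rewrite -[X in _ --> X](mul0r l); apply: cvgM => //; exact: cvg_harmonic.
apply: (@squeeze_cvgr _ _ _ _ (fun p => (p.+1%:R * u p) / (1 + u p))
          (fun p => p.+1%:R * u p)) => //.
  apply: nearW => p; have [h1 h2] := expRN_bounds (u0 p).
  by rewrite -mulrA !ler_pM2l ?ltr0n// h1.
have -> : l = l / (1 + 0) by rewrite addr0 divr1.
apply: cvgM => //; apply: cvgV; first by rewrite addr0 oner_eq0.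
by apply: cvgD => //; exact: cvg_cst.
Qed.

(** The chain rule for exp (- f). As f is smallest at 0 on the half-line, its increments are
    nonnegative and [cvg_expRN] applies; [- l] appears because [dq] is minus a derivative. *)
Lemma dq_expRN f l : (forall s, 0 <= s -> f 0 <= f s) -> dq f (- l) ->
  dq (fun s => expR (- f s)) (l * expR (- f 0)).
Proof.
move=> f0 df; rewrite /dq.
have -> : dquot (fun s => expR (- f s)) =
    (fun p => (p.+1%:R * (1 - expR (- (f p.+1%:R^-1 - f 0)))) * expR (- f 0)).
  apply/funext => p; rewrite /dquot -mulrA mulrBl mul1r -expRD.
  by congr (_ * (_ - expR _)); ring.
apply: cvgM; last exact: cvg_cst.
apply: cvg_expRN => [p|]; first by rewrite subr_ge0 f0.
rewrite -[X in _ --> X]opprK.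
rewrite (_ : (fun _ => _) = - dquot f); first exact: cvgN.
by apply/funext => p; rewrite /dquot opprfctE; ring.
Qed.

Lemma dq_unique f g l l' : dquot f = dquot g -> dq f l -> dq g l' -> l = l'.
Proof.
by rewrite /dq => -> fl gl'; exact: (cvg_unique (@Rhausdorff R) fl gl').
Qed.

End difference_quotients.

Section integral_difference_quotient.
Context {R : realType} d (T : measurableType d) (m : {measure set T -> \bar R}).
Implicit Types phi om : T -> R.

Lemma le_integrableR (f g : T -> R) : measurable_fun setT f ->
  (forall x, `|f x| <= g x) -> m.-integrable setT (EFin \o g) ->
  m.-integrable setT (EFin \o f).
Proof.
move=> mf fg; apply: le_integrable => //; first exact/measurable_EFinP.
by move=> x _; rewrite /= lee_fin (le_trans (fg x))// ler_norm.
Qed.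

(** Dominated convergence under [phi * om], from 1 - exp (- y) <= y. The domination asks for
    [phi * om] to be integrable rather than [phi], which matters when [phi] is the damping and the
    jump measure is infinite. *)
Lemma cvg_integral_expRN phi om :
  measurable_fun setT phi -> measurable_fun setT om ->
  (forall x, 0 <= phi x) -> (forall x, 0 <= om x) ->
  m.-integrable setT (EFin \o (fun x => phi x * om x)) ->
  (fun p : nat => p.+1%:R *
     Rintegral m setT (fun x => phi x * (1 - expR (- (p.+1%:R^-1 * om x)))))
    @ \oo --> Rintegral m setT (fun x => phi x * om x).
Proof.
move=> mphi mom phi0 om0 iphi.
pose f p x : R := phi x * (p.+1%:R * (1 - expR (- (p.+1%:R^-1 * om x)))).
have mf p : measurable_fun setT (f p).
  apply: measurable_funM => //; apply: measurable_funM => //.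
  apply: measurable_funB => //; apply: measurableT_comp => //.
  by apply: measurableT_comp => //; apply: measurable_funM.
have f0 p x : 0 <= f p x <= phi x * om x.
  have om1 : 0 <= p.+1%:R^-1 * om x by rewrite mulr_ge0// invr_ge0.
  have [h1 h2] := expRN_bounds om1.
  have e0 : 0 <= 1 - expR (- (p.+1%:R^-1 * om x)).
    by apply: le_trans h1; rewrite divr_ge0// addr_ge0.
  rewrite /f !mulr_ge0//= ler_wpM2l//.
  by rewrite -[leRHS](@mulVKf _ p.+1%:R) ?pnatr_eq0// ler_wpM2l.
have ifp p : m.-integrable setT (EFin \o f p).
  apply: le_integrableR iphi => // x; have /andP[? ?] := f0 p x.
  by rewrite ger0_norm.
have -> : (fun p : nat => p.+1%:R *
     Rintegral m setT (fun x => phi x * (1 - expR (- (p.+1%:R^-1 * om x))))) =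
   (fun p => Rintegral m setT (f p)).
  apply/funext => p; rewrite -RintegralZl//; last first.
    apply: le_integrableR (ifp p).
      apply: measurable_funM => //.
      apply: measurable_funB => //; apply: measurableT_comp => //.
      by apply: measurableT_comp => //; apply: measurable_funM.
    move=> x; have /andP[h _] := f0 p x.
    rewrite (_ : f p x = p.+1%:R * (phi x * (1 - expR (- (p.+1%:R^-1 * om x))))) in h *;
      last by rewrite /f; ring.
    rewrite pmulr_rge0 ?ltr0n// in h.
    by rewrite ger0_norm// ler_peMl// ler1n.
  by apply: eq_Rintegral => x _; rewrite /f; ring.
apply: fine_cvg.
rewrite fineK; last exact: integrable_fin_num.
apply: (@cvg_trans _ ((fun p => \int[m]_x (f p x)%:E)%E @ \oo)) => //.
have := @dominated_convergence _ _ _ m setT measurableT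
  (fun p x => (f p x)%:E) (fun x => (phi x * om x)%:E) (fun x => (phi x * om x)%:E).
case => //.
- by move=> p; exact/measurable_EFinP.
- exact/measurable_EFinP/measurable_funM.
- apply: aeW => x _; apply: cvg_EFin; first exact: nearW.
  rewrite /f; apply: cvgM; first exact: cvg_cst.
  apply: cvg_expRN => [p|]; first by rewrite mulr_ge0// invr_ge0.
  rewrite (_ : (fun _ => _) = fun=> om x); first exact: cvg_cst.
  by apply/funext => p; rewrite mulVKf ?pnatr_eq0.
- by apply: aeW => x p _; have /andP[? ?] := f0 p x; rewrite /= lee_fin ger0_norm.
Qed.

Lemma dq_integral phi om :
  measurable_fun setT phi -> measurable_fun setT om ->
  (forall x, 0 <= phi x) -> (forall x, 0 <= om x) ->
  m.-integrable setT (EFin \o phi) ->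
  m.-integrable setT (EFin \o (fun x => phi x * om x)) ->
  dq (fun s => Rintegral m setT (fun x => phi x * expR (- (s * om x))))
     (Rintegral m setT (fun x => phi x * om x)).
Proof.
move=> mphi mom phi0 om0 iphi iphiom; rewrite /dq.
suff -> : dquot (fun s => Rintegral m setT (fun x => phi x * expR (- (s * om x)))) =
   (fun p : nat => p.+1%:R *
     Rintegral m setT (fun x => phi x * (1 - expR (- (p.+1%:R^-1 * om x))))).
  exact: cvg_integral_expRN.
apply/funext => p; rewrite /dquot; congr (_ * _).
under [X in X - _ = _]eq_Rintegral do rewrite mul0r oppr0 expR0 mulr1.
rewrite -RintegralB//.
  by apply: eq_Rintegral => x _; ring.
apply: le_integrableR iphi.
  apply: measurable_funM => //; apply: measurableT_comp => //.
  by apply: measurableT_comp => //; apply: measurable_funM.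
move=> x; rewrite ger0_norm ?mulr_ge0 ?expR_ge0// ler_piMr//.
by rewrite -expR0 ler_expR oppr_le0 mulr_ge0// invr_ge0.
Qed.

End integral_difference_quotient.

(** * Moments from a Laplace functional *)

(** The Leibniz rule on lists of blocks: differentiating a product of block integrals in direction
    [k] gives one term per block, that block receiving [k]. *)
Fixpoint joins (k : nat) (r : seq (seq nat)) : seq (seq (seq nat)) :=
  if r is b :: r' then
    ((k :: b) :: r') :: [seq b :: r'' | r'' <- joins k r']
  else [::].

(* The set partitions of [0 .. K-1], one item being added at a time. *)
Fixpoint configs (K : nat) : seq (seq (seq nat)) :=
  if K is k.+1 then flatten [seq ([:: k] :: r) :: joins k r | r <- configs k]
  else [:: [::]].

Lemma big_configsS (R : Type) (idx : R) (op : Monoid.com_law idx) K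
    (f : seq (seq nat) -> R) :
  \big[op/idx]_(r <- configs K.+1) f r =
  \big[op/idx]_(r <- configs K)
     (op (f ([:: K] :: r)) (\big[op/idx]_(r' <- joins K r) f r')).
Proof.
rewrite /= big_flatten/= big_map; apply: eq_bigr => r _.
by rewrite big_cons.
Qed.

Lemma joins_neq0 k r c : all (fun b => b != [::]) r -> c \in joins k r ->
  all (fun b => b != [::]) c.
Proof.
elim: r c => //= b r ih c /andP[b0 r0]; rewrite inE => /orP[/eqP -> //|].
by move=> /mapP[c' c'r ->] /=; rewrite b0 ih.
Qed.

(** Nonempty blocks matter for convergence: an empty block would contribute the integral of the
    damping alone, against an infinite jump measure. *)
Lemma configs_neq0 K r : r \in configs K -> all (fun b => b != [::]) r.
Proof.
elim: K r => [|K ih] r /=; first by rewrite inE => /eqP ->.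
move=> /flatten_mapP[r' r'K]; rewrite inE => /orP[/eqP -> /=|].
  exact: ih.
by apply: joins_neq0; exact: ih.
Qed.

Section moment_formula.
Context {R : realType} dO (O : measurableType dO) (P : {measure set O -> \bar R})
  dL (L : measurableType dL) (La : {measure set L -> \bar R}).
Variables (theta : R) (n : nat).
Variables (S : nat -> O -> R) (phi : O -> R) (om : nat -> L -> R) (sigma : L -> R).
Hypothesis theta_ge0 : 0 <= theta.
Hypothesis mS : forall k, measurable_fun setT (S k).
Hypothesis mphi : measurable_fun setT phi.
Hypothesis mom : forall k, measurable_fun setT (om k).
Hypothesis msigma : measurable_fun setT sigma.
Hypothesis S0 : forall k w, 0 <= S k w.
Hypothesis phi0 : forall w, 0 <= phi w.
Hypothesis om0 : forall k x, 0 <= om k x.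
Hypothesis iS : forall b : seq nat,
  P.-integrable setT (EFin \o (fun w => (\prod_(k <- b) S k w) * phi w)).
Hypothesis iom : forall b : seq nat, b != [::] ->
  La.-integrable setT (EFin \o (fun x => (\prod_(k <- b) om k x) * expR (- sigma x))).
Hypothesis ilap : forall t : nat -> R, (forall k, 0 <= t k) ->
  La.-integrable setT
    (EFin \o (fun x => 1 - expR (- (\sum_(k < n) t k * om k x + sigma x)))).
Hypothesis laplace : forall t : nat -> R, (forall k, 0 <= t k) ->
  Rintegral P setT (fun w => phi w * expR (- \sum_(k < n) t k * S k w)) =
  expR (- (theta * Rintegral La setT
             (fun x => 1 - expR (- (\sum_(k < n) t k * om k x + sigma x))))).

Let damp (t : nat -> R) x := expR (- (\sum_(k < n) t k * om k x + sigma x)).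

Let blockint (t : nat -> R) (b : seq nat) :=
  theta * Rintegral La setT (fun x => (\prod_(k <- b) om k x) * damp t x).

Let bump (t : nat -> R) (j : nat) (s : R) : nat -> R :=
  fun k => t k + (k == j)%:R * s.

Let bump0 t j : bump t j 0 = t.
Proof. by apply/funext => k; rewrite /bump mulr0 addr0. Qed.

Let bump_ge0 t j s : (forall k, 0 <= t k) -> 0 <= s -> forall k, 0 <= bump t j s k.
Proof. by move=> t0 s0 k; rewrite addr_ge0// mulr_ge0. Qed.

Let sum_bump (t : nat -> R) (j : nat) s (F : nat -> R) : (j < n)%N ->
  \sum_(k < n) bump t j s k * F k = \sum_(k < n) t k * F k + s * F j.
Proof.
move=> jn; rewrite /bump; under eq_bigr do rewrite mulrDl; rewrite big_split/=.
congr (_ + _); rewrite (bigD1 (Ordinal jn))//= eqxx mul1r big1 ?addr0// => i.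
by rewrite -val_eqE/= => /negbTE ->; rewrite !mul0r.
Qed.

Let mdamp t : measurable_fun setT (damp t).
Proof.
apply: measurableT_comp => //; apply: measurableT_comp => //.
apply: measurable_funD => //.
by apply: measurable_sum => k; exact: measurable_funM.
Qed.

Let damp_ge0 t x : 0 <= damp t x. Proof. exact: expR_ge0. Qed.

Let damp_le t x : (forall k, 0 <= t k) -> damp t x <= expR (- sigma x).
Proof.
move=> t0; rewrite ler_expR lerN2 lerDr sumr_ge0// => k _.
by rewrite mulr_ge0.
Qed.

Let prod_ge0 T (f : nat -> T -> R) (b : seq nat) x :
  (forall k x, 0 <= f k x) -> 0 <= \prod_(k <- b) f k x.
Proof. by move=> f0; rewrite big_seq prodr_ge0. Qed.

Let mprod d' (T : measurableType d') (f : nat -> T -> R) (b : seq nat) :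
  (forall k, measurable_fun setT (f k)) ->
  measurable_fun setT (fun x => \prod_(k <- b) f k x).
Proof. by move=> mf; exact: measurable_prod. Qed.

Let iblock t b : b != [::] -> (forall k, 0 <= t k) ->
  La.-integrable setT (EFin \o (fun x => (\prod_(k <- b) om k x) * damp t x)).
Proof.
move=> b0 t0; apply: le_integrableR (iom b0).
  by apply: measurable_funM; [exact: mprod|exact: mdamp].
move=> x; rewrite ger0_norm ?mulr_ge0 ?damp_ge0 ?prod_ge0//.
by rewrite ler_wpM2l ?prod_ge0// damp_le.
Qed.

Let damp_bump t j s x : (j < n)%N ->
  damp (bump t j s) x = damp t x * expR (- (s * om j x)).
Proof.
move=> jn; rewrite /damp (@sum_bump t j s (fun k => om k x) jn) -expRD.
by congr expR; ring.
Qed.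

Let dq_block t j b : b != [::] -> (j < n)%N -> (forall k, 0 <= t k) ->
  dq (fun s => blockint (bump t j s) b) (blockint t (j :: b)).
Proof.
move=> b0 jn t0; rewrite /blockint; apply: dqZ.
pose psi x := (\prod_(k <- b) om k x) * damp t x.
have -> : (fun s => Rintegral La setT
      (fun x => (\prod_(k <- b) om k x) * damp (bump t j s) x)) =
    (fun s => Rintegral La setT (fun x => psi x * expR (- (s * om j x)))).
  by apply/funext => s; apply: eq_Rintegral => x _; rewrite damp_bump// /psi mulrA.
have -> : Rintegral La setT (fun x => \prod_(k <- j :: b) om k x * damp t x) =
    Rintegral La setT (fun x => psi x * om j x).
  by apply: eq_Rintegral => x _; rewrite big_cons /psi; ring.
apply: dq_integral => //.
- by apply: measurable_funM; [exact: mprod|exact: mdamp].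
- by move=> x; rewrite mulr_ge0// prod_ge0.
- exact: iblock.
- rewrite (_ : (fun x => psi x * om j x) =
      (fun x => (\prod_(k <- j :: b) om k x) * damp t x)); first exact: iblock.
  by apply/funext => x; rewrite big_cons /psi; ring.
Qed.

Let dq_prod t j r : all (fun b => b != [::]) r -> (j < n)%N ->
  (forall k, 0 <= t k) ->
  dq (fun s => \prod_(b <- r) blockint (bump t j s) b)
     (\sum_(r' <- joins j r) \prod_(b <- r') blockint t b).
Proof.
move=> + jn t0; elim: r => [_|b r ih /= /andP[b0 r0]].
  rewrite /= big_nil (_ : (fun _ => _) = fun=> 1); first exact: dq_cst.
  by apply/funext => s; rewrite big_nil.
have -> : (fun s => \prod_(c <- b :: r) blockint (bump t j s) c) =
    (fun s => blockint (bump t j s) b * \prod_(c <- r) blockint (bump t j s) c).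
  by apply/funext => s; rewrite big_cons.
have h := dqM (dq_block b0 jn t0) (ih r0); rewrite bump0 in h.
rewrite big_cons big_cons big_map.
under [X in dq _ (_ + X)]eq_bigr do rewrite big_cons.
rewrite -big_distrr; exact: h.
Qed.

Let Lap t := expR (- (theta * Rintegral La setT (fun x => 1 - damp t x))).

Let dq_Lap t j : (j < n)%N -> (forall k, 0 <= t k) ->
  dq (fun s => Lap (bump t j s)) (blockint t [:: j] * Lap t).
Proof.
move=> jn t0.
pose I s := Rintegral La setT (fun x => 1 - damp (bump t j s) x).
have I0 : I 0 = Rintegral La setT (fun x => 1 - damp t x) by rewrite /I bump0.
(* Integrability is available for 1 - damp, not for damp: the two exponents are subtracted first,
   and the factor damp is pulled out afterwards. *)
have Idiff s : 0 <= s -> I s - I 0 =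
    Rintegral La setT (fun x => damp t x * (1 - expR (- (s * om j x)))).
  move=> s0.
  rewrite I0 -(RintegralB measurableT (ilap (bump_ge0 j t0 s0)) (ilap t0)).
  apply: eq_Rintegral => x _.
  rewrite -/(damp (bump t j s) x) -/(damp t x) (@damp_bump t j s x jn); ring.
have ij : La.-integrable setT (EFin \o (fun x => damp t x * om j x)).
  have := @iblock t [:: j] isT t0; apply: le_integrableR.
    by apply: measurable_funM => //; exact: mdamp.
  move=> x; rewrite big_seq1 ger0_norm; first by rewrite mulrC lexx.
  exact: mulr_ge0 (damp_ge0 t x) (om0 j x).
have -> : Lap t = expR (- (fun s => theta * I s) 0) by rewrite /Lap -I0.
apply: (@dq_expRN R (fun s => theta * I s)).
  move=> s s0; apply: (ler_wpM2l theta_ge0); rewrite -subr_ge0 (Idiff _ s0).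
  apply: Rintegral_ge0 => x _; apply: (mulr_ge0 (damp_ge0 t x)).
  by rewrite subr_ge0 -expR0 ler_expR oppr_le0 mulr_ge0.
rewrite /blockint -mulrN; apply: dqZ; rewrite /dq.
rewrite (_ : dquot I = - (fun p : nat => p.+1%:R * Rintegral La setT
   (fun x => damp t x * (1 - expR (- (p.+1%:R^-1 * om j x)))))); last first.
  apply/funext => p; rewrite /dquot opprfctE.
  have p0 : 0 <= p.+1%:R^-1 :> R by rewrite invr_ge0.
  by rewrite -(Idiff _ p0) -mulrN opprB.
rewrite (_ : (fun x => \prod_(k <- [:: j]) om k x * damp t x) =
    (fun x => damp t x * om j x)); last first.
  by apply/funext => x; rewrite big_seq1 mulrC.
apply: cvgN.
exact: (cvg_integral_expRN (mdamp t) (mom j) (damp_ge0 t) (om0 j) ij).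
Qed.

(** Induction on the number of directions already differentiated, with the parameter [t] free so
    that direction [K] can still be differentiated. The prefactor [Lap] opens the block of [K]
    alone, and each block integral lets [K] join: this is the recursion of [configs]. *)
Let moment K (t : nat -> R) : (K <= n)%N -> (forall k, 0 <= t k) ->
  Rintegral P setT (fun w => (\prod_(k < K) S k w) * phi w *
                             expR (- \sum_(k < n) t k * S k w)) =
  Lap t * \sum_(r <- configs K) \prod_(b <- r) blockint t b.
Proof.
elim: K t => [|K ih] t Kn t0.
  rewrite /= big_seq1 big_nil mulr1 /Lap /damp -(laplace t0).
  by apply: eq_Rintegral => w _; rewrite big_ord0 mul1r.
pose J s := Rintegral P setT (fun w => (\prod_(k < K) S k w) * phi w *
                             expR (- \sum_(k < n) bump t K s k * S k w)).
pose G s := Lap (bump t K s) *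
  \sum_(r <- configs K) \prod_(b <- r) blockint (bump t K s) b.
have JG s : 0 <= s -> J s = G s.
  by move=> s0; rewrite /J ih// ?(ltnW Kn)// => k; exact: bump_ge0.
have mE : measurable_fun setT (fun w => expR (- \sum_(k < n) t k * S k w)).
  apply: measurableT_comp => //; apply: measurableT_comp => //.
  by apply: measurable_sum => k; exact: measurable_funM.
have E1 w : 0 <= expR (- \sum_(k < n) t k * S k w) <= 1.
  rewrite expR_ge0/= -expR0 ler_expR oppr_le0 sumr_ge0// => k _.
  by rewrite mulr_ge0.
pose psi w := (\prod_(k < K) S k w) * phi w * expR (- \sum_(k < n) t k * S k w).
have prodE N w : \prod_(k < N) S k w = \prod_(k <- iota 0 N) S k w.
  by rewrite -(big_mkord predT (fun k => S k w)) /index_iota subn0.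
have mpsi : measurable_fun setT psi.
  apply: measurable_funM => //; apply: measurable_funM => //.
  by apply: measurable_prod.
have psi0 w : 0 <= psi w.
  by rewrite /psi !mulr_ge0 ?expR_ge0//; apply: prodr_ge0.
have ipsi : P.-integrable setT (EFin \o psi).
  apply: le_integrableR (iS (iota 0 K)) => // w.
  rewrite -prodE ger0_norm// /psi; have /andP[e0 e1] := E1 w.
  by rewrite ler_piMr// mulr_ge0// prodr_ge0.
have ipsiS : P.-integrable setT (EFin \o (fun w => psi w * S K w)).
  apply: le_integrableR (iS (iota 0 K.+1)); first exact: measurable_funM.
  move=> w; rewrite -(prodE K.+1) big_ord_recr/=.
  rewrite (ger0_norm (mulr_ge0 (psi0 w) (S0 K w))) /psi.
  have /andP[e0 e1] := E1 w.
  rewrite [leLHS](_ : _ = \prod_(i < K) S i w * S K w * phi w *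
    expR (- (\sum_(k < n) t k * S k w))); last by ring.
  by apply: ler_piMr => //; rewrite !mulr_ge0// prodr_ge0.
have dJ : dq J (Rintegral P setT (fun w => psi w * S K w)).
  rewrite (_ : J = fun s => Rintegral P setT (fun w => psi w * expR (- (s * S K w)))).
    exact: (dq_integral mpsi (mS K) psi0 (S0 K) ipsi ipsiS).
  apply/funext => s; apply: eq_Rintegral => w _.
  rewrite (@sum_bump t K s (fun k => S k w) Kn) /psi -[RHS]mulrA -expRD.
  by congr (_ * expR _); ring.
have dG : dq G (blockint t [:: K] * Lap t *
      (\sum_(r <- configs K) \prod_(b <- r) blockint (bump t K 0) b) +
    Lap (bump t K 0) * (\sum_(r <- configs K)
      \sum_(r' <- joins K r) \prod_(b <- r') blockint t b)).
  apply: dqM; first exact: dq_Lap.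
  by apply: dq_sum => r /configs_neq0 r0; exact: dq_prod.
(* [J] and [G] are compared at nonnegative arguments only, and the quotients sample no others. *)
have JGd : dquot J = dquot G.
  by apply/funext => p; rewrite /dquot !JG// invr_ge0.
rewrite /dq JGd in dJ.
have h := cvg_unique (@Rhausdorff R) dJ dG; rewrite bump0 in h.
transitivity (Rintegral P setT (fun w => psi w * S K w)).
  by apply: eq_Rintegral => w _; rewrite big_ord_recr/= /psi; ring.
rewrite h big_configsS/= big_split/=.
under [X in _ * (X + _)]eq_bigr do rewrite big_cons.
by rewrite -big_distrr/=; ring.
Qed.

Lemma moment_formula :
  Rintegral P setT (fun w => (\prod_(k < n) S k w) * phi w) =
  expR (- (theta * Rintegral La setT (fun x => 1 - expR (- sigma x)))) *
  \sum_(r <- configs n) \prod_(b <- r)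
    (theta * Rintegral La setT (fun x => (\prod_(k <- b) om k x) * expR (- sigma x))).
Proof.
have dampE x : damp (fun=> 0) x = expR (- sigma x).
  by rewrite /damp big1 ?add0r// => k _; rewrite mul0r.
have := @moment n (fun=> 0) (leqnn n) (fun=> lexx 0).
rewrite /Lap /blockint; under [in RHS]eq_Rintegral do rewrite dampE.
under [X in _ = _ * X -> _]eq_bigr do under eq_bigr do under eq_Rintegral do rewrite dampE.
move=> <-; apply: eq_Rintegral => w _.
by rewrite [X in expR (- X)]big1 ?oppr0 ?expR0 ?mulr1// => k _; rewrite mul0r.
Qed.

End moment_formula.

(** * Independence and the Laplace functional of a completely random vector *)

Section integral_of_product.
Context {R : realType} dS (S : measurableType dS) (P : {measure set S -> \bar R})
  dT (T : measurableType dT) (m : {measure set T -> \bar R}).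
Variables (W : S -> R) (V : S -> T) (c : R).
Hypothesis mW : measurable_fun setT W.
Hypothesis W0 : forall w, 0 <= W w.
Hypothesis mV : measurable_fun setT V.
Hypothesis WV : forall B, measurable B ->
  (\int[P]_(w in V @^-1` B) (W w)%:E = c%:E * m B)%E.

Import HBNNSimple.

Let integral_weight_nnsfun (h : {nnsfun T >-> R}) :
  (\int[P]_w ((W w)%:E * (h (V w))%:E) = c%:E * \int[m]_x (h x)%:E)%E.
Proof.
have mh y : measurable (h @^-1` [set y]) by exact: measurable_sfunP.
have mVh y : measurable (V @^-1` (h @^-1` [set y])).
  by rewrite -[X in measurable X]setTI; exact: mV.
transitivity (\int[P]_w (\sum_(y \in range h)
    (y%:E * ((W w)%:E * (\1_(V @^-1` (h @^-1` [set y])) w)%:E))))%E.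
  apply: eq_integral => w _; rewrite (fimfunE h (V w)) -fsumEFin//.
  rewrite ge0_mule_fsumr; last by move=> y; rewrite EFinM nnfun_muleindic_ge0.
  by apply: eq_fsbigr => y _; rewrite EFinM muleCA.
rewrite ge0_integral_fsum//; last 2 first.
- move=> y; apply/measurable_EFinP; apply: measurable_funM => //.
  by apply: measurable_funM => //; exact: measurable_indic.
- move=> y w _; have [y0|y0] := leP 0 y.
    by rewrite mule_ge0 ?lee_fin// mulr_ge0.
  rewrite preimage_nnfun0// preimage_set0 indic0 mule0 mule0//.
transitivity (\int[m]_x (\sum_(y \in range h)
    (y%:E * (\1_(h @^-1` [set y]) x)%:E)) * c%:E)%E; last first.
  rewrite muleC; congr (_ * _)%E; apply: eq_integral => x _.
  by rewrite (fimfunE h x) -fsumEFin.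
rewrite ge0_integral_fsum//; last 2 first.
- move=> y; apply/measurable_EFinP; apply: measurable_funM => //.
- by move=> y x _; rewrite nnfun_muleindic_ge0.
rewrite ge0_mule_fsuml; last first.
  by move=> y; apply: integral_ge0 => x _; rewrite nnfun_muleindic_ge0.
apply: eq_fsbigr => y; rewrite inE => -[x _ <-{y}].
rewrite ge0_integralZl//; last 3 first.
- by apply/measurable_EFinP/measurable_funM => //; exact: measurable_indic.
- by move=> w _; rewrite lee_fin mulr_ge0.
- by rewrite lee_fin.
rewrite ge0_integralZl//; last 2 first.
- exact/measurable_EFinP/measurable_indic.
- by rewrite lee_fin.
rewrite -muleA; congr (_ * _)%E.
rewrite integral_indic// setIT muleC -WV//.
rewrite [RHS]integral_mkcond; apply: eq_integral => w _.
by rewrite epatch_indic.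
Qed.

(** The image under [V] of the measure with density [W] is [c] times [m]; simple functions and
    monotone limits lead from sets to functions. It is used for independence, where [W] is the
    product of the other factors, and for densities, where [V] is the identity. *)
Lemma integral_weight (f : T -> \bar R) : measurable_fun setT f ->
  (forall x, (0 <= f x)%E) ->
  (\int[P]_w ((W w)%:E * f (V w)) = c%:E * \int[m]_x f x)%E.
Proof.
move=> mf f0; pose h := nnsfun_approx measurableT mf.
have hf x : (EFin \o h ^~ x) @ \oo --> f x by exact: cvg_nnsfun_approx.
have mh n : measurable_fun setT (h n) by exact: measurable_funP.
transitivity (limn (fun n => \int[P]_w ((W w)%:E * (h n (V w))%:E)%E))%E.
  rewrite -monotone_convergence//=.
  - apply: eq_integral => w _; apply/esym/cvg_lim => //.
    by apply: cvgeZl => //; exact: hf.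
  - move=> n; apply/measurable_EFinP/measurable_funM => //.
    exact: measurableT_comp.
  - by move=> n w _; rewrite lee_fin mulr_ge0.
  - move=> w _ a b ab; rewrite lee_fin ler_wpM2l//.
    exact/lefP/nd_nnsfun_approx.
under eq_fun do rewrite integral_weight_nnsfun.
transitivity (c%:E * limn (fun n => \int[m]_x (h n x)%:E))%E.
  rewrite limeMl//; apply: ereal_nondecreasing_is_cvgn => a b ab.
  apply: ge0_le_integral => //.
  - by move=> x _; rewrite lee_fin.
  - exact/measurable_EFinP.
  - exact/measurable_EFinP.
  - by move=> x _; rewrite lee_fin; exact/lefP/nd_nnsfun_approx.
congr (_ * _)%E; rewrite -monotone_convergence//=.
- by apply: eq_integral => x _; apply/cvg_lim => //; exact: hf.
- by move=> n; exact/measurable_EFinP.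
- by move=> n x _; rewrite lee_fin.
- by move=> x _ a b ab; rewrite lee_fin; exact/lefP/nd_nnsfun_approx.
Qed.

End integral_of_product.

Section independence.
Context {R : realType} dS (S : measurableType dS) (P : probability S R)
  dT (T : measurableType dT).
Variables (V : nat -> S -> T) (N : nat).
Hypothesis mV : forall i, measurable_fun setT (V i).
Hypothesis indep : forall B : nat -> set T, (forall i, measurable (B i)) ->
  (P (\bigcap_(i in `I_N) (V i @^-1` B i)) =
  \prod_(i < N) P (V i @^-1` B i))%E.

Lemma integral_prod_indep (f : nat -> T -> R) :
  (forall i, measurable_fun setT (f i)) -> (forall i x, 0 <= f i x <= 1) ->
  (\int[P]_w (\prod_(i < N) f i (V i w))%:E =
   \prod_(i < N) \int[P]_w (f i (V i w))%:E)%E.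
Proof.
move=> mf f01.
(* Factors are freed one at a time: those of index at least [j] are still indicators. The hypothesis
   on events is the case [j = 0]. *)
suff H j (g : nat -> T -> R) : (j <= N)%N ->
    (forall i, measurable_fun setT (g i)) -> (forall i x, 0 <= g i x <= 1) ->
    (forall i, (j <= i)%N -> exists2 B, measurable B & g i = \1_B) ->
    (\int[P]_w (\prod_(i < N) g i (V i w))%:E =
      \prod_(i < N) \int[P]_w (g i (V i w))%:E)%E.
  (* Padding by the constant 1 beyond [N] makes the indicator condition hold for all indices at
     [j = N]. *)
  pose g i := if (i < N)%N then f i else \1_setT.
  transitivity (\int[P]_w (\prod_(i < N) g i (V i w))%:E)%E.
    by apply: eq_integral => w _; congr EFin; apply: eq_bigr => i _; rewrite /g ltn_ord.
  rewrite (H N)//.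
  - by apply: eq_bigr => i _; rewrite /g ltn_ord.
  - by move=> i; rewrite /g; case: ifP.
  - move=> i x; rewrite /g; case: ifP => // _.
    by rewrite indicE; case: (_ \in _); rewrite ?lexx ?ler01.
  - by move=> i Ni; exists setT => //; rewrite /g ltnNge Ni.
elim: j g => [|j ih] g jN mg g01 gB.
  have /choice[B HB] : forall i, exists B, measurable B /\ g i = \1_B.
    by move=> i; have [B mB gi] := gB i isT; exists B.
  have mB i : measurable (B i) by have [] := HB i.
  have mVB i : measurable (V i @^-1` B i).
    by rewrite -[X in measurable X]setTI; exact: mV.
  transitivity (\int[P]_w (\1_(\bigcap_(i in `I_N) (V i @^-1` B i)) w)%:E)%E.
    apply: eq_integral => w _; congr EFin; rewrite indicE.
    have [/set_mem h|/negP h] := boolP (w \in _).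
      by rewrite big1// => i _; have [_ ->] := HB i; rewrite indicE mem_set//; apply: h => /=.
    have [i iN nB] : exists2 i, (i < N)%N & ~ B i (V i w).
      apply: contrapT => hh; apply: h; apply/mem_set => i /= iN.
      by apply: contrapT => hB; apply: hh; exists i.
    rewrite (bigD1 (Ordinal iN))//=; have [_ ->] := HB i.
    by rewrite indicE memNset// mul0r.
  transitivity (P (\bigcap_(i in `I_N) (V i @^-1` B i))).
    by rewrite integral_indic ?setIT//; apply: fin_bigcap_measurable.
  rewrite (indep mB); apply: eq_bigr => i _.
  have [_ ->] := HB i.
  transitivity (\int[P]_w (\1_(V i @^-1` B i) w)%:E)%E.
    by rewrite integral_indic// setIT.
  by apply: eq_integral => w _; rewrite !indicE.
pose J := Ordinal jN.
pose W w := \prod_(i < N | i != J) g i (V i w).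
have int01 i : (0 <= \int[P]_w (g i (V i w))%:E <= 1)%E.
  rewrite integral_ge0/=; last first.
    by move=> w _; rewrite lee_fin; have /andP[] := g01 i (V i w).
  rewrite -(@probability_setT _ _ _ P) -[leRHS]mul1e -integral_cst//.
  apply: ge0_le_integral => //.
  - by move=> w _; rewrite lee_fin; have /andP[] := g01 i (V i w).
  - by apply/measurable_EFinP; exact: measurableT_comp.
  - by move=> w _; rewrite lee_fin; have /andP[] := g01 i (V i w).
have intfin i : (\int[P]_w (g i (V i w))%:E \is a fin_num)%E.
  have /andP[h1 h2] := int01 i; rewrite ge0_fin_numE//.
  by apply: le_lt_trans h2 _; rewrite ltry.
pose c := \prod_(i < N | i != J) fine (\int[P]_w (g i (V i w))%:E)%E.
have cE : (\prod_(i < N | i != J) \int[P]_w (g i (V i w))%:E = c%:E)%E.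
  rewrite /c -prodEFin; apply: eq_bigr => i _; rewrite fineK//.
have mW : measurable_fun setT W.
  rewrite /W; under eq_fun do rewrite big_mkcond.
  by apply: measurable_prod => i _; case: (i != J) => //; exact: measurableT_comp.
have W0 w : 0 <= W w.
  by apply: prodr_ge0 => i _; have /andP[] := g01 i (V i w).
pose mVj : {mfun S >-> T} := HB.pack (V j) (isMeasurableFun.Build _ _ _ _ (V j) (mV j)).
have WV B : measurable B ->
    (\int[P]_(w in V j @^-1` B) (W w)%:E = c%:E * pushforward P mVj B)%E.
  move=> mB.
  have mVB : measurable (V j @^-1` B).
    by rewrite -[X in measurable X]setTI; exact: mV.
  (* Putting an indicator in place of factor [j] gives an instance of the induction hypothesis,
     which yields the identity on sets that [integral_weight] asks for. *)
  pose g' i := if i == j then \1_B else g i : T -> R.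
  have g'E (i : 'I_N) : i != J -> g' i = g i.
    by rewrite -val_eqE/= /g' => /negbTE ->.
  have g'J : g' j = \1_B by rewrite /g' eqxx.
  have H : (\int[P]_w (\prod_(i < N) g' i (V i w))%:E =
      \prod_(i < N) \int[P]_w (g' i (V i w))%:E)%E.
    apply: ih (ltnW jN) _ _ _ => i.
    - by rewrite /g'; case: ifP => // _; exact: measurable_indic.
    - move=> x; rewrite /g'; case: ifP => // _.
      by rewrite indicE; case: (_ \in _); rewrite ?lexx ?ler01.
    - move=> ji; rewrite /g'; case: eqP => [_|/eqP ij]; first by exists B.
      by apply: gB; rewrite ltn_neqAle eq_sym ij.
  transitivity (\int[P]_w (\prod_(i < N) g' i (V i w))%:E)%E.
    rewrite integral_mkcond; apply: eq_integral => w _.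
    rewrite (bigD1 J)//= g'J epatch_indic/= -EFinM mulrC; congr EFin; congr (_ * _).
    by apply: eq_bigr => i iJ; rewrite g'E.
  rewrite H (bigD1 J)//= g'J muleC; congr (_ * _)%E.
    by rewrite -cE; apply: eq_bigr => i iJ; rewrite g'E.
  transitivity (\int[P]_w (\1_(V j @^-1` B) w)%:E)%E.
    by apply: eq_integral => w _; rewrite !indicE.
  by rewrite integral_indic// setIT.
rewrite (bigD1 J)//= cE muleC.
transitivity (c%:E * \int[pushforward P mVj]_x (g j x)%:E)%E; last first.
  congr (_ * _)%E; apply: ge0_integral_pushforward => //.
    exact/measurable_EFinP.
  by move=> x _; rewrite lee_fin; have /andP[] := g01 j x.
have mEg : measurable_fun setT (EFin \o g j) by exact/measurable_EFinP.
have Eg0 x : (0 <= (EFin \o g j) x)%E by rewrite lee_fin; have /andP[] := g01 j x.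
rewrite -(integral_weight mW W0 (mV j) WV mEg Eg0); last exact: mV.
by apply: eq_integral => w _; rewrite (bigD1 J)//= EFinM muleC.
Qed.

End independence.

Section expmE.
Context {R : realType}.
Implicit Types x y : \bar R.

Lemma expmED x y : (0 <= x)%E -> (0 <= y)%E -> expmE (x + y)%E = expmE x * expmE y.
Proof.
by case: x y => [x| |] [y| |]//= _ _; rewrite ?mulr0 ?mul0r// opprD expRD.
Qed.

Lemma expmE_sum (I : Type) (s : seq I) (f : I -> \bar R) :
  (forall i, (0 <= f i)%E) -> expmE (\sum_(i <- s) f i)%E = \prod_(i <- s) expmE (f i).
Proof.
move=> f0; elim: s => [|i s ih]; first by rewrite !big_nil /= oppr0 expR0.
by rewrite !big_cons expmED// ?ih//; apply: sume_ge0.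
Qed.

Lemma expmE_ge0_le1 x : (0 <= x)%E -> 0 <= expmE x <= 1.
Proof.
case: x => [x| |]//=; rewrite ?lexx ?ler01// lee_fin => x0.
by rewrite expR_ge0/= -expR0 ler_expR oppr_le0.
Qed.

Lemma measurable_expmE : measurable_fun setT (@expmE R).
Proof.
rewrite (_ : @expmE R = (fun x => if x \is a fin_num then expR (- fine x) else 0)).
  apply: measurable_fun_ifT => //.
    apply: (measurable_fun_bool true) => /=.
    have := emeasurable_fin_num measurableT (@measurable_id _ (\bar R) setT).
    by rewrite setTI.
  apply: measurableT_comp => //; apply: measurableT_comp => //.
by apply/funext => -[x| |].
Qed.

End expmE.

Section jump_coordinates.
Context {R : realType}.

(** Positive parts make the jump coordinates nonnegative everywhere rather than almost everywhere;
    they differ from the coordinates only on a null set of [rho]. The boolean [true] stands for the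
    first measure. *)
Definition pos_jump (e : bool) (s : measurableTypeR R * measurableTypeR R) : R :=
  Num.max 0 (if e then s.1 else s.2).

Lemma pos_jump_ge0 e s : 0 <= pos_jump e s.
Proof. by rewrite /pos_jump le_max lexx. Qed.

Lemma measurable_pos_jump e : measurable_fun setT (pos_jump e).
Proof.
apply: measurable_maxr => //.
by case: e; [exact: measurable_fst|exact: measurable_snd].
Qed.

Variable rho : {measure set (measurableTypeR R * measurableTypeR R)%type -> \bar R}.
Hypothesis Hrho_supp :
  rho (~` ([set s | 0 <= s.1 /\ 0 <= s.2] `\` [set (0, 0)])) = 0%E.

Lemma measurable_quadrant : measurable
  ([set s : measurableTypeR R * measurableTypeR R | 0 <= s.1 /\ 0 <= s.2] `\` [set (0, 0)]).
Proof.
apply: measurableD.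
  rewrite (_ : [set _ | _] = (fst @^-1` `[0, +oo[) `&` (snd @^-1` `[0, +oo[)).
    apply: measurableI; rewrite -[X in measurable X]setTI;
    [exact: measurable_fst|exact: measurable_snd].
  by apply/seteqP; split => s /=; rewrite !in_itv/= !andbT => -[].
rewrite (_ : [set _] = [set 0] `*` [set 0]); last first.
  by apply/seteqP; split => [s /= -> //|[a b] /= [-> ->]].
by apply: measurableX; exact: measurable_set1.
Qed.

Lemma ae_pos_jump : {ae rho, forall s, 0 <= s.1 /\ 0 <= s.2 /\ 0 < s.1 + s.2}.
Proof.
exists (~` ([set s | 0 <= s.1 /\ 0 <= s.2] `\` [set (0, 0)])); split.
- by apply: measurableC; exact: measurable_quadrant.
- exact: Hrho_supp.
- apply: subsetC => -[a b] /= [[a0 b0] ab]; split => //; split => //.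
  rewrite lt_neqAle addr_ge0// andbT eq_sym paddr_eq0//.
  by apply/negP => /andP[/eqP ? /eqP ?]; apply: ab; subst.
Qed.

Lemma pos_jumpE s : 0 <= s.1 -> 0 <= s.2 ->
  pos_jump true s = s.1 /\ pos_jump false s = s.2.
Proof. by move=> h1 h2; split; apply/max_idPr. Qed.

End jump_coordinates.

(** * Laplace functional on overlapping sets *)

Section laplace_functional.
Context {R : realType} dZ (Z : measurableType dZ) (G0 : probability Z R).
Variables (theta : R)
  (rho : {sigma_finite_measure set (measurableTypeR R * measurableTypeR R)%type -> \bar R}).
Hypothesis Hrho_supp :
  rho (~` ([set s | 0 <= s.1 /\ 0 <= s.2] `\` [set (0, 0)])) = 0%E.
Hypothesis Hrho_int : (\int[rho]_s (Num.min 1 (pos_jump true s + pos_jump false s))%:E < +oo)%E.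
Variables (dO : measure_display) (Omega : measurableType dO) (P : probability Omega R).
Variable mu : bool -> Omega -> {measure set Z -> \bar R}.
Hypothesis mmu : forall e A, measurable A -> measurable_fun setT (fun w => mu e w A).
Hypothesis indep_mu : forall (N : nat) (A : nat -> set Z) (B : nat -> set (\bar R * \bar R)%type),
  (forall i, (i < N)%N -> measurable (A i) /\ measurable (B i)) ->
  (forall i j, (i < N)%N -> (j < N)%N -> i <> j -> A i `&` A j = set0) ->
  P (\bigcap_(i in `I_N) [set w | B i (mu true w (A i), mu false w (A i))]) =
  (\prod_(i < N) P [set w | B i (mu true w (A i), mu false w (A i))])%E.
Hypothesis laplace_mu : forall (A : set Z) (l1 l2 : R), measurable A -> 0 <= l1 -> 0 <= l2 ->
  (\int[P]_w (expmE (l1%:E * mu true w A + l2%:E * mu false w A)%E)%:E)%E =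
  (expR (- (theta * fine (G0 A) *
     fine (\int[rho]_s (1 - expR (- (l1 * s.1 + l2 * s.2)))%:E)%E)))%:E.

(** A point of the product space is a jump together with its location; this is what it adds to
    [mu (e k) w (E k)], the mass that item [k] looks at. *)
Definition jump_in (e : nat -> bool) (E : nat -> set Z) (k : nat)
    (x : (measurableTypeR R * measurableTypeR R) * Z) : R :=
  pos_jump (e k) x.1 * \1_(E k) x.2.

Let bigjump s := pos_jump true s + pos_jump false s : R.

Let bigjump_ge0 s : 0 <= bigjump s.
Proof. by rewrite addr_ge0// pos_jump_ge0. Qed.

Lemma integrable_min_jump :
  (rho \x G0)%E.-integrable setT
    (EFin \o (fun x => Num.min 1 (pos_jump true x.1 + pos_jump false x.1))).
Proof.
have m1 : measurable_fun setT (fun x : (measurableTypeR R * measurableTypeR R) * Z =>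
    Num.min 1 (pos_jump true x.1 + pos_jump false x.1)).
  apply: measurable_minr => //; apply: measurable_funD;
  by apply: measurableT_comp => //; exact: measurable_pos_jump.
apply/integrableP; split; first exact/measurable_EFinP.
under eq_integral => x _.
  rewrite gee0_abs/=; last by rewrite lee_fin le_min ler01 bigjump_ge0.
  over.
rewrite (fubini_tonelli1 (fun x : (measurableTypeR R * measurableTypeR R) * Z =>
    (Num.min 1 (pos_jump true x.1 + pos_jump false x.1))%:E))//=.
- rewrite /fubini_F/=; move: Hrho_int; congr (_ < _)%E; apply: eq_integral => s _.
  rewrite -[LHS]mule1 -(@probability_setT _ _ _ G0) -(integral_cst G0 measurableT).
  exact: eq_integral.
- exact/measurable_EFinP.
- by move=> x; rewrite lee_fin le_min ler01 bigjump_ge0.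
Qed.

Let psi (a b : R) := (\int[rho]_s
  (1 - expR (- (a * pos_jump true s + b * pos_jump false s)))%:E)%E.

Let mpsi a b : measurable_fun setT (fun s : measurableTypeR R * measurableTypeR R =>
  1 - expR (- (a * pos_jump true s + b * pos_jump false s)) : R).
Proof.
apply: measurable_funB => //; apply: measurableT_comp => //.
apply: measurableT_comp => //; apply: measurable_funD;
by apply: measurable_funM => //; exact: measurable_pos_jump.
Qed.

Let psi_ge0 a b (s : measurableTypeR R * measurableTypeR R) : 0 <= a -> 0 <= b ->
  0 <= 1 - expR (- (a * pos_jump true s + b * pos_jump false s)).
Proof.
move=> a0 b0; rewrite subr_ge0 -expR0 ler_expR oppr_le0.
by rewrite addr_ge0// mulr_ge0// pos_jump_ge0.
Qed.

Let psiE a b : (\int[rho]_s (1 - expR (- (a * s.1 + b * s.2)))%:E)%E = psi a b.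
Proof.
apply: ae_eq_integral => //.
- apply/measurable_EFinP.
  apply: measurable_funB => //; apply: measurableT_comp => //.
  apply: measurableT_comp => //; apply: measurable_funD;
  by apply: measurable_funM.
- apply/measurable_EFinP; exact: mpsi.
- have [N [mN N0 NS]] := ae_pos_jump Hrho_supp; exists N; split => //.
  apply: subset_trans NS; apply: subsetC => s [h1 [h2 _]] _.
  by have [-> ->] := pos_jumpE h1 h2.
Qed.

Section items.
Variables (n : nat) (e : nat -> bool) (E : nat -> set Z) (t : nat -> R).
Hypothesis mE : forall k, measurable (E k).
Hypothesis t0 : forall k, 0 <= t k.

Let FF : finType := {ffun 'I_n -> bool}.
(** The pattern of memberships cuts the space into at most 2^n disjoint cells. On a cell the energy
    is a fixed linear combination of the two jump coordinates, so that independence and the one-set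
    Laplace formula apply cell by cell. *)
Let pat (z : Z) : FF := [ffun k : 'I_n => z \in E k].
Let cell (p : FF) : set Z := [set z | pat z = p].
Let ca (b : bool) (p : FF) : R := \sum_(k < n) ((e k == b) && p k)%:R * t k.

Let ca_ge0 b p : 0 <= ca b p.
Proof. by apply: sumr_ge0 => k _; rewrite mulr_ge0. Qed.

Let mcell p : measurable (cell p).
Proof.
rewrite (_ : cell p = \bigcap_(k in [set: 'I_n]) (if p k then E k else ~` E k)).
  by apply: fin_bigcap_measurable => // k _; case: ifP => // _; exact: measurableC.
apply/seteqP; split => [z /= <- k _ /=|z /= h].
  by rewrite ffunE; have [/set_mem//|/negP h] := boolP (z \in E k); move=> Ez; apply: h; exact/mem_set.
apply/ffunP => k; rewrite ffunE; have := h k I.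
by case: (p k) => [/mem_set ->//|/= Ez]; apply/negbTE/negP => /set_mem.
Qed.

Let cell_disj p q : p <> q -> cell p `&` cell q = set0.
Proof. by move=> pq; apply/seteqP; split => // z [/= zp zq]; apply: pq; rewrite -zp -zq. Qed.

Let measure_cells (m : {measure set Z -> \bar R}) (k : 'I_n) :
  (m (E k) = \sum_(p : FF) (p k)%:R%:E * m (cell p))%E.
Proof.
transitivity (\int[m]_z (\1_(E k) z)%:E)%E; first by rewrite integral_indic// setIT.
transitivity (\int[m]_z (\sum_(p : FF) (p k)%:R%:E * (\1_(cell p) z)%:E))%E.
  apply: eq_integral => z _; rewrite (bigD1 (pat z))//= big1 ?adde0.
    by rewrite !indicE [in X in _ = (_ * X)%E]mem_set//= mule1 ffunE.
  by move=> p pz; rewrite indicE memNset ?mule0//= => pz'; move: pz; rewrite pz' eqxx.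
rewrite ge0_integral_sum//; last by
  first [move=> p; apply/measurable_EFinP/measurable_funM => //; exact: measurable_indic
        |move=> p z _; rewrite lee_fin mulr_ge0].
apply: eq_bigr => p _; rewrite ge0_integralZl//;
  try by first [exact/measurable_EFinP/measurable_indic|rewrite lee_fin].
by rewrite integral_indic// setIT.
Qed.

Let energy_cells w :
  (\sum_(k < n) (t k)%:E * mu (e k) w (E k) =
   \sum_(p : FF) ((ca true p)%:E * mu true w (cell p) +
                  (ca false p)%:E * mu false w (cell p)))%E.
Proof.
under eq_bigr => k _.
  rewrite measure_cells ge0_sume_distrr; last first.
    by move=> p _; rewrite mule_ge0// lee_fin.
  over.
rewrite exchange_big/=; apply: eq_bigr => p _; rewrite /ca -!sumEFin.
rewrite !ge0_sume_distrl; last 2 first.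
- by move=> k _; rewrite lee_fin mulr_ge0.
- by move=> k _; rewrite lee_fin mulr_ge0.
rewrite -big_split/=; apply: eq_bigr => k _.
by case: (e k); case: (p k); rewrite /= ?mul1r ?mul0r ?mul1e ?mul0e ?mule0 ?adde0 ?add0e.
Qed.

Let laplace_cells :
  (\int[P]_w (\prod_(p : FF) expmE ((ca true p)%:E * mu true w (cell p) +
                                     (ca false p)%:E * mu false w (cell p))%E)%:E =
   \prod_(p : FF) \int[P]_w (expmE ((ca true p)%:E * mu true w (cell p) +
                                     (ca false p)%:E * mu false w (cell p))%E)%:E)%E.
Proof.
pose p0 : FF := [ffun=> false].
pose pp i := nth p0 (enum FF) i.
have prodpp (U : Type) (idx : U) (op : Monoid.com_law idx) (F : FF -> U) :
    \big[op/idx]_(p : FF) F p = \big[op/idx]_(i < size (enum FF)) F (pp i).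
  by rewrite -big_enum/= (big_nth p0) big_mkord.
(* The absolute values change nothing on masses, and put [f] between 0 and 1 on its whole domain as
   [integral_prod_indep] requires. *)
pose f i (x : \bar R * \bar R) : R := expmE ((ca true (pp i))%:E * `|x.1| +
                                     (ca false (pp i))%:E * `|x.2|)%E.
rewrite [RHS]prodpp.
pose V i w := (mu true w (cell (pp i)), mu false w (cell (pp i))).
have fV i w : f i (V i w) = expmE ((ca true (pp i))%:E * mu true w (cell (pp i)) +
                                     (ca false (pp i))%:E * mu false w (cell (pp i)))%E.
  by rewrite /f /V/= !gee0_abs.
under eq_integral do rewrite prodpp.
under eq_integral do under eq_bigr do rewrite -fV.
under [RHS]eq_bigr do under eq_integral do rewrite -fV.
apply: (integral_prod_indep (V := V)).
- by move=> i; apply: measurable_fun_pair; exact: mmu.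
- move=> B mB; apply: indep_mu => //.
  move=> i j iN jN ij; apply: cell_disj => /eqP; rewrite nth_uniq// ?enum_uniq//.
  by move=> /eqP.
- move=> i; apply: measurableT_comp; first exact: measurable_expmE.
  apply: emeasurable_funD; apply: measurable_funeM; apply: measurableT_comp => //.
- by move=> i x; apply: expmE_ge0_le1; rewrite adde_ge0// mule_ge0// ?lee_fin ?abse_ge0.
Qed.

Let tot := \sum_(k < n) t k.

Let tot_ge0 : 0 <= tot. Proof. exact: sumr_ge0. Qed.

Lemma sum_jump_le x : 0 <= \sum_(k < n) t k * jump_in e E k x <=
  tot * (pos_jump true x.1 + pos_jump false x.1).
Proof.
apply/andP; split.
  by apply: sumr_ge0 => k _; rewrite mulr_ge0// mulr_ge0// pos_jump_ge0.
rewrite /tot mulr_suml; apply: ler_sum => k _; rewrite ler_wpM2l//.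
apply: (@le_trans _ _ (pos_jump (e k) x.1)).
  by rewrite /jump_in ler_piMr ?pos_jump_ge0// indicE lern1 leq_b1.
by case: (e k); rewrite ?lerDl ?lerDr pos_jump_ge0.
Qed.

Lemma measurable_jump_in k : measurable_fun setT (jump_in e E k).
Proof.
apply: measurable_funM.
  by apply: measurableT_comp; [exact: measurable_pos_jump|exact: measurable_fst].
apply: measurableT_comp; [exact: measurable_indic|exact: measurable_snd].
Qed.

Let energy x := \sum_(k < n) t k * jump_in e E k x.

Lemma integrable_laplace : (rho \x G0)%E.-integrable setT
  (EFin \o (fun x => 1 - expR (- \sum_(k < n) t k * jump_in e E k x))).
Proof.
(* The bound is (1 + tot) min (1, q) with q the total jump: 1 - exp (- y) is at most 1, which serves
   when q >= 1, and at most y <= tot q, which serves when q < 1. *)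
have := integrable_min_jump; move=> /(integrableZl measurableT (1 + tot)).
apply: (@le_integrableR R _ _ (rho \x G0)%E).
  apply: measurable_funB => //; apply: measurableT_comp => //.
  apply: measurableT_comp => //; apply: measurable_sum => k.
  by apply: measurable_funM => //; exact: measurable_jump_in.
move=> x; have /andP[] := sum_jump_le x.
set y := \sum_(k < n) _; set q := pos_jump true _ + _ => y0 yq.
have q0 : 0 <= q by rewrite addr_ge0// pos_jump_ge0.
have [h1 h2] := expRN_bounds y0.
have y1 : 0 <= y / (1 + y) by rewrite divr_ge0// addr_ge0.
rewrite ger0_norm; last exact: le_trans h1.
have [q1|q1] := leP 1 q.
  by have := expR_ge0 (- y); have := tot_ge0; lra.
by have := mulr_ge0 tot_ge0 q0; lra.
Qed.

Let psi_cell p : (\int[rho \x G0]_x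
   (\1_(cell p) x.2 * (1 - expR (- (ca true p * pos_jump true x.1 + ca false p * pos_jump false x.1))))%:E =
   G0 (cell p) * psi (ca true p) (ca false p))%E.
Proof.
rewrite (fubini_tonelli1 (fun x : (measurableTypeR R * measurableTypeR R) * Z =>
  (\1_(cell p) x.2 * (1 - expR (- (ca true p * pos_jump true x.1 + ca false p * pos_jump false x.1))))%:E)).
- rewrite /psi /fubini_F/= -ge0_integralZl//; last 2 first.
  + by apply/measurable_EFinP; exact: mpsi.
  + by move=> s _; rewrite lee_fin psi_ge0.
  apply: eq_integral => s _.
  under eq_integral do rewrite EFinM.
  rewrite ge0_integralZr//;
    try by first [apply/measurable_EFinP; exact: measurable_indic|rewrite lee_fin psi_ge0].
  by rewrite integral_indic// setIT.
- apply/measurable_EFinP; apply: measurable_funM.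
    by apply: measurableT_comp; [exact: measurable_indic|exact: measurable_snd].
  by apply: (measurableT_comp (mpsi _ _)); exact: measurable_fst.
- by move=> x; rewrite lee_fin mulr_ge0// psi_ge0.
Qed.

Let energy_cell x : energy x = ca true (pat x.2) * pos_jump true x.1 +
                               ca false (pat x.2) * pos_jump false x.1.
Proof.
rewrite /energy /ca !mulr_suml -big_split/=; apply: eq_bigr => k _.
rewrite /jump_in ffunE indicE.
by case: (e k); case: (_ \in _); rewrite /=; ring.
Qed.

Let integral_cells : (\int[rho \x G0]_x (1 - expR (- energy x))%:E =
  \sum_(p : FF) G0 (cell p) * psi (ca true p) (ca false p))%E.
Proof.
under [RHS]eq_bigr do rewrite -psi_cell.
rewrite -ge0_integral_sum//; last 2 first.
- move=> p; apply/measurable_EFinP; apply: measurable_funM.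
    by apply: measurableT_comp; [exact: measurable_indic|exact: measurable_snd].
  by apply: (measurableT_comp (mpsi _ _)); exact: measurable_fst.
- by move=> p x _; rewrite lee_fin mulr_ge0// psi_ge0.
apply: eq_integral => x _; rewrite (bigD1 (pat x.2))//= big1 ?adde0.
  by rewrite indicE mem_set//= mul1r energy_cell.
by move=> p pz; rewrite indicE memNset ?mul0r//= => pz'; move: pz; rewrite pz' eqxx.
Qed.

Lemma laplace_items :
  (\int[P]_w (expmE (\sum_(k < n) (t k)%:E * mu (e k) w (E k))%E)%:E)%E =
  (expR (- (theta * Rintegral (rho \x G0)%E setT
     (fun x => 1 - expR (- \sum_(k < n) t k * jump_in e E k x)))))%:E.
Proof.
under eq_integral => w _.
  rewrite energy_cells expmE_sum; last first.
    by move=> p; rewrite adde_ge0// mule_ge0// lee_fin.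
  over.
rewrite laplace_cells.
under eq_bigr do rewrite laplace_mu// psiE.
rewrite prodEFin -expR_sum; congr (expR _)%:E.
rewrite sumrN; congr (- _).
have fin : (\int[rho \x G0]_x (1 - expR (- energy x))%:E)%E \is a fin_num.
  exact: integrable_fin_num integrable_laplace.
have term0 p : (0 <= G0 (cell p) * psi (ca true p) (ca false p))%E.
  by rewrite mule_ge0//; apply: integral_ge0 => s _; rewrite lee_fin psi_ge0.
have termfin p : (G0 (cell p) * psi (ca true p) (ca false p))%E \is a fin_num.
  move: fin; rewrite integral_cells sum_fin_num => /allP; apply.
  by apply/map_f; rewrite mem_filter mem_index_enum.
rewrite /Rintegral; transitivity (theta * fine (\sum_(p : FF) G0 (cell p) * psi (ca true p) (ca false p))%E).
  rewrite (eq_bigr (fun p => (fine (G0 (cell p) * psi (ca true p) (ca false p))%E)%:E));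
    last by move=> p _; rewrite fineK.
  rewrite sumEFin/=.
  rewrite mulr_sumr; apply: eq_bigr => p _; rewrite -mulrA; congr (_ * _).
  have G0fin : G0 (cell p) \is a fin_num by exact: fin_num_measure.
  (* [fine] is multiplicative on finite values. A null cell gives 0 on both sides; on any other cell
     the finiteness of the product forces that of [psi]. *)
  have [G00|G00] := eqVneq (G0 (cell p)) 0%E; first by rewrite G00 mul0e mul0r.
  rewrite fineM//; move: (termfin p).
  rewrite -{1}(fineK G0fin).
  have : 0 < fine (G0 (cell p)) by rewrite fine_gt0// lt0e G00 measure_ge0/= -ge0_fin_numE.
  case: (psi _ _) => //= g0.
    by rewrite gt0_muley ?lte_fin.
  by rewrite gt0_muleNy ?lte_fin.
by rewrite -integral_cells.
Qed.

End items.
End laplace_functional.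

(** * Normalisation by Gamma integrals *)

Section gamma_integrals.
Context {R : realType}.
Local Notation leb := (@lebesgue_measure R).

Lemma expr_expRN_bounded (N : nat) (c : R) : 0 < c ->
  exists2 C : R, 0 <= C & forall x, 0 <= x -> x ^+ N * expR (- (c * x)) <= C.
Proof.
move=> c0; case: N => [|N].
  by exists 1 => // x x0; rewrite expr0 mul1r -expR0 ler_expR oppr_le0 mulr_ge0// ltW.
(* The constant c'^-(N+1) comes from c' x <= exp (c' x), raised to the power N + 1. *)
pose c' := c / N.+1%:R; have c'0 : 0 < c' by rewrite divr_gt0.
exists (c'^-1 ^+ N.+1); first by rewrite exprn_ge0// invr_ge0 ltW.
move=> x x0.
have -> : expR (- (c * x)) = expR (- (c' * x)) ^+ N.+1.
  rewrite -expRM_natl; congr expR; rewrite /c'; field.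
  by rewrite addrC natr1 pnatr_eq0.
rewrite -exprMn lerXn2r ?nnegrE ?mulr_ge0 ?expR_ge0 ?invr_ge0 ?(ltW c'0)//.
rewrite expRN ler_pdivrMr ?expR_gt0// ler_pdivlMl//.
by apply: le_trans (expR_ge1Dx _); rewrite lerDr.
Qed.

(** Normalised to have Laplace transform T^-(N+1). The indicator turns it into a weight on the whole
    line. *)
Definition gamma_weight (N : nat) (u : R) : R :=
  \1_(`]0, +oo[%classic : set R) u * u ^+ N / N`!%:R.

Lemma gamma_weight_ge0 N u : 0 <= gamma_weight N u.
Proof.
rewrite /gamma_weight indicE; case: (boolP (u \in _)) => [|_]; last by rewrite mul0r mul0r.
by rewrite inE/= in_itv/= andbT mul1r => u0; rewrite divr_ge0// exprn_ge0// ltW.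
Qed.

Lemma gamma_weight_le0 N u : u <= 0 -> gamma_weight N u = 0.
Proof.
move=> u0; rewrite /gamma_weight indicE memNset ?mul0r//=.
by rewrite in_itv/= andbT; apply/negP; rewrite -leNgt.
Qed.

Lemma measurable_gamma_weight N : measurable_fun setT (gamma_weight N).
Proof.
apply: measurable_funM => //; apply: measurable_funM; last exact: exprn_measurable.
exact: measurable_indic.
Qed.

Let mgexp N T : measurable_fun setT (fun u => gamma_weight N u * expR (- (T * u))).
Proof.
apply: measurable_funM; first exact: measurable_gamma_weight.
by apply: measurableT_comp => //; apply: measurableT_comp => //; exact: measurable_funM.
Qed.

Let integral_gamma0 (T : R) : 0 < T ->
  (\int[leb]_u (gamma_weight 0 u * expR (- (T * u)))%:E = (T^-1)%:E)%E.
Proof.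
move=> T0.
have pdf0 : (\int[leb]_u (exponential_pdf T u)%:E = \int[leb]_u (T%:E * (gamma_weight 0 u * expR (- (T * u)))%:E))%E.
  apply: ae_eq_integral => //.
  - apply/measurable_EFinP; exact: measurable_exponential_pdf.
  - by apply: measurable_funeM; apply/measurable_EFinP; exact: mgexp.
  (* At 0 the exponential density equals [T], whereas [gamma_weight] vanishes. *)
  exists [set 0]; split => //; first exact: lebesgue_measure_set1.
  move=> u /=; apply: contra_notP => u0 _.
  rewrite /gamma_weight expr0 fact0 divr1 mulr1 indicE.
  have [u1|u1|/esym//] := ltgtP u 0.
    rewrite lt0_exponential_pdf// memNset ?mul0r ?mule0//=.
    by rewrite in_itv/= andbT; apply/negP; rewrite -leNgt ltW.
  rewrite exponential_pdfE ?ltW// mem_set/=; last by rewrite in_itv/= u1.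
  by rewrite mul1r -EFinM mulNr.
have := integral_exponential_pdf T0; rewrite pdf0 ge0_integralZl//; last 3 first.
- by apply/measurable_EFinP; exact: mgexp.
- by move=> u _; rewrite lee_fin mulr_ge0 ?expR_ge0 ?gamma_weight_ge0.
- by rewrite lee_fin ltW.
move=> h; have := congr1 (fun x => (T^-1)%:E * x)%E h.
by rewrite muleA -EFinM mulVf ?gt_eqF// mul1e mule1.
Qed.

Lemma integrable_gamma N (T : R) : 0 < T ->
  leb.-integrable setT (EFin \o (fun u => gamma_weight N u * expR (- (T * u)))).
Proof.
(* Half of the exponent absorbs [u ^+ N]; the other half is integrable by the case [N = 0]. *)
move=> T0; have T20 : 0 < T / 2 by rewrite divr_gt0.
have [C C0 HC] := expr_expRN_bounded N T20.
have i0 : leb.-integrable setT (EFin \o (fun u => gamma_weight 0 u * expR (- (T / 2 * u)))).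
  apply/integrableP; split; first by apply/measurable_EFinP; exact: mgexp.
  under eq_integral do rewrite /= ger0_norm ?mulr_ge0 ?expR_ge0 ?gamma_weight_ge0//.
  by rewrite integral_gamma0// ltry.
have := integrableZl measurableT C i0; apply: le_integrableR; first exact: mgexp.
move=> u; rewrite (ger0_norm (mulr_ge0 (gamma_weight_ge0 N u) (expR_ge0 _))).
have [u0|u0] := leP u 0.
  by rewrite !gamma_weight_le0// !mul0r mulr0.
have ind : \1_(`]0, +oo[%classic : set R) u = 1 :> R.
  by rewrite indicE mem_set//= in_itv/= u0.
rewrite /gamma_weight ind expr0 fact0 divr1 !mul1r.
have -> : expR (- (T * u)) = expR (- (T / 2 * u)) * expR (- (T / 2 * u)).
  by rewrite -expRD; congr expR; field.
rewrite mulrA ler_wpM2r ?expR_ge0//; apply: le_trans (HC u (ltW u0)).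
rewrite ler_wpM2r ?expR_ge0// ler_pdivrMr ?ltr0n ?fact_gt0//.
by apply: ler_peMr; [exact: exprn_ge0 (ltW u0)|rewrite ler1n fact_gt0].
Qed.

Let dq_inv (T : R) N : 0 < T ->
  dq (fun s => (T + s)^-1 ^+ N.+1) (N.+1%:R * T^-1 ^+ N.+2).
Proof.
move=> T0.
have h1 : dq (fun s => (T + s)^-1 ^+ 1) (1%:R * T^-1 ^+ 2).
  have E : dquot (fun s => (T + s)^-1 ^+ 1) = fun p : nat => T^-1 * (T + p.+1%:R^-1)^-1.
    apply/funext => p; rewrite /dquot !expr1 addr0.
    have : 0 < p.+1%:R :> R by rewrite ltr0n.
    move: (p.+1%:R) => a a0.
    have Ta : 0 < T * a + 1 by rewrite addr_gt0// mulr_gt0.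
    by field; rewrite !gt_eqF.
  rewrite mul1r /dq E expr2; apply: cvgM; first exact: cvg_cst.
  apply: cvgV; first by rewrite gt_eqF.
  by rewrite -[X in _ --> X]addr0; apply: cvgD; [exact: cvg_cst|exact: cvg_harmonic].
elim: N => [//|N ih].
have := dqM h1 ih; rewrite addr0 (_ : _ + _ = N.+2%:R * T^-1 ^+ N.+3).
  by congr dq; apply/funext => s; rewrite -exprD.
by rewrite -[N.+2%:R]natr1 !exprS; ring.
Qed.

(** The identity for [N + 1] is the one for [N] differentiated in [T], with the same one-sided
    quotients; the case [N = 0] is the exponential law. *)
Lemma Rintegral_gamma N (T : R) : 0 < T ->
  Rintegral leb setT (fun u => gamma_weight N u * expR (- (T * u))) = T^-1 ^+ N.+1.
Proof.
elim: N T => [|N ih] T T0; first by rewrite /Rintegral integral_gamma0// expr1.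
(* [dq_integral] wants a factor that is nonnegative on the whole line; where the weight is nonzero
   this one is [u]. *)
pose om (u : R) := Num.max 0 u.
have gS u : gamma_weight N u * om u = N.+1%:R * gamma_weight N.+1 u.
  have [u0|u0] := leP u 0; first by rewrite !gamma_weight_le0// mul0r mulr0.
  rewrite /om; have -> : Num.max 0 u = u by apply/max_idPr/ltW.
  rewrite /gamma_weight factS natrM exprS.
  have : N.+1%:R != 0 :> R by rewrite pnatr_eq0.
  have : N`!%:R != 0 :> R by rewrite pnatr_eq0 -lt0n fact_gt0.
  move: (N.+1%:R) (N`!%:R) => a b b0 a0.
  by field; rewrite a0 b0.
have dI : dq (fun s => Rintegral leb setT (fun u => gamma_weight N u * expR (- ((T + s) * u))))
             (N.+1%:R * Rintegral leb setT (fun u => gamma_weight N.+1 u * expR (- (T * u)))).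
  rewrite -RintegralZl//; last exact: integrable_gamma.
  have -> : Rintegral leb setT (fun u => N.+1%:R * (gamma_weight N.+1 u * expR (- (T * u)))) =
      Rintegral leb setT (fun u => (gamma_weight N u * expR (- (T * u))) * om u).
    by apply: eq_Rintegral => u _; rewrite mulrA -gS; ring.
  have -> : (fun s => Rintegral leb setT (fun u => gamma_weight N u * expR (- ((T + s) * u)))) =
     (fun s => Rintegral leb setT (fun u => (gamma_weight N u * expR (- (T * u))) * expR (- (s * om u)))).
    apply/funext => s; apply: eq_Rintegral => u _.
    have [u0|u0] := leP u 0; first by rewrite gamma_weight_le0// !mul0r.
    rewrite /om; have -> : Num.max 0 u = u by apply/max_idPr/ltW.
    by rewrite -mulrA -expRD; congr (_ * expR _); ring.
  apply: dq_integral.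
  - exact: mgexp.
  - exact: measurable_maxr.
  - by move=> u; rewrite mulr_ge0 ?expR_ge0 ?gamma_weight_ge0.
  - by move=> u; rewrite /om le_max lexx.
  - exact: integrable_gamma.
  - have := integrableZl measurableT N.+1%:R (integrable_gamma N.+1 T0).
    apply: (eq_integrable measurableT) => u _ /=.
    by rewrite -EFinM mulrA -gS; congr EFin; ring.
have dG := @dq_inv T N T0.
have dE : dquot (fun s => Rintegral leb setT (fun u => gamma_weight N u * expR (- ((T + s) * u)))) =
    dquot (fun s => (T + s)^-1 ^+ N.+1).
  by apply/funext => p; rewrite /dquot !ih// ?addr0// addr_gt0// invr_gt0.
have N0 : N.+1%:R != 0 :> R by rewrite pnatr_eq0.
exact: (mulfI N0 (dq_unique dE dI dG)).
Qed.

Lemma integral_gamma N (T : R) : 0 < T ->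
  (\int[leb]_u (gamma_weight N u * expR (- (T * u)))%:E = (T^-1 ^+ N.+1)%:E)%E.
Proof.
move=> T0; rewrite -(Rintegral_gamma N T0) /Rintegral fineK//.
exact: integrable_fin_num (integrable_gamma N T0).
Qed.

End gamma_integrals.

(** Inversion is not continuous at 0, where it takes the value 0; on each open half-line it is
    expressed by exp and ln. *)
Lemma measurable_invr (R : realType) : measurable_fun [set: R] (@GRing.inv R).
Proof.
rewrite (_ : @GRing.inv R = (fun x => \1_(`]0, +oo[%classic : set R) x * expR (- ln x)
    - \1_(`]-oo, 0[%classic : set R) x * expR (- ln (- x)))); last first.
  apply/funext => x; rewrite !indicE.
  have [x0|x0|->] := ltgtP x 0.
  - rewrite memNset/=; last by rewrite in_itv/= andbT; apply/negP; rewrite -leNgt ltW.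
    rewrite mem_set/=; last by rewrite in_itv/=.
    by rewrite mul0r mul1r sub0r expRN lnK ?posrE ?oppr_gt0// invrN opprK.
  - rewrite mem_set/=; last by rewrite in_itv/= andbT.
    rewrite memNset/=; last by rewrite in_itv/=; apply/negP; rewrite -leNgt ltW.
    by rewrite mul0r mul1r subr0 expRN lnK ?posrE.
  - rewrite memNset/=; last by rewrite in_itv/= ltxx.
    by rewrite memNset/= ?in_itv/= ?ltxx// invr0 !mul0r subr0.
apply: measurable_funB; apply: measurable_funM; try exact: measurable_indic.
  by do 2 apply: measurableT_comp => //; exact: measurable_ln.
by do 3 apply: measurableT_comp => //; exact: measurable_ln.
Qed.

(** * Mixed moments of the masses under exponential damping *)

Section mixed_moments.
Context {R : realType} dZ (Z : measurableType dZ) (G0 : probability Z R).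
Variables (theta : R)
  (rho : {sigma_finite_measure set (measurableTypeR R * measurableTypeR R)%type -> \bar R}).
Hypothesis theta0 : 0 <= theta.
Hypothesis Hrho_supp :
  rho (~` ([set s | 0 <= s.1 /\ 0 <= s.2] `\` [set (0, 0)])) = 0%E.
Hypothesis Hrho_int : (\int[rho]_s (Num.min 1 (pos_jump true s + pos_jump false s))%:E < +oo)%E.
Variables (dO : measure_display) (Omega : measurableType dO) (P : probability Omega R).
Variable mu : bool -> Omega -> {measure set Z -> \bar R}.
Hypothesis mmu : forall e A, measurable A -> measurable_fun setT (fun w => mu e w A).
Hypothesis indep_mu : forall (N : nat) (A : nat -> set Z) (B : nat -> set (\bar R * \bar R)%type),
  (forall i, (i < N)%N -> measurable (A i) /\ measurable (B i)) ->
  (forall i j, (i < N)%N -> (j < N)%N -> i <> j -> A i `&` A j = set0) ->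
  P (\bigcap_(i in `I_N) [set w | B i (mu true w (A i), mu false w (A i))]) =
  (\prod_(i < N) P [set w | B i (mu true w (A i), mu false w (A i))])%E.
Hypothesis laplace_mu : forall (A : set Z) (l1 l2 : R), measurable A -> 0 <= l1 -> 0 <= l2 ->
  (\int[P]_w (expmE (l1%:E * mu true w A + l2%:E * mu false w A)%E)%:E)%E =
  (expR (- (theta * fine (G0 A) *
     fine (\int[rho]_s (1 - expR (- (l1 * s.1 + l2 * s.2)))%:E)%E)))%:E.
Hypothesis mass_ae : {ae P, forall w, forall e, (0 < mu e w setT < +oo)%E}.

Let SS : measurableType _ := (measurableTypeR R * measurableTypeR R)%type.

Definition total e w : R := fine (mu e w setT).
(** The value is 0 when the total mass is 0 or infinite, since [fine] sends infinity to 0 and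
    [0^-1 = 0]; hence a share of a measurable set lies in [0, 1] at every outcome. *)
Definition share e w (A : set Z) : R := fine (mu e w A) / fine (mu e w setT).

Lemma total_ge0 e w : 0 <= total e w. Proof. exact: fine_ge0. Qed.

Lemma share_ge0_le1 e w A : measurable A -> 0 <= share e w A <= 1.
Proof.
move=> mA; rewrite /share divr_ge0 ?fine_ge0//=.
have [->|T0] := eqVneq (fine (mu e w setT)) 0; first by rewrite invr0 mulr0 ler01.
have Tfin : mu e w setT \is a fin_num.
  by move: T0; case: (mu e w setT) => //=; rewrite eqxx.
have AT : (mu e w A <= mu e w setT)%E by apply: le_measure; rewrite ?inE.
have Afin : mu e w A \is a fin_num.
  rewrite ge0_fin_numE//; apply: le_lt_trans AT _.
  by rewrite -ge0_fin_numE.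
rewrite ler_pdivrMr ?mul1r; first exact: fine_le.
by rewrite lt_neqAle eq_sym T0 fine_ge0.
Qed.

Lemma share_total e w A : measurable A -> (mu e w setT < +oo)%E -> (0 < mu e w setT)%E ->
  mu e w A = (share e w A * total e w)%:E.
Proof.
move=> mA Ty T0.
have Tfin : mu e w setT \is a fin_num by rewrite ge0_fin_numE.
have AT : (mu e w A <= mu e w setT)%E by apply: le_measure; rewrite ?inE.
have Afin : mu e w A \is a fin_num by rewrite ge0_fin_numE//; apply: le_lt_trans AT _.
have T1 : 0 < fine (mu e w setT) by rewrite fine_gt0// T0.
by rewrite /share /total divfK ?fineK// gt_eqF.
Qed.

Lemma measurable_total e : measurable_fun setT (total e).
Proof. by apply: measurableT_comp => //; exact: mmu. Qed.

Lemma measurable_share e A : measurable A -> measurable_fun setT (fun w => share e w A).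
Proof.
move=> mA; apply: measurable_funM.
  by apply: measurableT_comp => //; exact: mmu.
by apply: measurableT_comp; [exact: measurable_invr|exact: measurable_total].
Qed.

Definition jump_prod (e : nat -> bool) (b : seq nat) (s : SS) : R :=
  \prod_(k <- b) pos_jump (e k) s.

Definition damping (u v : R) (s : SS) : R := u * pos_jump true s + v * pos_jump false s.

Lemma jump_prod_ge0 e b s : 0 <= jump_prod e b s.
Proof. by rewrite /jump_prod big_seq prodr_ge0// => k _; exact: pos_jump_ge0. Qed.

Lemma measurable_jump_prod e b : measurable_fun setT (jump_prod e b).
Proof. by apply: measurable_prod => k _; exact: measurable_pos_jump. Qed.

Lemma measurable_damping u v : measurable_fun setT (damping u v).
Proof.
by apply: measurable_funD; apply: measurable_funM => //; exact: measurable_pos_jump.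
Qed.

Lemma prodr_le_size (b : seq nat) (f : nat -> R) (M : R) :
  (forall k, 0 <= f k <= M) -> \prod_(k <- b) f k <= M ^+ size b.
Proof.
move=> fM; elim: b => [|k b ih]; first by rewrite big_nil expr0.
have /andP[f0 f1] := fM k.
rewrite big_cons exprS ler_pM// big_seq prodr_ge0// => j _.
by have /andP[] := fM j.
Qed.

Let damping_ge (u v : R) s : Num.min u v * (pos_jump true s + pos_jump false s) <= damping u v s.
Proof.
rewrite mulrDr lerD// ler_wpM2r ?pos_jump_ge0// ge_min lexx ?orbT//.
Qed.

(** With q the total jump, the left side is at most q^|b| exp (- min (u, v) q). For q >= 1 this is
    bounded; for q < 1 one factor q is kept, which exists because the block is nonempty, and the
    rest is bounded. *)
Lemma jump_prod_bound e b u v : 0 < u -> 0 < v -> b != [::] ->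
  exists2 C : R, 0 <= C & forall s, jump_prod e b s * expR (- damping u v s) <=
     C * Num.min 1 (pos_jump true s + pos_jump false s).
Proof.
move=> u0 v0; case: b => // k0 b _.
have c0 : 0 < Num.min u v by rewrite lt_min u0.
have [C1 C10 H1] := expr_expRN_bounded (size b).+1 c0.
have [C2 C20 H2] := expr_expRN_bounded (size b) c0.
exists (C1 + C2); first by rewrite addr_ge0.
move=> s; set q := pos_jump true s + pos_jump false s.
have q0 : 0 <= q by rewrite addr_ge0// pos_jump_ge0.
have le1 : jump_prod e (k0 :: b) s * expR (- damping u v s) <=
    q ^+ (size b).+1 * expR (- (Num.min u v * q)).
  apply: ler_pM.
  - exact: jump_prod_ge0.
  - exact: expR_ge0.
  - apply: (@prodr_le_size (k0 :: b)) => k; rewrite pos_jump_ge0/= /q.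
    by case: (e k); rewrite ?lerDl ?lerDr pos_jump_ge0.
  - by rewrite ler_expR lerN2 damping_ge.
apply: (le_trans le1); have [q1|q1] := leP 1 q.
  by rewrite mulr1; apply: le_trans (H1 q q0) _; rewrite lerDl.
rewrite exprS -mulrA mulrC; apply: ler_wpM2r => //.
by apply: le_trans (H2 q q0) _; rewrite lerDr.
Qed.

Let measurable_min_jump : measurable_fun setT (fun s : SS =>
  Num.min 1 (pos_jump true s + pos_jump false s)).
Proof.
by apply: measurable_minr => //; apply: measurable_funD; exact: measurable_pos_jump.
Qed.

Lemma integrable_jump_prod e b u v : 0 < u -> 0 < v -> b != [::] ->
  rho.-integrable setT (EFin \o (fun s => jump_prod e b s * expR (- damping u v s))).
Proof.
move=> u0 v0 b0; have [C C0 HC] := jump_prod_bound e u0 v0 b0.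
have i1 : rho.-integrable setT (EFin \o (fun s : SS =>
    Num.min 1 (pos_jump true s + pos_jump false s))).
  apply/integrableP; split; first exact/measurable_EFinP.
  under eq_integral => s _.
    rewrite /= ger0_norm; last by rewrite le_min ler01 addr_ge0// pos_jump_ge0.
    over.
  exact: Hrho_int.
have := integrableZl measurableT C i1; apply: le_integrableR.
  apply: measurable_funM; first exact: measurable_jump_prod.
  by do 2 apply: measurableT_comp => //; exact: measurable_damping.
move=> s; rewrite ger0_norm; first exact: HC.
by rewrite mulr_ge0 ?expR_ge0 ?jump_prod_ge0.
Qed.

(** The items of a block have one common location, which must lie in the set of each of them. *)
Definition capE (E : nat -> set Z) (b : seq nat) : set Z :=
  \bigcap_(k in [set k | k \in b]) E k.

Lemma measurable_capE E b : (forall k, measurable (E k)) -> measurable (capE E b).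
Proof. by move=> mE; exact: bigcap_measurableType. Qed.

Lemma prod_indic_capE E b z : \prod_(k <- b) \1_(E k) z = \1_(capE E b) z :> R.
Proof.
elim: b => [|k b ih].
  by rewrite big_nil indicE mem_set// => k /=; rewrite in_nil.
rewrite big_cons ih !indicE -natrM mulnb; congr (_%:R); congr nat_of_bool.
apply/idP/idP => [/andP[/set_mem h1 /set_mem h2]|/set_mem h].
  by apply/mem_set => j /=; rewrite inE => /orP[/eqP ->//|]; exact: h2.
apply/andP; split; apply/mem_set.
  by apply: h => /=; rewrite mem_head.
by move=> j jb; apply: h => /=; rewrite inE jb orbT.
Qed.

Section items.
Variables (n : nat) (e : nat -> bool) (E : nat -> set Z).
Hypothesis mE : forall k, measurable (E k).

Let S k w := share (e k) w (E k) * total (e k) w.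

Let S_ge0 k w : 0 <= S k w.
Proof. by rewrite mulr_ge0 ?total_ge0//; have /andP[] := share_ge0_le1 (e k) w (mE k). Qed.

Let S_le k w : S k w <= total true w + total false w.
Proof.
apply: (@le_trans _ _ (total (e k) w)).
  by rewrite ler_piMl ?total_ge0//; have /andP[] := share_ge0_le1 (e k) w (mE k).
by case: (e k); rewrite ?lerDl ?lerDr total_ge0.
Qed.

Let measurable_S k : measurable_fun setT (S k).
Proof. by apply: measurable_funM; [exact: measurable_share|exact: measurable_total]. Qed.

Section uv.
Variables (u v : R).
Hypotheses (u0 : 0 < u) (v0 : 0 < v).

Let phi w := expR (- (u * total true w + v * total false w)).

Let measurable_phi : measurable_fun setT phi.
Proof.
do 2 apply: measurableT_comp => //.
by apply: measurable_funD; apply: measurable_funM => //; exact: measurable_total.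
Qed.

Let integrable_S b :
  P.-integrable setT (EFin \o (fun w => (\prod_(k <- b) S k w) * phi w)).
Proof.
have c0 : 0 < Num.min u v by rewrite lt_min u0.
have [C C0 HC] := expr_expRN_bounded (size b) c0.
have ic : P.-integrable setT (EFin \o (fun=> C)).
  exact: finite_measure_integrable_cst.
apply: le_integrableR ic.
  by apply: measurable_funM => //; apply: measurable_prod.
move=> w; rewrite ger0_norm; last first.
  by rewrite mulr_ge0 ?expR_ge0// big_seq prodr_ge0.
set T := total true w + total false w.
have T0 : 0 <= T by rewrite addr_ge0// total_ge0.
apply: le_trans (HC T T0); apply: ler_pM.
- by rewrite big_seq prodr_ge0.
- exact: expR_ge0.
- by apply: prodr_le_size => k; rewrite S_ge0/= S_le.
- rewrite ler_expR lerN2 mulrDr lerD// ler_wpM2r ?total_ge0// ge_min lexx ?orbT//.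
Qed.

Let La := (rho \x G0)%E.

Let prod_jump_in b x :
  \prod_(k <- b) jump_in e E k x = jump_prod e b x.1 * \1_(capE E b) x.2.
Proof. by rewrite -prod_indic_capE /jump_in big_split. Qed.

Let msig : measurable_fun setT (fun x : SS * Z => damping u v x.1).
Proof. by apply: measurableT_comp; [exact: measurable_damping|exact: measurable_fst]. Qed.

Let integrable_om b : b != [::] -> La.-integrable setT
  (EFin \o (fun x => (\prod_(k <- b) jump_in e E k x) * expR (- damping u v x.1))).
Proof.
move=> b0; have [C C0 HC] := jump_prod_bound e u0 v0 b0.
have := integrableZl measurableT C (integrable_min_jump G0 Hrho_int).
apply: (@le_integrableR R _ _ La).
  apply: measurable_funM.
    by apply: measurable_prod => k _; exact: measurable_jump_in.
  by do 2 apply: measurableT_comp => //.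
move=> x; rewrite prod_jump_in ger0_norm; last first.
  by rewrite mulr_ge0 ?expR_ge0// mulr_ge0 ?jump_prod_ge0.
apply: le_trans (HC x.1); rewrite ler_wpM2r ?expR_ge0//.
by rewrite ler_piMr ?jump_prod_ge0// indicE lern1 leq_b1.
Qed.

(** The damping is obtained from two more items that see the whole space: item [n] weighs the first
    measure by [u], and item [n + 1] the second by [v]. The Laplace formula for n + 2 items then
    contains the damped one. *)
Let e' k := if (k < n)%N then e k else k == n.
Let E' k := if (k < n)%N then E k else setT.
Let t' (t : nat -> R) k := if (k < n)%N then t k else if k == n then u else v.

Let mE' k : measurable (E' k). Proof. by rewrite /E'; case: ifP. Qed.

Let t'_ge0 t : (forall k, 0 <= t k) -> forall k, 0 <= t' t k.
Proof. by move=> t0 k; rewrite /t'; case: ifP => // _; case: ifP => _; exact: ltW. Qed.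

Let sum_t' (t : nat -> R) (F : bool -> set Z -> R) :
  \sum_(k < n.+2) t' t k * F (e' k) (E' k) =
  \sum_(k < n) t k * F (e k) (E k) + (u * F true setT + v * F false setT).
Proof.
rewrite big_ord_recr big_ord_recr/= -addrA; congr (_ + (_ + _)).
- by apply: eq_bigr => k _; rewrite /t' /e' /E' ltn_ord.
- by rewrite /t' /e' /E' ltnn eqxx.
- by rewrite /t' /e' /E' ltnNge leqnSn/= eqn_leq ltnn.
Qed.

Let sum_jump t x : \sum_(k < n.+2) t' t k * jump_in e' E' k x =
  \sum_(k < n) t k * jump_in e E k x + damping u v x.1.
Proof.
rewrite (sum_t' t (fun b A => pos_jump b x.1 * \1_A x.2)).
by rewrite /damping !indicE !in_setT !mulr1.
Qed.

Let laplace_S (t : nat -> R) : (forall k, 0 <= t k) ->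
  Rintegral P setT (fun w => phi w * expR (- \sum_(k < n) t k * S k w)) =
  expR (- (theta * Rintegral La setT
             (fun x => 1 - expR (- (\sum_(k < n) t k * jump_in e E k x + damping u v x.1))))).
Proof.
move=> t0.
have := laplace_items Hrho_supp Hrho_int mmu indep_mu laplace_mu n.+2 e' mE' (t'_ge0 t0).
under eq_Rintegral do rewrite sum_jump.
move=> /(congr1 fine)/= <-; congr fine; apply: ae_eq_integral => //.
- apply/measurable_EFinP; apply: measurable_funM => //.
  do 2 apply: measurableT_comp => //.
  by apply: measurable_sum => k; exact: measurable_funM.
- apply/measurable_EFinP; apply: measurableT_comp; first exact: measurable_expmE.
  by apply: emeasurable_sum => k; apply: measurable_funeM; exact: mmu.
(* Where both total masses are positive and finite, every mass is a real number and [expmE] is the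
   real exponential. *)
have [N [mN N0 NS]] := mass_ae; exists N; split => //.
apply: subset_trans NS; apply: subsetC => w good _.
have muE b A : measurable A -> mu b w A = (share b w A * total b w)%:E.
  by move=> mA; have /andP[? ?] := good b; exact: share_total.
under [in RHS]eq_bigr do rewrite muE// -EFinM.
rewrite sumEFin/=; congr EFin.
have tot b : share b w setT * total b w = total b w.
  by rewrite [RHS]/total muE.
rewrite (sum_t' t (fun b A => share b w A * total b w)) !tot opprD expRD.
exact: mulrC.
Qed.

Let mixed_moment_La :
  Rintegral P setT (fun w => (\prod_(k < n) S k w) * phi w) =
  expR (- (theta * Rintegral La setT (fun x => 1 - expR (- damping u v x.1)))) *
  \sum_(r <- configs n) \prod_(b <- r)
    (theta * Rintegral La setT (fun x => (\prod_(k <- b) jump_in e E k x) * expR (- damping u v x.1))).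
Proof.
have om0 k (x : SS * Z) : 0 <= jump_in e E k x by rewrite mulr_ge0// pos_jump_ge0.
have mom k : measurable_fun setT (jump_in e E k : SS * Z -> R) by exact: measurable_jump_in.
have phi0 w : 0 <= phi w by exact: expR_ge0.
have ilap (t : nat -> R) : (forall k, 0 <= t k) -> La.-integrable setT
    (EFin \o (fun x => 1 - expR (- (\sum_(k < n) t k * jump_in e E k x + damping u v x.1)))).
  move=> t0; have := integrable_laplace G0 Hrho_int n.+2 e' mE' (t'_ge0 t0).
  by under eq_fun do rewrite sum_jump.
exact: (@moment_formula R _ Omega P _ (SS * Z)%type La theta n S phi (jump_in e E)
  (fun x => damping u v x.1) theta0 measurable_S measurable_phi mom msig S_ge0
  phi0 om0 integrable_S integrable_om ilap laplace_S).
Qed.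

Let block_La b : b != [::] ->
  Rintegral La setT (fun x => (\prod_(k <- b) jump_in e E k x) * expR (- damping u v x.1)) =
  fine (G0 (capE E b)) * Rintegral rho setT (fun s => jump_prod e b s * expR (- damping u v s)).
Proof.
move=> b0; rewrite -fineM; last 2 first.
- by apply: fin_num_measure; exact: measurable_capE.
- exact: integrable_fin_num (integrable_jump_prod e u0 v0 b0).
congr fine.
have mj : measurable_fun setT (fun s => jump_prod e b s * expR (- damping u v s)).
  apply: measurable_funM; first exact: measurable_jump_prod.
  by do 2 apply: measurableT_comp => //; exact: measurable_damping.
have j0 s : 0 <= jump_prod e b s * expR (- damping u v s).
  by rewrite mulr_ge0 ?expR_ge0 ?jump_prod_ge0.
transitivity (\int[La]_x (\1_(capE E b) x.2 * (jump_prod e b x.1 * expR (- damping u v x.1)))%:E)%E.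
  by apply: eq_integral => x _; rewrite prod_jump_in; congr EFin; ring.
rewrite (fubini_tonelli1 (fun x : SS * Z =>
   (\1_(capE E b) x.2 * (jump_prod e b x.1 * expR (- damping u v x.1)))%:E)).
- rewrite /fubini_F/= -ge0_integralZl//; last 2 first.
  + exact/measurable_EFinP.
  + by move=> s _; rewrite lee_fin.
  apply: eq_integral => s _.
  under eq_integral do rewrite EFinM.
  rewrite ge0_integralZr//;
    try by first [apply/measurable_EFinP; apply: measurable_indic; exact: measurable_capE|rewrite lee_fin].
  by rewrite integral_indic// ?setIT//; exact: measurable_capE.
- apply/measurable_EFinP; apply: measurable_funM.
    apply: measurableT_comp; last exact: measurable_snd.
    by apply: measurable_indic; exact: measurable_capE.
  by apply: (measurableT_comp mj); exact: measurable_fst.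
- by move=> x; rewrite lee_fin mulr_ge0.
Qed.

Let exponent_La :
  Rintegral La setT (fun x => 1 - expR (- damping u v x.1)) =
  Rintegral rho setT (fun s => 1 - expR (- damping u v s)).
Proof.
congr fine.
have d0 s : 0 <= 1 - expR (- damping u v s).
  rewrite subr_ge0 -expR0 ler_expR oppr_le0.
  by rewrite addr_ge0// mulr_ge0 ?pos_jump_ge0// ltW.
have md : measurable_fun setT (fun s : SS => 1 - expR (- damping u v s)).
  apply: measurable_funB => //.
  by do 2 apply: measurableT_comp => //; exact: measurable_damping.
rewrite (fubini_tonelli1 (fun x : SS * Z => (1 - expR (- damping u v x.1))%:E)).
- rewrite /fubini_F/=; apply: eq_integral => s _.
  rewrite -[RHS]mule1 -(@probability_setT _ _ _ G0) -(integral_cst G0 measurableT).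
  exact: eq_integral.
- apply/measurable_EFinP; apply: (measurableT_comp md); exact: measurable_fst.
- by move=> x; rewrite lee_fin.
Qed.

Lemma mixed_moment :
  Rintegral P setT (fun w => (\prod_(k < n) (share (e k) w (E k) * total (e k) w)) *
     expR (- (u * total true w + v * total false w))) =
  expR (- (theta * Rintegral rho setT (fun s => 1 - expR (- damping u v s)))) *
  \sum_(r <- configs n) \prod_(b <- r)
    (theta * (fine (G0 (capE E b)) *
       Rintegral rho setT (fun s => jump_prod e b s * expR (- damping u v s)))).
Proof.
have := mixed_moment_La; rewrite /S /phi => ->; rewrite exponent_La; congr (_ * _).
rewrite big_seq [RHS]big_seq; apply: eq_bigr => r rn.
rewrite big_seq [RHS]big_seq; apply: eq_bigr => b br.
by rewrite block_La//; have /allP := configs_neq0 rn; exact.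
Qed.

Lemma integrable_mixed : P.-integrable setT (EFin \o (fun w =>
  (\prod_(k < n) (share (e k) w (E k) * total (e k) w)) *
     expR (- (u * total true w + v * total false w)))).
Proof.
apply: (eq_integrable measurableT) (integrable_S (iota 0 n)) => w _ /=.
by congr (_ * _)%:E; rewrite -(big_mkord predT (fun k => S k w)) /index_iota subn0.
Qed.

End uv.
End items.
End mixed_moments.

(** * Moments of the shares, by integrating out the damping *)

Section share_moments.
Context {R : realType} dZ (Z : measurableType dZ) (G0 : probability Z R).
Variables (theta : R)
  (rho : {sigma_finite_measure set (measurableTypeR R * measurableTypeR R)%type -> \bar R}).
Hypothesis theta0 : 0 <= theta.
Hypothesis Hrho_supp :
  rho (~` ([set s | 0 <= s.1 /\ 0 <= s.2] `\` [set (0, 0)])) = 0%E.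
Hypothesis Hrho_int : (\int[rho]_s (Num.min 1 (pos_jump true s + pos_jump false s))%:E < +oo)%E.
Variables (dO : measure_display) (Omega : measurableType dO) (P : probability Omega R).
Variable mu : bool -> Omega -> {measure set Z -> \bar R}.
Hypothesis mmu : forall e A, measurable A -> measurable_fun setT (fun w => mu e w A).
Hypothesis indep_mu : forall (N : nat) (A : nat -> set Z) (B : nat -> set (\bar R * \bar R)%type),
  (forall i, (i < N)%N -> measurable (A i) /\ measurable (B i)) ->
  (forall i j, (i < N)%N -> (j < N)%N -> i <> j -> A i `&` A j = set0) ->
  P (\bigcap_(i in `I_N) [set w | B i (mu true w (A i), mu false w (A i))]) =
  (\prod_(i < N) P [set w | B i (mu true w (A i), mu false w (A i))])%E.
Hypothesis laplace_mu : forall (A : set Z) (l1 l2 : R), measurable A -> 0 <= l1 -> 0 <= l2 ->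
  (\int[P]_w (expmE (l1%:E * mu true w A + l2%:E * mu false w A)%E)%:E)%E =
  (expR (- (theta * fine (G0 A) *
     fine (\int[rho]_s (1 - expR (- (l1 * s.1 + l2 * s.2)))%:E)%E)))%:E.
Hypothesis mass_ae : {ae P, forall w, forall e, (0 < mu e w setT < +oo)%E}.

Variables (n : nat) (e : nat -> bool) (n1 n2 : nat).
Hypothesis Hn1 : (\sum_(k < n) e k = n1.+1)%N.
Hypothesis Hn2 : (\sum_(k < n) ~~ e k = n2.+1)%N.

Let SS : measurableType _ := (measurableTypeR R * measurableTypeR R)%type.

Let tau (b : seq nat) (x : SS) : R :=
  Rintegral rho setT (fun s => jump_prod e b s * expR (- damping x.1 x.2 s)).

(** The positive parts make the inner integrand nonnegative for all [x], as measurability through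
    Tonelli requires; only positive arguments count, because [gg] vanishes elsewhere. *)
Let lap (x : SS) : R := expR (- (theta * Rintegral rho setT
  (fun s => 1 - expR (- damping (Num.max 0 x.1) (Num.max 0 x.2) s)))).

Let gg (x : SS) : R := gamma_weight n1 x.1 * gamma_weight n2 x.2.

Let dens (r : seq (seq nat)) (x : SS) : R :=
  gg x * lap x * \prod_(b <- r) (theta * tau b x).

Variable leb2 : {sigma_finite_measure set SS -> \bar R}.
Hypothesis integral_gg : forall T1 T2 : R, 0 < T1 -> 0 < T2 ->
  (\int[leb2]_x (gg x * expR (- (x.1 * T1 + x.2 * T2)))%:E =
    (T1^-1 ^+ n1.+1 * T2^-1 ^+ n2.+1)%:E)%E.

Let gg_ge0 x : 0 <= gg x.
Proof. by rewrite mulr_ge0 ?gamma_weight_ge0. Qed.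

Let tau_ge0 b x : 0 <= tau b x.
Proof.
by apply: Rintegral_ge0 => s _; rewrite mulr_ge0 ?expR_ge0 ?jump_prod_ge0.
Qed.

Let dens_ge0 r x : 0 <= dens r x.
Proof.
apply: mulr_ge0; first exact: mulr_ge0 (gg_ge0 x) (expR_ge0 _).
by rewrite big_seq prodr_ge0// => b _; exact: mulr_ge0.
Qed.

Let mpj e0 : measurable_fun setT (fun y : SS * SS => pos_jump e0 y.2).
Proof. by apply: measurableT_comp; [exact: measurable_pos_jump|exact: measurable_snd]. Qed.

Let measurable_tau b : measurable_fun setT (tau b).
Proof.
apply: measurableT_comp => //.
apply: (measurable_fun_fubini_tonelli_F (fun y : SS * SS =>
  (jump_prod e b y.2 * expR (- damping y.1.1 y.1.2 y.2))%:E)).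
- apply/measurable_EFinP; apply: measurable_funM.
    apply: measurableT_comp; [exact: measurable_jump_prod|exact: measurable_snd].
  do 2 apply: measurableT_comp => //.
  apply: measurable_funD; apply: measurable_funM => //.
  + by apply: measurableT_comp; [exact: measurable_fst|exact: measurable_fst].
  + by apply: measurableT_comp; [exact: measurable_snd|exact: measurable_fst].
- by move=> y; rewrite lee_fin mulr_ge0 ?expR_ge0 ?jump_prod_ge0.
Qed.

Let measurable_lap : measurable_fun setT lap.
Proof.
apply: measurableT_comp => //; apply: measurableT_comp => //.
apply: measurable_funM => //; apply: measurableT_comp => //.
apply: (measurable_fun_fubini_tonelli_F (fun y : SS * SS =>
  (1 - expR (- damping (Num.max 0 y.1.1) (Num.max 0 y.1.2) y.2))%:E)).
- apply/measurable_EFinP; apply: measurable_funB => //.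
  do 2 apply: measurableT_comp => //.
  apply: measurable_funD; apply: measurable_funM => //; apply: measurable_maxr => //.
  + by apply: measurableT_comp; [exact: measurable_fst|exact: measurable_fst].
  + by apply: measurableT_comp; [exact: measurable_snd|exact: measurable_fst].
- move=> y; rewrite lee_fin subr_ge0 -expR0 ler_expR oppr_le0.
  by rewrite addr_ge0// mulr_ge0 ?pos_jump_ge0// le_max lexx.
Qed.

Let measurable_gg : measurable_fun setT gg.
Proof.
apply: measurable_funM; (apply: measurableT_comp; first exact: measurable_gamma_weight).
  exact: measurable_fst.
exact: measurable_snd.
Qed.

Let measurable_dens r : measurable_fun setT (dens r).
Proof.
apply: measurable_funM; first exact: measurable_funM.
by apply: measurable_prod => b _; apply: measurable_funM.
Qed.

Let prod_total w : \prod_(k < n) total mu (e k) w =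
  total mu true w ^+ n1.+1 * total mu false w ^+ n2.+1.
Proof.
rewrite -Hn1 -Hn2 !expr_sum -big_split/=; apply: eq_bigr => k _.
by case: (e k); rewrite /= ?expr1 ?expr0 ?mulr1 ?mul1r.
Qed.

Section sets.
Variable E : nat -> set Z.
Hypothesis mE : forall k, measurable (E k).

Let S w := \prod_(k < n) (share mu (e k) w (E k) * total mu (e k) w).

(** Integrated over the parameters first, this gives the product of the shares, the powers of the
    total masses cancelling; integrated over the outcomes first, it gives the sum over
    configurations. *)
Let kern (y : Omega * SS) : R :=
  S y.1 * (gg y.2 * expR (- (y.2.1 * total mu true y.1 + y.2.2 * total mu false y.1))).

Let S_ge0 w : 0 <= S w.
Proof.
apply: prodr_ge0 => k _; rewrite mulr_ge0 ?total_ge0//.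
by have /andP[] := share_ge0_le1 mu (e k) w (mE k).
Qed.

Let measurable_S : measurable_fun setT S.
Proof.
apply: measurable_prod => k _; apply: measurable_funM.
  exact: measurable_share.
exact: measurable_total.
Qed.

Let kern_ge0 y : 0 <= kern y.
Proof. exact: mulr_ge0 (S_ge0 _) (mulr_ge0 (gg_ge0 _) (expR_ge0 _)). Qed.

Let measurable_kern : measurable_fun setT kern.
Proof.
apply: measurable_funM.
  by apply: (measurableT_comp measurable_S); exact: measurable_fst.
apply: measurable_funM.
  by apply: (measurableT_comp measurable_gg); exact: measurable_snd.
do 2 apply: measurableT_comp => //.
apply: measurable_funD; apply: measurable_funM.
- by apply: measurableT_comp; [exact: measurable_fst|exact: measurable_snd].
- by apply: measurableT_comp; [exact: measurable_total|exact: measurable_fst].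
- by apply: measurableT_comp; [exact: measurable_snd|exact: measurable_snd].
- by apply: measurableT_comp; [exact: measurable_total|exact: measurable_fst].
Qed.

Let Gr (r : seq (seq nat)) : R := \prod_(b <- r) fine (G0 (capE E b)).

Let Gr_ge0 r : 0 <= Gr r.
Proof. by rewrite /Gr big_seq prodr_ge0// => b _; exact: fine_ge0. Qed.

Let integral_kern x : (\int[P]_w (kern (w, x))%:E =
  (\sum_(r <- configs n) Gr r * dens r x)%:E)%E.
Proof.
have [x1|x1] := leP x.1 0.
  rewrite big1; last first.
    by move=> r _; rewrite /dens /gg gamma_weight_le0// !mul0r mulr0.
  rewrite integral0_eq// => w _.
  by rewrite /kern /gg/= gamma_weight_le0// !mul0r mulr0.
have [x2|x2] := leP x.2 0.
  rewrite big1; last first.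
    by move=> r _; rewrite /dens /gg (gamma_weight_le0 n2 x2) mulr0 !mul0r mulr0.
  rewrite integral0_eq// => w _.
  by rewrite /kern /gg/= (gamma_weight_le0 n2 x2) mulr0 !mul0r mulr0.
transitivity ((gg x)%:E * \int[P]_w (S w *
    expR (- (x.1 * total mu true w + x.2 * total mu false w)))%:E)%E.
  rewrite -ge0_integralZl//; last 3 first.
  - apply/measurable_EFinP; apply: measurable_funM => //.
    do 2 apply: measurableT_comp => //.
    by apply: measurable_funD; apply: measurable_funM => //; exact: measurable_total.
  - by move=> w _; rewrite lee_fin mulr_ge0 ?expR_ge0.
  - by rewrite lee_fin.
  by apply: eq_integral => w _; rewrite -EFinM /kern/=; congr EFin; ring.
have := mixed_moment theta0 Hrho_supp Hrho_int mmu indep_mu laplace_mu mass_ae n e mE x1 x2.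
rewrite /Rintegral => H.
have fin : (\int[P]_w (S w * expR (- (x.1 * total mu true w + x.2 * total mu false w)))%:E)%E
    \is a fin_num.
  exact: integrable_fin_num (integrable_mixed P mmu n e mE x1 x2).
rewrite -[X in (_ * X)%E](fineK fin) H -EFinM; congr EFin.
rewrite mulr_sumr mulr_sumr; apply: eq_bigr => r _.
rewrite /dens /lap /Gr.
have -> : Num.max 0 x.1 = x.1 by apply/max_idPr/ltW.
have -> : Num.max 0 x.2 = x.2 by apply/max_idPr/ltW.
rewrite [X in gg x * (_ * X)](eq_bigr (fun b => fine (G0 (capE E b)) * (theta * tau b x))); last first.
  by move=> b _; rewrite mulrCA.
rewrite big_split/=; ring.
Qed.

Lemma integral_share :
  (\int[P]_w (\prod_(k < n) share mu (e k) w (E k))%:E =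
   \sum_(r <- configs n) (Gr r)%:E * \int[leb2]_x (dens r x)%:E)%E.
Proof.
transitivity (\int[P]_w \int[leb2]_x (kern (w, x))%:E)%E.
  apply: ae_eq_integral => //.
  - apply/measurable_EFinP; apply: measurable_prod => k _; exact: measurable_share.
  - apply: (@measurable_fun_fubini_tonelli_F _ _ Omega SS R leb2 (fun y => (kern y)%:E)).
      exact/measurable_EFinP.
    by move=> y; rewrite lee_fin kern_ge0.
  have [N [mN N0 NS]] := mass_ae; exists N; split => //.
  apply: subset_trans NS; apply: subsetC => w good _.
  have T0 b : 0 < total mu b w.
    by have /andP[T0 Ty] := good b; rewrite fine_gt0// T0.
  rewrite /kern/=; under eq_integral do rewrite EFinM.
  rewrite ge0_integralZl//; last 3 first.
  - apply/measurable_EFinP; apply: measurable_funM => //.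
    do 2 apply: measurableT_comp => //.
    by apply: measurable_funD; apply: measurable_funM.
  - by move=> x _; rewrite lee_fin mulr_ge0 ?expR_ge0.
  - by rewrite lee_fin.
  rewrite integral_gg// -EFinM; congr EFin.
  rewrite /S [in RHS]big_split/= prod_total -mulrA !exprVn.
  rewrite [X in _ = _ * X](_ : _ = 1) ?mulr1//.
  by field; rewrite !expf_neq0// gt_eqF.
rewrite (fubini_tonelli (fun y => (kern y)%:E)); last 2 first.
- exact/measurable_EFinP.
- by move=> y; rewrite lee_fin kern_ge0.
under eq_integral do rewrite integral_kern -sumEFin.
rewrite ge0_integral_sum//; last 2 first.
- by move=> r; apply/measurable_EFinP; exact: measurable_funM.
- by move=> r x _; rewrite lee_fin mulr_ge0.
apply: eq_bigr => r _; under eq_integral do rewrite EFinM.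
rewrite ge0_integralZl//; [exact/measurable_EFinP| |by rewrite lee_fin].
by move=> x _; rewrite lee_fin.
Qed.

End sets.

Lemma share_moments : exists w : seq (seq nat) -> R, (forall r, 0 <= w r) /\
  forall E : nat -> set Z, (forall k, measurable (E k)) ->
  (\int[P]_w (\prod_(k < n) share mu (e k) w (E k))%:E)%E =
  (\sum_(r <- configs n) w r * \prod_(b <- r) fine (G0 (capE E b)))%:E.
Proof.
pose W r := (\int[leb2]_x (dens r x)%:E)%E.
have W0 r : (0 <= W r)%E by apply: integral_ge0 => x _; rewrite lee_fin dens_ge0.
(* With every set equal to the whole space, the weights add up to the expectation of a number
   between 0 and 1. *)
have Wfin r : r \in configs n -> W r \is a fin_num.
  have := @integral_share (fun=> setT) (fun=> measurableT).
  under [X in _ = X -> _]eq_bigr => r' _.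
    rewrite big1; last first.
      move=> b _; rewrite (_ : capE _ b = setT) ?probability_setT//.
      by apply/seteqP; split.
    rewrite mul1e; over.
  move=> H.
  have : (\sum_(r <- configs n) W r)%E \is a fin_num.
    rewrite -H; apply: (integrable_fin_num measurableT).
    have i1 : P.-integrable setT (EFin \o (fun=> 1 : R)).
      exact: finite_measure_integrable_cst.
    apply: (le_integrableR _ _ i1).
      by apply: measurable_prod => k _; exact: measurable_share.
    move=> w; have h k : 0 <= share mu (e k) w setT <= 1 by exact: share_ge0_le1.
    rewrite ger0_norm; first by apply: prodr_ile1 => k _; exact: h.
    by apply: prodr_ge0 => k _; have /andP[] := h k.
  rewrite sum_fin_num => /allP h rn; apply: h; apply: map_f.
  by rewrite mem_filter.
exists (fun r => fine (W r)); split; first by move=> r; exact: fine_ge0.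
move=> E mE; rewrite integral_share// -sumEFin big_seq [RHS]big_seq.
by apply: eq_bigr => r rn; rewrite EFinM muleC fineK// Wfin.
Qed.

End share_moments.

(** * Laws of the mixture components *)

Section sigma_finite_alias.
Context (R : realType) d (T : measurableType d) (m : {measure set T -> \bar R}).

(** The proof of sigma-finiteness is an argument of the alias, so that the structure can be attached
    to measures whose sigma-finiteness is a lemma: [rho] and the product of two Lebesgue
    measures. *)
Definition sf_measure & sigma_finite setT m : set T -> \bar R := m.

Variable sf : sigma_finite setT m.
HB.instance Definition _ := Measure.copy (sf_measure sf) m.
HB.instance Definition _ := Measure_isSigmaFinite.Build _ _ _ (sf_measure sf) sf.

End sigma_finite_alias.

Lemma sigma_finite_prod (R : realType) d1 d2 (T1 : measurableType d1) (T2 : measurableType d2)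
    (m1 : {sigma_finite_measure set T1 -> \bar R})
    (m2 : {sigma_finite_measure set T2 -> \bar R}) :
  sigma_finite setT (m1 \x m2)%E.
Proof.
have /sigma_finiteP[F [TF ndF Foo]] := sigma_finiteT m1.
have /sigma_finiteP[G [TG ndG Goo]] := sigma_finiteT m2.
exists (fun n => F n `*` G n).
  rewrite -setXTT TF TG predeqE => -[x y]; split; last by move=> [n _ []/= ? ?]; split; exists n.
  move=> [/= [n _ Fnx] [k _ Gky]]; exists (maxn n k) => //; split.
  - by move: x Fnx; exact/subsetPset/ndF/leq_maxl.
  - by move: y Gky; exact/subsetPset/ndG/leq_maxr.
move=> k; have [? ?] := Foo k; have [? ?] := Goo k.
split; first exact: measurableX.
by rewrite product_measure1E// lte_mul_pinfty// ge0_fin_numE.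
Qed.

Section gamma_product.
Context {R : realType}.
Let SS : measurableType _ := (measurableTypeR R * measurableTypeR R)%type.

Let leb : {sigma_finite_measure set (measurableTypeR R) -> \bar R} := @lebesgue_measure R.

Lemma gamma_product (n1 n2 : nat) :
  exists leb2 : {sigma_finite_measure set SS -> \bar R},
  forall T1 T2 : R, 0 < T1 -> 0 < T2 ->
  (\int[leb2]_x (gamma_weight n1 x.1 * gamma_weight n2 x.2 *
      expR (- (x.1 * T1 + x.2 * T2)))%:E =
    (T1^-1 ^+ n1.+1 * T2^-1 ^+ n2.+1)%:E)%E.
Proof.
exists (sf_measure (sigma_finite_prod leb leb)) => T1 T2 T10 T20.
have mg N T : measurable_fun setT (fun u : measurableTypeR R => gamma_weight N u * expR (- (T * u))).
  apply: measurable_funM; first exact: measurable_gamma_weight.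
  by do 2 apply: measurableT_comp => //; exact: measurable_funM.
have g0 N T (u : R) : 0 <= gamma_weight N u * expR (- (T * u)).
  by rewrite mulr_ge0 ?expR_ge0 ?gamma_weight_ge0.
transitivity (\int[leb \x leb]_x ((gamma_weight n1 x.1 * expR (- (T1 * x.1))) *
    (gamma_weight n2 x.2 * expR (- (T2 * x.2))))%:E)%E.
  rewrite (@eq_measure_integral _ _ _ setT (leb \x leb)%E)//.
  apply: eq_integral => x _; congr EFin; rewrite [RHS]mulrACA -expRD.
  by congr (_ * expR _); ring.
rewrite (fubini_tonelli1 (fun x : SS =>
    ((gamma_weight n1 x.1 * expR (- (T1 * x.1))) *
    (gamma_weight n2 x.2 * expR (- (T2 * x.2))))%:E)).
- rewrite /fubini_F/=.
  transitivity (\int[leb]_u ((gamma_weight n1 u * expR (- (T1 * u)))%:E *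
      (T2^-1 ^+ n2.+1)%:E))%E.
    apply: eq_integral => u _; rewrite -(integral_gamma n2 T20).
    under eq_integral do rewrite EFinM.
    rewrite ge0_integralZl//; try (apply/measurable_EFinP; exact: mg);
      try (by move=> v _; rewrite lee_fin); by rewrite lee_fin.
  rewrite ge0_integralZr//.
  + by rewrite integral_gamma.
  + by apply/measurable_EFinP; exact: mg.
  + by move=> v _; rewrite lee_fin.
  + by rewrite lee_fin exprn_ge0// invr_ge0 ltW.
- apply/measurable_EFinP; apply: measurable_funM.
    by apply: (measurableT_comp (mg _ _)); exact: measurable_fst.
  by apply: (measurableT_comp (mg _ _)); exact: measurable_snd.
- by move=> x; rewrite lee_fin mulr_ge0.
Qed.

End gamma_product.

Lemma joinsP k r c : c \in joins k r ->
  exists r1 b r2, r = r1 ++ b :: r2 /\ c = r1 ++ (k :: b) :: r2.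
Proof.
elim: r c => //= b r ih c; rewrite inE => /orP[/eqP ->|/mapP[c' /ih[r1 [b' [r2 [-> ->]]]] ->]].
  by exists [::], b, r.
by exists (b :: r1), b', r2.
Qed.

Lemma configsSP K c : c \in configs K.+1 -> exists2 r, r \in configs K &
  c = [:: K] :: r \/ exists r1 b r2, r = r1 ++ b :: r2 /\ c = r1 ++ (K :: b) :: r2.
Proof.
move=> /= /flatten_mapP[r rK]; rewrite inE => /orP[/eqP ->|/joinsP h].
  by exists r => //; left.
by exists r => //; right.
Qed.

Lemma perm_flatten_configs K r : r \in configs K -> perm_eq (flatten r) (iota 0 K).
Proof.
elim: K r => [|K ih] r; first by rewrite inE => /eqP ->.
have E : perm_eq (iota 0 K.+1) (K :: iota 0 K).
  by rewrite -addn1 iotaD add0n cats1 perm_rcons.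
move=> /configsSP[s /ih sK [->|[r1 [b [r2 [sE ->]]]]]].
  by rewrite perm_sym (permPl E) /= perm_cons perm_sym.
rewrite perm_sym (permPl E) perm_sym flatten_cat/= -cat_cons.
rewrite perm_catCA/= perm_cons; rewrite sE flatten_cat/= in sK.
by rewrite perm_catCA.
Qed.

Section images_and_products.
Context {R : realType}.

Lemma image_probability d1 d2 (T1 : measurableType d1) (T2 : measurableType d2)
    (P : probability T1 R) (f : T1 -> T2) : measurable_fun setT f ->
  exists Q : probability T2 R,
    (forall B, Q B = P (f @^-1` B)) /\
    (forall D (g : T2 -> \bar R), measurable D -> measurable_fun setT g ->
       (forall y, (0 <= g y)%E) ->
       (\int[Q]_(y in D) g y = \int[P]_(x in f @^-1` D) g (f x))%E).
Proof.
move=> mf.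
pose F : {mfun T1 >-> T2} := HB.pack f (isMeasurableFun.Build _ _ _ _ f mf).
exists (distribution P F); split => // D g mD mg g0.
rewrite (@eq_measure_integral _ _ _ D (pushforward P f))//.
by rewrite ge0_integral_pushforward//; exact: measurable_funTS.
Qed.

Lemma product_probability d1 d2 (T1 : measurableType d1) (T2 : measurableType d2)
    (P1 : probability T1 R) (P2 : probability T2 R) :
  exists Q : probability (T1 * T2)%type R, forall f : T1 -> \bar R, forall A B,
    measurable A -> measurable B -> measurable_fun setT f -> (forall x, (0 <= f x)%E) ->
    (Q (A `*` B) = P1 A * P2 B)%E /\
    (\int[Q]_(z in A `*` B) f z.1 = (\int[P1]_(x in A) f x) * P2 B)%E.
Proof.
exists (P1 \x P2)%E => f A B mA mB mf f0.
split; first exact: product_measure1E.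
rewrite integral_mkcond epatch_indic.
transitivity (\int[(P1 \x P2)%E]_z (fun z => f z.1 * (\1_A z.1)%:E * (\1_B z.2)%:E) z)%E.
  apply: eq_integral => -[x y] _ /=; rewrite -muleA -EFinM; congr (_ * _%:E)%E.
  rewrite !indicE -natrM mulnb; congr (_%:R); congr nat_of_bool.
  apply/idP/idP => [/set_mem[/= h1 h2]|/andP[/set_mem h1 /set_mem h2]].
    by apply/andP; split; exact/mem_set.
  exact/mem_set.
rewrite fubini_tonelli1; last 2 first.
- apply: emeasurable_funM; first apply: emeasurable_funM.
  + by apply: (measurableT_comp mf); exact: measurable_fst.
  + apply/measurable_EFinP; apply: measurableT_comp; [exact: measurable_indic|exact: measurable_fst].
  + apply/measurable_EFinP; apply: measurableT_comp; [exact: measurable_indic|exact: measurable_snd].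
- by move=> z; rewrite !mule_ge0// lee_fin.
rewrite /fubini_F/=.
transitivity (\int[P1]_x (f x * (\1_A x)%:E * P2 B))%E.
  apply: eq_integral => x _; rewrite ge0_integralZl//.
  - by rewrite integral_indic// setIT.
  - exact/measurable_EFinP/measurable_indic.
  - by rewrite mule_ge0// lee_fin.
rewrite ge0_integralZr//.
- by rewrite [in RHS]integral_mkcond epatch_indic.
- by apply: emeasurable_funM => //; exact/measurable_EFinP/measurable_indic.
- by move=> x _; rewrite mule_ge0// lee_fin.
Qed.

End images_and_products.

(** * Data vectors as sequences with finitely many visible coordinates *)

Section cylinders.
Context d (X : measurableType d).

Definition proj (e : bool) (z : X * X) : X := if e then z.1 else z.2.

Definition cyl (e : bool) (A : set X) : set (X * X) := proj e @^-1` A.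

Lemma measurable_proj e : measurable_fun setT (proj e).
Proof. by case: e; [exact: measurable_fst|exact: measurable_snd]. Qed.

Lemma measurable_cyl e A : measurable A -> measurable (cyl e A).
Proof. by move=> mA; rewrite -[X in measurable X]setTI; exact: measurable_proj. Qed.

Definition coordgen (N : nat) : set (set (nat -> X)) :=
  \bigcup_(k in `I_N) preimage_set_system setT (fun v : nat -> X => v k) measurable.

(** A data vector is an entire sequence of which the sigma-algebra sees the first [N] coordinates
    only; indices stay plain natural numbers, and what stands beyond [N] is irrelevant. *)
Definition dataT (N : nat) := g_sigma_algebraType (coordgen N).

Lemma measurable_coord N k : (k < N)%N -> measurable_fun setT (fun v : dataT N => v k).
Proof.
move=> kN _ B mB; rewrite setTI; apply: sub_sigma_algebra.
by exists k => //; exists B => //; rewrite setTI.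
Qed.

Lemma measurable_dataP d' (T : measurableType d') N (f : T -> dataT N) :
  (forall k, (k < N)%N -> measurable_fun setT (fun t => f t k)) -> measurable_fun setT f.
Proof.
move=> mf; apply: (@measurability _ _ _ (dataT N) setT f (coordgen N)) => // _ [_ [k kN [B mB <-]] <-].
rewrite !setTI; rewrite -[X in measurable X]setTI; exact: mf.
Qed.

Definition rect (N : nat) (A : nat -> set X) : set (dataT N) :=
  \bigcap_(k in `I_N) ((fun v : dataT N => v k) @^-1` A k).

Arguments rect N A : clear implicits.

Lemma measurable_rect N A : (forall k, measurable (A k)) -> measurable (rect N A).
Proof.
move=> mA; apply: fin_bigcap_measurable => // k kN.
by rewrite -[X in measurable X]setTI; exact: measurable_coord.
Qed.

(** Rectangles generate the sigma-algebra, are stable under intersection, and include the whole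
    space. *)
Lemma data_measure_unique (R : realType) N (m1 m2 : {measure set (dataT N) -> \bar R}) :
  (m1 setT < +oo)%E ->
  (forall A, (forall k, measurable (A k)) -> m1 (rect N A) = m2 (rect N A)) ->
  forall D, measurable D -> m1 D = m2 D.
Proof.
move=> m1oo m12.
pose G := [set rect N A | A in [set A | forall k, measurable (A k)]].
apply: (measure_unique G (fun=> setT)) => //.
- apply/seteqP; split; last first.
    apply: smallest_sub; first exact: sigma_algebra_measurable.
    by move=> _ [A mA <-]; exact: measurable_rect.
  apply: smallest_sub; first exact: smallest_sigma_algebra.
  move=> _ [k kN [B mB <-]]; apply: sub_sigma_algebra.
  exists (fun j => if j == k then B else setT).
    by move=> j; case: ifP.
  rewrite setTI; apply/seteqP; split => [v h|v /= vB j jN /=].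
    by have := h k kN; rewrite /= eqxx.
  by case: eqP => [->//|].
- move=> _ _ [A mA <-] [B mB <-]; exists (fun k => A k `&` B k).
    by move=> k; exact: measurableI.
  apply/seteqP; split => [v h|v [hA hB] k kN]; last by split; [exact: hA|exact: hB].
  by split => k kN; have [] := h k kN.
- by move=> _; exists (fun=> setT) => //; apply/seteqP; split.
- by rewrite bigcup_const//; exists 0%N.
- by move=> _ [A mA <-]; exact: m12.
Qed.

End cylinders.
Arguments rect {d X} N A _.

Section realization.
Context {R : realType} d (X : measurableType d) (G0 : probability (X * X)%type R).
Variable e : nat -> bool.

Let cells (A : nat -> set X) k := cyl (e k) (A k).

Let value A (r : seq (seq nat)) : \bar R := (\prod_(b <- r) fine (G0 (capE (cells A) b)))%:E.

(** One factor of law [G0] is adjoined per block, and each item of the block reads its own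
    coordinate there. The underlying space depends on the blocks, hence the existential over
    measurable types; [uniq (flatten r)] keeps the new block apart from the items already
    realised. *)
Lemma realization (r : seq (seq nat)) : uniq (flatten r) ->
  exists (dS : measure_display) (S : measurableType dS) (Pr : probability S R)
    (O : nat -> S -> X), (forall k, measurable_fun setT (O k)) /\
    forall A, (forall k, measurable (A k)) ->
      Pr (\bigcap_(k in [set k | k \in flatten r]) (O k @^-1` A k)) = value A r.
Proof.
elim: r => [_|b r ih /=].
  exists _, (X * X)%type, G0, (fun=> fst); split; first by move=> k; exact: measurable_fst.
  move=> A mA; rewrite /value big_nil (_ : \bigcap_(_ in _) _ = setT) ?probability_setT//.
  by apply/seteqP; split.
rewrite cat_uniq => /and3P[_ /hasPn br /ih].
move=> [dS [S [Pr [Ob [mO HO]]]]].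
have [Q HQ] := product_probability G0 Pr.
exists _, (X * X * S)%type, Q, (fun k zs => if k \in b then proj (e k) zs.1 else Ob k zs.2).
split.
  move=> k; case: (k \in b).
    by apply: measurableT_comp; [exact: measurable_proj|exact: measurable_fst].
  by apply: measurableT_comp; [exact: mO|exact: measurable_snd].
move=> A mA.
have mc : measurable (capE (cells A) b).
  by apply: measurable_capE => k; exact: measurable_cyl.
set F := \bigcap_(k in [set k | k \in flatten r]) (Ob k @^-1` A k).
have mF : measurable F.
  apply: bigcap_measurableType => k _; rewrite -[X in measurable X]setTI; exact: mO.
have -> : \bigcap_(k in [set k | k \in b ++ flatten r])
    ((fun zs : X * X * S => if k \in b then proj (e k) zs.1 else Ob k zs.2) @^-1` A k) =
    capE (cells A) b `*` F.
  apply/seteqP; split => [[z s] h|[z s] [h1 h2] k /=].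
    split => k /= kb.
      by have := h k; rewrite /= mem_cat kb; exact.
    have := h k; rewrite /= mem_cat kb orbT (negbTE (br k kb)); exact.
  rewrite mem_cat => kb; case: ifPn => [kb'|nkb]; first exact: h1.
  by move: kb; rewrite (negbTE nkb)/=; exact: h2.
have [-> _] := HQ (cst 1%E) _ _ mc mF (measurable_cst _) (fun=> lee01).
rewrite HO// /value big_cons EFinM; congr (_ * _)%E.
by rewrite fineK// fin_num_measure.
Qed.

End realization.

(** * Conditional laws of [G0], and of the next item within a component *)

Section conditional_kernels.
Context {R : realType} d (X : measurableType d).
Variables (G0 : probability (X * X)%type R) (P0 : probability X R).
Hypothesis HG0marg : forall A : set X, measurable A ->
      G0 (A `*` setT) = P0 A /\ G0 (setT `*` A) = P0 A.
Variables (lam : {sigma_finite_measure set X -> \bar R})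
  (g0 : X * X -> R) (p0 : X -> R).
Hypotheses (Hg0m : measurable_fun setT g0) (Hg0pos : forall z, 0 <= g0 z).
Hypothesis Hg0 : forall A : set (X * X), measurable A ->
      G0 A = (\int[(lam \x lam)%E]_(z in A) (g0 z)%:E)%E.
Hypotheses (Hp0m : measurable_fun setT p0) (Hp0pos : forall x, 0 <= p0 x).
Hypothesis Hp0 : forall A : set X, measurable A -> P0 A = (\int[lam]_(x in A) (p0 x)%:E)%E.

Lemma marginal e A : measurable A -> G0 (cyl e A) = P0 A.
Proof.
move=> mA; have [h1 h2] := HG0marg mA; case: e.
  by rewrite -h1; congr (G0 _); apply/seteqP; split => [z|z []].
by rewrite -h2; congr (G0 _); apply/seteqP; split => [z|z []].
Qed.

Lemma integral_marginal e B (f : X -> \bar R) : measurable B -> measurable_fun setT f ->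
  (forall y, (0 <= f y)%E) ->
  (\int[G0]_(z in cyl e B) f (proj e z) = \int[P0]_(y in B) f y)%E.
Proof.
move=> mB mf f0.
have [Q [HQ1 HQ2]] := image_probability G0 (measurable_proj e).
rewrite -(HQ2 _ _ mB mf f0); apply: eq_measure_integral => A mA _.
by rewrite /= -(marginal e mA); first [exact: HQ1|exact/esym/HQ1].
Qed.

(** [eN] is the kind of the item to predict: one of the first kind shows the first coordinate, whose
    law given the second is [Rker]. *)
Definition cond_kernel (eN : bool) (y : X) (C : set X) : \bar R :=
  if eN then Rker lam g0 p0 y C else Qker lam g0 p0 y C.

Let pt (eN : bool) (c y : X) : X * X := if eN then (c, y) else (y, c).

Let inner eN (C : set X) (y : X) : \bar R := (\int[lam]_c (g0 (pt eN c y) * \1_C c)%:E)%E.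

Let mg0C eN C : measurable C ->
  measurable_fun setT (fun z => (g0 z * \1_C (proj eN z))%:E).
Proof.
move=> mC; apply/measurable_EFinP; apply: measurable_funM => //.
by apply: measurableT_comp; [exact: measurable_indic|exact: measurable_proj].
Qed.

Let g0C_ge0 eN C z : (0 <= (g0 z * \1_C (proj eN z))%:E)%E.
Proof. by rewrite lee_fin mulr_ge0. Qed.

Let innerE eN C : inner eN C = if eN then
   fubini_G lam (fun z => (g0 z * \1_C (proj eN z))%:E)
   else fubini_F lam (fun z => (g0 z * \1_C (proj eN z))%:E).
Proof. by case: eN. Qed.

Let cond_kernelE eN y C : cond_kernel eN y C = (inner eN C y * ((p0 y)^-1)%:E)%E.
Proof.
rewrite /cond_kernel /inner; case: eN; rewrite /Rker /Qker; congr (_ * _)%E;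
rewrite integral_mkcond; apply: eq_integral => c _; by rewrite epatch_indic/= EFinM.
Qed.

Let inner_ge0 eN C y : (0 <= inner eN C y)%E.
Proof. by apply: integral_ge0 => c _; rewrite lee_fin mulr_ge0. Qed.

Let measurable_inner eN C : measurable C -> measurable_fun setT (inner eN C).
Proof.
move=> mC; rewrite innerE; case: eN.
  apply: measurable_fun_fubini_tonelli_G; [exact: (@mg0C true)|exact: (@g0C_ge0 true)].
apply: measurable_fun_fubini_tonelli_F; [exact: (@mg0C false)|exact: (@g0C_ge0 false)].
Qed.

Lemma cond_kernel_ge0 eN y C : (0 <= cond_kernel eN y C)%E.
Proof. by rewrite cond_kernelE mule_ge0// lee_fin invr_ge0. Qed.

Lemma measurable_cond_kernel eN C : measurable C ->
  measurable_fun setT (fun y => cond_kernel eN y C).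
Proof.
move=> mC; under eq_fun do rewrite cond_kernelE.
apply: emeasurable_funM; first exact: measurable_inner.
by apply/measurable_EFinP; apply: measurableT_comp => //; exact: measurable_invr.
Qed.

Let integral_inner eN B C : measurable B -> measurable C ->
  (\int[lam]_y (inner eN C y * (\1_B y)%:E) = G0 (cyl eN C `&` cyl (~~ eN) B))%E.
Proof.
move=> mB mC.
pose f z := (g0 z * \1_C (proj eN z) * \1_B (proj (~~ eN) z))%:E.
have mf : measurable_fun setT f.
  apply/measurable_EFinP; apply: measurable_funM; last first.
    by apply: measurableT_comp; [exact: measurable_indic|exact: measurable_proj].
  apply: measurable_funM => //.
  by apply: measurableT_comp; [exact: measurable_indic|exact: measurable_proj].
have f0 z : (0 <= f z)%E by rewrite lee_fin !mulr_ge0.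
transitivity (\int[(lam \x lam)%E]_z f z)%E.
  case: eN @f mf f0 => f mf f0.
  - rewrite fubini_tonelli2//; apply: eq_integral => y _.
    rewrite /inner /fubini_G -ge0_integralZr//; try by first
      [apply/measurable_EFinP; apply: measurable_funM; last exact: measurable_indic;
       exact: (measurableT_comp Hg0m (measurable_pair2 y))
      |move=> c _; rewrite lee_fin mulr_ge0|rewrite lee_fin].
  - rewrite fubini_tonelli1//; apply: eq_integral => y _.
    rewrite /inner /fubini_F -ge0_integralZr//; try by first
      [apply/measurable_EFinP; apply: measurable_funM; last exact: measurable_indic;
       exact: (measurableT_comp Hg0m (measurable_pair1 y))
      |move=> c _; rewrite lee_fin mulr_ge0|rewrite lee_fin].
rewrite Hg0; last by apply: measurableI; exact: measurable_cyl.
rewrite [RHS]integral_mkcond epatch_indic; apply: eq_integral => z _.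
rewrite /f -mulrA EFinM; congr (_ * _%:E)%E.
rewrite !indicE -natrM mulnb; congr (_%:R); congr nat_of_bool.
apply/idP/idP => [/andP[/set_mem h1 /set_mem h2]|/set_mem[h1 h2]].
  exact/mem_set.
by apply/andP; split; exact/mem_set.
Qed.

(** The kernels disintegrate [G0]. Where [p0] vanishes the kernel is 0 by the convention on
    inverses, instead of a probability; this set is null for [P0] and the cylinder above it is null
    for [G0], so nothing is lost. *)
Lemma integral_cond_kernel eN B C : measurable B -> measurable C ->
  (\int[P0]_(y in B) cond_kernel eN y C = G0 (cyl eN C `&` cyl (~~ eN) B))%E.
Proof.
move=> mB mC.
pose B' := B `&` [set y | p0 y != 0].
have mp : measurable [set y | p0 y != 0].
  rewrite (_ : [set y | _] = ~` (p0 @^-1` [set 0])); last first.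
    by apply/seteqP; split => y /=; [move=> /eqP|move=> /eqP].
  by apply: measurableC; rewrite -[X in measurable X]setTI; exact: Hp0m.
have mB' : measurable B' by exact: measurableI.
have K0 y : (0 <= cond_kernel eN y C * (\1_B y)%:E)%E.
  by rewrite mule_ge0 ?cond_kernel_ge0// lee_fin.
have mK : measurable_fun setT (fun y => cond_kernel eN y C * (\1_B y)%:E)%E.
  apply: emeasurable_funM; first exact: measurable_cond_kernel.
  exact/measurable_EFinP/measurable_indic.
rewrite integral_mkcond epatch_indic.
(* Integration against [P0] becomes integration against [lam] with weight [p0], which cancels the
   inverse in the kernel wherever [p0] is nonzero. *)
have := @integral_weight R _ X lam _ X P0 p0 id 1 Hp0m Hp0pos (@measurable_id _ _ _).
have HW (D : set X) : measurable D ->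
    (\int[lam]_(w in id @^-1` D) (p0 w)%:E = 1%:E * P0 D)%E.
  by move=> mD; rewrite mul1e Hp0.
move=> /(_ HW _ mK K0); rewrite mul1e => <-.
transitivity (\int[lam]_y (inner eN C y * (\1_B' y)%:E))%E.
  apply: eq_integral => y _; rewrite cond_kernelE.
  have -> : \1_B' y = (p0 y)^-1 * p0 y * \1_B y :> R.
    have [y0|y0] := eqVneq (p0 y) 0.
      by rewrite y0 mulr0 mul0r indicE memNset//= => -[_]/=; rewrite y0 eqxx.
    rewrite mulVf// mul1r !indicE; congr (_%:R); congr nat_of_bool.
    by apply/idP/idP => [/set_mem[h _]|/set_mem h]; exact/mem_set.
  by rewrite !EFinM !muleA; congr (_ * _)%E; rewrite -muleA muleC.
rewrite integral_inner//.
apply/eqP; rewrite eq_le; apply/andP; split.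
  apply: le_measure; rewrite ?inE; try by apply: measurableI; exact: measurable_cyl.
  by move=> z [h1 [h2 _]]; split.
have mp' : measurable (~` [set y | p0 y != 0]) by exact: measurableC.
have zero : G0 (cyl (~~ eN) (~` [set y | p0 y != 0])) = 0%E.
  rewrite marginal// Hp0//; apply: integral0_eq => y /= /negP; rewrite negbK => /eqP ->.
  by [].
rewrite -[leRHS]adde0 -zero.
apply: le_trans (measureU2 _ _ _); try by [apply: measurableI; exact: measurable_cyl|exact: measurable_cyl].
apply: le_measure; rewrite ?inE; first by apply: measurableI; exact: measurable_cyl.
  by apply: measurableU; [apply: measurableI; exact: measurable_cyl|exact: measurable_cyl].
move=> z [h1 h2]; have [h|h] := pselect ([set y | p0 y != 0] (proj (~~ eN) z)).
  by left; split => //; split.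
by right.
Qed.

(** The law of the next item as seen from one item of its block, of kind [e] and value [y]: the same
    coordinate is copied, the opposite one is drawn conditionally. *)
Definition seen_kernel (e eN : bool) (y : X) (C : set X) : \bar R :=
  if e == eN then \d_y C else cond_kernel eN y C.

Lemma seen_kernel_ge0 e eN y C : (0 <= seen_kernel e eN y C)%E.
Proof.
rewrite /seen_kernel; case: ifP => _; last exact: cond_kernel_ge0.
by rewrite diracE lee_fin.
Qed.

Lemma measurable_seen_kernel e eN C : measurable C ->
  measurable_fun setT (fun y => seen_kernel e eN y C).
Proof.
move=> mC; rewrite /seen_kernel; case: (e == eN).
  by apply/measurable_EFinP; exact: measurable_indic.
exact: measurable_cond_kernel.
Qed.

Variables (e : nat -> bool) (N : nat).

Let cells (A : nat -> set X) k := cyl (e k) (A k).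

(** A block is summarised by one of its items. One of the kind of the next item is preferred, as it
    determines the coordinate to be shown; failing that, all items show the same opposite coordinate
    and any of them carries the whole information. *)
Lemma block_kernel (b : seq nat) : b != [::] -> exists2 k, k \in b &
  forall A C, (forall k, measurable (A k)) -> measurable C ->
  (\int[G0]_(z in capE (cells A) b) seen_kernel (e k) (e N) (proj (e k) z) C =
   G0 (capE (cells A) b `&` cyl (e N) C))%E.
Proof.
move=> b0; have [/hasP[k kb /eqP ek]|/hasPn opp] := boolP (has (fun k => e k == e N) b).
  exists k => // A C mA mC; rewrite /seen_kernel ek eqxx.
  have mb : measurable (capE (cells A) b).
    by apply: measurable_capE => j; exact: measurable_cyl.
  transitivity (\int[G0]_(z in capE (cells A) b) (\1_(cyl (e N) C) z)%:E)%E.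
    by apply: eq_integral => z _; rewrite diracE indicE.
  have mcN : measurable (cyl (e N) C) by exact: measurable_cyl.
  by rewrite (integral_indic _ mb mcN) setIC.
case: b b0 opp => // k0 b _ opp; exists k0; first exact: mem_head.
move=> A C mA mC.
have opp' k : k \in k0 :: b -> e k = ~~ e N.
  by move=> /opp; case: (e k); case: (e N).
pose B := \bigcap_(k in [set k | k \in k0 :: b]) A k.
have mB : measurable B by exact: bigcap_measurableType.
have -> : capE (cells A) (k0 :: b) = cyl (~~ e N) B.
  by apply/seteqP; split => z h k kb; have := h k kb; rewrite /cells /cyl /= (opp' k kb).
rewrite (opp' k0 (mem_head _ _)) /seen_kernel.
have -> : (~~ e N == e N) = false by case: (e N).
rewrite (integral_marginal (~~ e N) mB (measurable_cond_kernel (e N) mC) (cond_kernel_ge0 (e N) ^~ C)).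
by rewrite integral_cond_kernel// setIC.
Qed.

Definition kind_kernel (kind : option nat) (v : dataT X N) (C : set X) : \bar R :=
  if kind is Some k then seen_kernel (e k) (e N) (v k) C else P0 C.

(** Removing item [N] leaves a configuration of the first [N] items: [kind] is [None] if [N] was
    alone, and otherwise the item that represents its block. [kappa] is the law of the data in this
    component, which the second conclusion pins down on rectangles. *)
Lemma config_kernel c : c \in configs N.+1 ->
  exists (kappa : probability (dataT X N) R) (kind : option nat),
    (forall k, kind = Some k -> (k < N)%N) /\
    forall A, (forall k, measurable (A k)) ->
    ((\prod_(b <- c) fine (G0 (capE (cells A) b)))%:E =
      \int[kappa]_(v in rect N A) kind_kernel kind v (A N))%E /\
    (A N = setT -> (\prod_(b <- c) fine (G0 (capE (cells A) b)))%:E = kappa (rect N A)).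
Proof.
have mcap A b : (forall k, measurable (A k)) -> measurable (capE (cells A) b).
  by move=> mA; apply: measurable_capE => k; exact: measurable_cyl.
move=> /configsSP[r rN [->|[r1 [b [r2 [rE ->]]]]]].
  have perm := perm_flatten_configs rN.
  have ur : uniq (flatten r) by rewrite (perm_uniq perm) iota_uniq.
  have [dS [S [Pr [Ob [mO HO]]]]] := realization G0 e ur.
  pose dat (s : S) : dataT X N := fun k => Ob k s.
  have mdat : measurable_fun setT dat by apply: measurable_dataP => k _; exact: mO.
  have [Q [HQ1 HQ2]] := image_probability Pr mdat.
  exists Q, None; split => // A mA.
  have Qrect : Q (rect N A) = (\prod_(b <- r) fine (G0 (capE (cells A) b)))%:E.
    rewrite HQ1 -HO//; congr (Pr _); apply/seteqP; split => [s h k /=|s h k kN].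
      by rewrite (perm_mem perm) mem_iota add0n => kN; exact: h.
    by apply: h => /=; rewrite (perm_mem perm) mem_iota add0n.
  have capN : capE (cells A) [:: N] = cyl (e N) (A N).
    apply/seteqP; split => [z h|z h k /=]; first by apply: (h N); rewrite /= mem_head.
    by rewrite inE => /eqP ->.
  rewrite big_cons capN marginal//.
  split.
    rewrite integral_cst; last exact: measurable_rect.
    rewrite EFinM fineK ?fin_num_measure//; congr (_ * _)%E; exact/esym/Qrect.
  by move=> ->; rewrite probability_setT mul1r Qrect.
have b0 : b != [::].
  have /allP := configs_neq0 rN; apply; rewrite rE mem_cat mem_head orbT//.
have [k0 k0b Hk0] := block_kernel b0.
have perm := perm_flatten_configs rN.
have perm' : perm_eq (b ++ flatten (r1 ++ r2)) (iota 0 N).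
  apply: perm_trans perm; rewrite rE !flatten_cat/= perm_sym perm_catCA.
  by rewrite perm_refl.
have ub : uniq (b ++ flatten (r1 ++ r2)) by rewrite (perm_uniq perm') iota_uniq.
move: (ub); rewrite cat_uniq => /and3P[_ /hasPn br ur].
have [dS [S [Pr [Ob [mO HO]]]]] := realization G0 e ur.
have [Q HQ] := product_probability G0 Pr.
(* The block joined by [N] is left out of [realization] and gets a factor of its own, so that its
   location is at hand for the kernel. *)
pose dat (zs : X * X * S) : dataT X N :=
  fun k => if k \in b then proj (e k) zs.1 else Ob k zs.2.
have mdat : measurable_fun setT dat.
  apply: measurable_dataP => k _; rewrite /dat; case: (k \in b).
    by apply: measurableT_comp; [exact: measurable_proj|exact: measurable_fst].
  by apply: measurableT_comp; [exact: mO|exact: measurable_snd].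
have [Qd [HQ1 HQ2]] := image_probability Q mdat.
exists Qd, (Some k0); split.
  move=> _ [<-]; have : k0 \in iota 0 N by rewrite -(perm_mem perm') mem_cat k0b.
  by rewrite mem_iota.
have k0N : (k0 < N)%N.
  have : k0 \in iota 0 N by rewrite -(perm_mem perm') mem_cat k0b.
  by rewrite mem_iota.
move=> A mA.
set F := \bigcap_(k in [set k | k \in flatten (r1 ++ r2)]) (Ob k @^-1` A k).
have mF : measurable F.
  by apply: bigcap_measurableType => k _; rewrite -[X in measurable X]setTI; exact: mO.
have rectE : dat @^-1` rect N A = capE (cells A) b `*` F.
  apply/seteqP; split => [[z s] h|[z s] [h1 h2] k /= kN].
    split => k /= kb.
      have kN : (k < N)%N.
        have : k \in iota 0 N by rewrite -(perm_mem perm') mem_cat kb.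
        by rewrite mem_iota.
      by have := h k kN; rewrite /dat /= kb.
    have kN : (k < N)%N.
      have : k \in iota 0 N by rewrite -(perm_mem perm') mem_cat kb orbT.
      by rewrite mem_iota.
    by have := h k kN; rewrite /dat /= (negbTE (br k kb)).
  have kb : k \in b ++ flatten (r1 ++ r2) by rewrite (perm_mem perm') mem_iota.
  rewrite /dat; case: ifPn => [kb'|nkb]; first exact: h1.
  by move: kb; rewrite mem_cat (negbTE nkb)/=; exact: h2.
have capN : capE (cells A) (N :: b) = capE (cells A) b `&` cyl (e N) (A N).
  apply/seteqP; split => [z h|z [h1 h2] k /=].
    split; first by move=> k kb; apply: h; rewrite /= inE kb orbT.
    by apply: (h N); rewrite /= mem_head.
  by rewrite inE => /orP[/eqP ->//|]; exact: h1.
have prodE : \prod_(b0 <- r1 ++ (N :: b) :: r2) fine (G0 (capE (cells A) b0)) =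
    fine (G0 (capE (cells A) b `&` cyl (e N) (A N))) *
    \prod_(b0 <- r1 ++ r2) fine (G0 (capE (cells A) b0)).
  by rewrite !big_cat big_cons/= capN mulrCA.
have mI : measurable (capE (cells A) b `&` cyl (e N) (A N)).
  by apply: measurableI; [exact: mcap|exact: measurable_cyl].
have mker : measurable_fun setT (fun v : dataT X N => seen_kernel (e k0) (e N) (v k0) (A N)).
  apply: (measurableT_comp (measurable_seen_kernel (e k0) (e N) (mA N))).
  exact: measurable_coord.
have mker' : measurable_fun setT (fun z => seen_kernel (e k0) (e N) (proj (e k0) z) (A N)).
  by apply: (measurableT_comp (measurable_seen_kernel (e k0) (e N) (mA N))); exact: measurable_proj.
have [Q1 Q2] := HQ (fun z => seen_kernel (e k0) (e N) (proj (e k0) z) (A N)) _ _ (mcap A b mA) mF mker'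
  (fun z => seen_kernel_ge0 (e k0) (e N) (proj (e k0) z) (A N)).
rewrite prodE EFinM; split.
  rewrite /kind_kernel HQ2; last 3 first.
  - exact: measurable_rect.
  - exact: mker.
  - by move=> v; exact: seen_kernel_ge0.
  rewrite rectE (eq_integral (fun zs => seen_kernel (e k0) (e N) (proj (e k0) zs.1) (A N))); last first.
    by move=> zs _; rewrite /dat k0b.
  by rewrite Q2 Hk0// HO// fineK// fin_num_measure.
move=> AN; rewrite HQ1 rectE Q1 HO// AN (_ : cyl (e N) setT = setT)// setIT.
by rewrite fineK//; apply: fin_num_measure; exact: mcap.
Qed.

End conditional_kernels.

(** * Posterior weights *)

Section density_measure.
Context {R : realType} d (T : measurableType d) (m : {measure set T -> \bar R}).
Variable f : T -> \bar R.

(** The unnamed arguments are proofs that let the measure structure be attached, so that uniqueness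
    on rectangles can be applied to an integral against a density. *)
Definition mdensity & measurable_fun setT f & (forall x, (0 <= f x)%E) : set T -> \bar R :=
  fun A => (\int[m]_(x in A) f x)%E.

Variables (mf : measurable_fun setT f) (f0 : forall x, (0 <= f x)%E).

Let mdensity0 : mdensity mf f0 set0 = 0%E.
Proof. exact: integral_set0. Qed.

Let mdensity_ge0 A : (0 <= mdensity mf f0 A)%E.
Proof. exact: integral_ge0. Qed.

Let mdensity_sigma_additive : semi_sigma_additive (mdensity mf f0).
Proof.
move=> F mF tF mUF; apply: cvg_toP.
  apply: ereal_nondecreasing_is_cvgn => a b ab.
  by apply: lee_sum_nneg_natr => // k _ _; exact: integral_ge0.
by rewrite /mdensity ge0_integral_bigcup//; exact: measurable_funTS.
Qed.

HB.instance Definition _ := isMeasure.Build _ _ _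
  (mdensity mf f0) mdensity0 mdensity_ge0 mdensity_sigma_additive.

End density_measure.

Section posterior.
Context {R : realType} d (X : measurableType d).
Variables (G0 : probability (X * X)%type R) (P0 : probability X R).
Hypothesis HG0marg : forall A : set X, measurable A ->
      G0 (A `*` setT) = P0 A /\ G0 (setT `*` A) = P0 A.
Variables (lam : {sigma_finite_measure set X -> \bar R})
  (g0 : X * X -> R) (p0 : X -> R).
Hypotheses (Hg0m : measurable_fun setT g0) (Hg0pos : forall z, 0 <= g0 z).
Hypothesis Hg0 : forall A : set (X * X), measurable A ->
      G0 A = (\int[(lam \x lam)%E]_(z in A) (g0 z)%:E)%E.
Hypotheses (Hp0m : measurable_fun setT p0) (Hp0pos : forall x, 0 <= p0 x).
Hypothesis Hp0 : forall A : set X, measurable A -> P0 A = (\int[lam]_(x in A) (p0 x)%:E)%E.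
Variables (e : nat -> bool) (N : nat).
Variables (dO : measure_display) (Omega : measurableType dO) (P : probability Omega R).
Variable Ob : nat -> Omega -> X.
Hypothesis mO : forall k, measurable_fun setT (Ob k).
Variable wt : seq (seq nat) -> R.
Hypothesis wt0 : forall r, 0 <= wt r.
Hypothesis law : forall A : nat -> set X, (forall k, measurable (A k)) ->
  P (\bigcap_(k in `I_N.+1) (Ob k @^-1` A k)) =
  (\sum_(c <- configs N.+1) wt c *
    \prod_(b <- c) fine (G0 (capE (fun k => cyl (e k) (A k)) b)))%:E.

Let SK k := seen_kernel lam g0 p0 (e k) (e N).
Let KK := kind_kernel P0 lam g0 p0 e (N := N).
Let dat w : dataT X N := fun k => Ob k w.
Let cs := configs N.+1.

Let mdat : measurable_fun setT dat.
Proof. by apply: measurable_dataP => k _; exact: mO. Qed.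

Let KK_ge0 kind v C : (0 <= KK kind v C)%E.
Proof. by rewrite /KK /kind_kernel; case: kind => [k|]//; exact: seen_kernel_ge0. Qed.

Let measurable_KK kind C : (forall k, kind = Some k -> (k < N)%N) -> measurable C ->
  measurable_fun setT (fun v => KK kind v C).
Proof.
move=> kN mC; rewrite /KK /kind_kernel; case: kind kN => [k|] kN; last exact: measurable_cst.
apply: (measurableT_comp (measurable_seen_kernel lam Hg0m Hg0pos Hp0m (e k) (e N) mC)).
by apply: measurable_coord; exact: kN.
Qed.

Let upd (A : nat -> set X) (C : set X) k := if k == N then C else A k.

Let mupd A C : (forall k, measurable (A k)) -> measurable C -> forall k, measurable (upd A C k).
Proof. by move=> mA mC k; rewrite /upd; case: ifP. Qed.

Let rect_upd A C : rect N (upd A C) = rect N A.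
Proof.
by apply/seteqP; split => v h k kN; have := h k kN; rewrite /upd /= (ltn_eqF kN).
Qed.

Let updN A C : upd A C N = C. Proof. by rewrite /upd eqxx. Qed.

Let dat_rect A C : dat @^-1` rect N A `&` Ob N @^-1` C =
  \bigcap_(k in `I_N.+1) (Ob k @^-1` upd A C k).
Proof.
apply/seteqP; split => [w [h1 h2] k /=|w h].
  rewrite ltnS leq_eqVlt => /orP[/eqP ->|kN]; first by rewrite updN.
  by rewrite /upd (ltn_eqF kN); exact: h1.
split; last by have := h N (ltnSn N); rewrite updN.
by move=> k kN; have := h k (ltnW kN); rewrite /upd (ltn_eqF kN).
Qed.

(** Bayes' rule in density form: the joint law of the data and the next item is a sum of [kappa c]
    times a kernel that depends on [kind c] alone, so the densities are grouped by kind. The weights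
    are indexed by items here, equal observations being merged later. *)
Lemma posterior :
  exists (rho0 : dataT X N -> R) (rhok : nat -> dataT X N -> R),
  [/\ measurable_fun setT rho0 /\ (forall k, measurable_fun setT (rhok k)),
      (forall v, 0 <= rho0 v) /\ (forall k v, 0 <= rhok k v),
      (forall v, rho0 v + \sum_(k < N) rhok k v = 1) &
      forall C D, measurable C -> measurable D ->
        P (dat @^-1` D `&` Ob N @^-1` C) =
        (\int[P]_(w in dat @^-1` D) ((rho0 (dat w))%:E * P0 C +
           \sum_(k < N) (rhok k (dat w))%:E * SK k (Ob k w) C))%E].
Proof.
have [M [HM1 HM2]] := image_probability P mdat.
have /choice[kk Hkk] : forall c, exists kk : probability (dataT X N) R * option nat,
    c \in cs -> (forall k, kk.2 = Some k -> (k < N)%N) /\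
    forall A, (forall k, measurable (A k)) ->
    ((\prod_(b <- c) fine (G0 (capE (fun k => cyl (e k) (A k)) b)))%:E =
      \int[kk.1]_(v in rect N A) KK kk.2 v (A N))%E /\
    (A N = setT ->
     (\prod_(b <- c) fine (G0 (capE (fun k => cyl (e k) (A k)) b)))%:E = kk.1 (rect N A)).
  move=> c; have [cN|cN] := boolP (c \in cs); last by exists (M, None).
  have [kappa [kind [h1 h2]]] := config_kernel HG0marg Hg0m Hg0pos Hg0 Hp0m Hp0pos Hp0 e cN.
  by exists (kappa, kind).
pose kappa c := (kk c).1; pose kind c := (kk c).2.
have kindN c k : c \in cs -> kind c = Some k -> (k < N)%N by move=> /Hkk[h _]; exact: h.
have Mmix D : measurable D -> (M D = \sum_(c <- cs) (wt c)%:E * kappa c D)%E.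
  move=> mD.
  pose m_ i := mscale (NngNum (wt0 (nth [::] cs i))) (kappa (nth [::] cs i)).
  have mE B : msum m_ (size cs) B = (\sum_(c <- cs) (wt c)%:E * kappa c B)%E.
    by rewrite /msum [RHS](big_nth [::]) big_mkord.
  rewrite -mE; apply: data_measure_unique mD.
    by rewrite (le_lt_trans (probability_le1 M measurableT))// ltry.
  move=> A mA; rewrite [RHS]mE.
  transitivity (M (rect N (upd A setT))); first by rewrite rect_upd.
  have mA' := mupd mA measurableT.
  rewrite HM1 -(setIT (_ @^-1` _)) -(preimage_setT (Ob N)) rect_upd dat_rect law// -sumEFin.
  rewrite big_seq [RHS]big_seq; apply: eq_bigr => c cN; rewrite EFinM; congr (_ * _)%E.
  have [_ /(_ _ mA')[_ ->]] := Hkk c cN; last exact: updN.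
  by rewrite rect_upd.
(* A component of positive weight is dominated by the law of the data, in whose mixture it occurs;
   one of weight 0 need not be, and receives density 0 instead. *)
pose live c := (c \in cs) && (0 < wt c).
have dom c : live c -> kappa c `<< M.
  move=> /andP[cN w0]; apply/null_content_dominatesP => A mA MA0.
  have S0 : (\sum_(c <- cs) (wt c)%:E * kappa c A = 0)%E := etrans (esym (Mmix A mA)) MA0.
  have t0 c' : (0 <= (wt c')%:E * kappa c' A)%E by rewrite mule_ge0// lee_fin.
  have := S0; rewrite (big_rem c)//= => /eqP.
  rewrite padde_eq0//; last by apply: sume_ge0 => c' _; exact: t0.
  by rewrite mule_eq0 eqe gt_eqF//= => /andP[/eqP ? _].
pose RN c := Radon_Nikodym_SigmaFinite.f (kappa c) M.
pose g c v : R := if live c then wt c * fine (RN c v) else 0.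
have gge0 c v : 0 <= g c v.
  rewrite /g; case: ifP => // w0; rewrite mulr_ge0// fine_ge0//.
  exact: Radon_Nikodym_SigmaFinite.f_ge0 (dom c w0) v.
have mg c : measurable_fun setT (g c).
  rewrite /g; have [w0|w0] := boolP (live c); last exact: measurable_cst.
  apply: measurable_funM => //; apply: measurableT_comp => //.
  exact: measurable_int (Radon_Nikodym_SigmaFinite.f_integrable (dom c w0)).
have gint c D (f : dataT X N -> \bar R) : c \in cs -> measurable D -> measurable_fun setT f ->
    (forall v, 0 <= f v)%E ->
    (\int[M]_(v in D) ((g c v)%:E * f v) = (wt c)%:E * \int[kappa c]_(v in D) f v)%E.
  move=> cN mD mf f0; rewrite /g; have [w0|w0] := boolP (live c); last first.
    have -> : wt c = 0.
      by apply/eqP; rewrite eq_le wt0 andbT; move: w0; rewrite /live cN/= -leNgt.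
    by rewrite mul0e integral0_eq// => v _; rewrite mul0e.
  rewrite -(Radon_Nikodym_SigmaFinite.change_of_variables (dom c w0) f0 mD (measurable_funTS mf)).
  rewrite -ge0_integralZl//; last 3 first.
  - apply: emeasurable_funM; apply: measurable_funTS => //.
    exact: measurable_int (Radon_Nikodym_SigmaFinite.f_integrable (dom c w0)).
  - by move=> v _; rewrite mule_ge0// Radon_Nikodym_SigmaFinite.f_ge0//; exact: dom.
  - by rewrite lee_fin.
  apply: eq_integral => v _; rewrite EFinM fineK; first by rewrite -muleA (muleC _ (f v)).
  exact: Radon_Nikodym_SigmaFinite.f_fin_num (dom c w0) v.
pose sg v := \sum_(c <- cs) g c v.
have msg : measurable_fun setT sg by exact: measurable_sum.
have int_sum D (f : seq (seq nat) -> dataT X N -> \bar R) : measurable D ->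
    (forall c, measurable_fun setT (f c)) -> (forall c v, 0 <= f c v)%E ->
    (\int[M]_(v in D) (\sum_(c <- cs) (g c v)%:E * f c v) =
      \sum_(c <- cs) (wt c)%:E * \int[kappa c]_(v in D) f c v)%E.
  move=> mD mf f0; rewrite ge0_integral_sum//; last 2 first.
  - move=> c; apply: measurable_funTS; apply: emeasurable_funM => //.
    exact/measurable_EFinP.
  - by move=> c v _; rewrite mule_ge0// lee_fin.
  by rewrite big_seq [RHS]big_seq; apply: eq_bigr => c cN; exact: gint.
have sg1 : ae_eq M setT (cst 1%E) (EFin \o sg).
  apply: integral_ae_eq => //.
  - exact: finite_measure_integrable_cst.
  - exact/measurable_EFinP.
  move=> D _ mD; rewrite integral_cst// mul1e.
  transitivity (\sum_(c <- cs) (wt c)%:E * kappa c D)%E; first exact: Mmix.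
  transitivity (\int[M]_(v in D) (\sum_(c <- cs) (g c v)%:E * cst 1%E v))%E.
    rewrite (int_sum D (fun=> cst 1%E) mD (fun=> measurable_cst _) (fun _ _ => lee01)).
    by apply: eq_bigr => c _; rewrite integral_cst// mul1e.
  by apply: eq_integral => v _; under eq_bigr do rewrite mule1; rewrite sumEFin.
(* The default outside the list makes the bound [kindcN] hold for every [c], so that measurability
   can be proved termwise. *)
pose kindc c := if c \in cs then kind c else None.
have kindcN c k : kindc c = Some k -> (k < N)%N.
  by rewrite /kindc; case: ifP => // cN; exact: kindN.
have mKK c C : measurable C -> measurable_fun setT (fun v => KK (kindc c) v C).
  by move=> mC; apply: measurable_KK => // k; exact: kindcN.
have joint C D : measurable C -> measurable D ->
    (P (dat @^-1` D `&` Ob N @^-1` C) =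
     \int[M]_(v in D) (\sum_(c <- cs) (g c v)%:E * KK (kindc c) v C))%E.
  move=> mC mD.
  have mOC : measurable (Ob N @^-1` C) by rewrite -[X in measurable X]setTI; exact: mO.
  have mF : measurable_fun setT (fun v => \sum_(c <- cs) (g c v)%:E * KK (kindc c) v C)%E.
    apply: emeasurable_sum => c; apply: emeasurable_funM; last exact: mKK.
    exact/measurable_EFinP.
  have F0 v : (0 <= \sum_(c <- cs) (g c v)%:E * KK (kindc c) v C)%E.
    by apply: sume_ge0 => c _; rewrite mule_ge0// lee_fin.
  (* For fixed [C] both sides are measures in [D]; they agree on rectangles by [law] and by the
     kernel of each component. *)
  have H := @data_measure_unique _ _ R N (pushforward (mrestr P mOC) dat) (mdensity M mF F0).
  apply: (H mdat _ _ D mD).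
    apply: (@le_lt_trans _ _ 1%E); last exact: ltry.
    change (P ([set: Omega] `&` Ob N @^-1` C) <= 1)%E.
    by rewrite setTI; exact: probability_le1.
  move=> A mA.
  transitivity (P (dat @^-1` rect N A `&` Ob N @^-1` C)) => //.
  rewrite dat_rect law; last exact: mupd.
  transitivity (\int[M]_(v in rect N A) (\sum_(c <- cs) (g c v)%:E * KK (kindc c) v C))%E => //.
  rewrite (int_sum _ (fun c v => KK (kindc c) v C)); [|exact: measurable_rect|by move=> c; exact: mKK|by []].
  rewrite -sumEFin big_seq [RHS]big_seq; apply: eq_bigr => c cN; rewrite EFinM; congr (_ * _)%E.
  have [_ /(_ _ (mupd mA mC))[-> _]] := Hkk c cN.
  by rewrite updN rect_upd /kindc cN.
(* The densities sum to 1 only almost everywhere. On the exceptional null set all the weight goes to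
   [P0], so that the weights sum to 1 at every data vector. *)
pose rho0 v := if sg v == 1 then \sum_(c <- cs) (kindc c == None)%:R * g c v else 1.
pose rhok k v := if sg v == 1 then \sum_(c <- cs) (kindc c == Some k)%:R * g c v else 0.
have kind_sum c : (kindc c == None)%:R + \sum_(k < N) (kindc c == Some (k : nat))%:R = 1 :> R.
  have := @kindcN c; case: (kindc c) => [k /(_ k erefl) kN|_].
    rewrite add0r (bigD1 (Ordinal kN))//= eqxx big1 ?addr0// => i.
    by rewrite -val_eqE/= eq_sym => /negbTE ik; rewrite (inj_eq Some_inj) ik.
  by rewrite eqxx big1 ?addr0.
have meq : measurable_fun setT (fun v => sg v == 1).
  apply: (measurable_fun_bool true) => /=.
  rewrite (_ : _ @^-1` _ = sg @^-1` [set 1]); last first.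
    apply/seteqP; split => v /= h; last by rewrite h eqxx.
    by apply/eqP; rewrite h.
  by have := msg measurableT _ (measurable_set1 1); rewrite setTI.
have mrho0 : measurable_fun setT rho0.
  apply: measurable_fun_ifT => //; apply: measurable_sum => c.
  exact: measurable_funM.
have mrhok k : measurable_fun setT (rhok k).
  apply: measurable_fun_ifT => //; apply: measurable_sum => c.
  exact: measurable_funM.
have rho00 v : 0 <= rho0 v.
  by rewrite /rho0; case: ifP => // _; apply: sumr_ge0 => c _; rewrite mulr_ge0.
have rhok0 k v : 0 <= rhok k v.
  by rewrite /rhok; case: ifP => // _; apply: sumr_ge0 => c _; rewrite mulr_ge0.
exists rho0, rhok; split => //.
  move=> v; rewrite /rho0 /rhok; case: eqP => [sv|_]; last by rewrite big1 ?addr0.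
  rewrite exchange_big/= -big_split/= -[RHS]sv; apply: eq_bigr => c _.
  by rewrite -mulr_suml -mulrDl kind_sum mul1r.
move=> C D mC mD; rewrite joint//.
have mSK k : (k < N)%N -> measurable_fun setT (fun v : dataT X N => SK k (v k) C).
  by move=> kN; have := @measurable_KK (Some k) C; apply => // j [<-].
have SK0 k y : (0 <= SK k y C)%E by exact: seen_kernel_ge0.
pose F v := ((rho0 v)%:E * P0 C + \sum_(k < N) (rhok k v)%:E * SK k (v k) C)%E.
have mF : measurable_fun setT F.
  apply: emeasurable_funD.
    by apply: emeasurable_funM => //; exact/measurable_EFinP.
  apply: emeasurable_sum => k; apply: emeasurable_funM; last exact: mSK.
  exact/measurable_EFinP.
have F0 v : (0 <= F v)%E.
  rewrite adde_ge0//; first by rewrite mule_ge0// lee_fin.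
  by apply: sume_ge0 => k _; rewrite mule_ge0// lee_fin.
transitivity (\int[M]_(v in D) F v)%E; last by rewrite HM2.
apply: ae_eq_integral => //.
- apply: measurable_funTS; apply: emeasurable_sum => c; apply: emeasurable_funM; last exact: mKK.
  exact/measurable_EFinP.
- exact: measurable_funTS.
have [B [mB MB BS]] := sg1; exists B; split => //; apply: subset_trans BS; apply: subsetC.
move=> v /= sv _; have {}sv : sg v = 1 by have := sv I; case.
rewrite /F /rho0 /rhok sv eqxx.
rewrite -sumEFin ge0_sume_distrl; last by move=> c _; rewrite lee_fin mulr_ge0.
under [X in (_ = _ + X)%E]eq_bigr => k _.
  rewrite -sumEFin ge0_sume_distrl; last by move=> c _; rewrite lee_fin mulr_ge0.
  over.
rewrite exchange_big/= -big_split/=; apply: eq_bigr => c _.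
have := @kindcN c; rewrite /KK; case: (kindc c) => [k /(_ k erefl) kN|_] /=.
  rewrite mul0r mul0e add0e (bigD1 (Ordinal kN))//= eqxx mul1r big1 ?adde0// => i.
  by rewrite -val_eqE/= eq_sym => /negbTE ik; rewrite (inj_eq Some_inj) ik mul0r mul0e.
by rewrite mul1r big1 ?adde0// => k _; rewrite mul0r mul0e.
Qed.

End posterior.

(** Off the diagonal, some ball of radius 1/(p+1) < dist x y / 2 around a point of the dense
    sequence contains [x] and misses [y]; so the complement is a countable union of measurable
    rectangles. *)
Lemma measurable_diagonal (R : realType) d (X : measurableType d) :
  polish_space R X -> measurable [set z : X * X | z.1 = z.2].
Proof.
move=> [dist [[d0 dC] dtri _ [S HS] Xborel]].
have mball x e : measurable (dist_ball dist x e).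
  rewrite Xborel; apply: sub_sigma_algebra => y xy.
  exists (e - dist x y); first by rewrite subr_gt0.
  by move=> z /= yz; rewrite /dist_ball/=; have := dtri x y z; rewrite /dist_ball/= in yz; lra.
have dge0 x y : 0 <= dist x y.
  have := dtri x y x; rewrite (dC y x) ((d0 x x).2 erefl); lra.
rewrite -[X in measurable X]setCK; apply: measurableC.
rewrite (_ : ~` _ = \bigcup_k \bigcup_p
   (dist_ball dist (S k) p.+1%:R^-1 `*` ~` dist_ball dist (S k) p.+1%:R^-1)).
  apply: bigcupT_measurable => k; apply: bigcupT_measurable => p.
  by apply: measurableX => //; exact: measurableC.
apply/seteqP; split => [[x y] /= xy|[x y] [k _ [p _ []]] /= h1 h2 xy]; last first.
  by apply: h2; rewrite -xy.
have dpos : 0 < dist x y.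
  by rewrite lt_neqAle dge0 andbT eq_sym; apply/eqP => /d0.
have dpos2 : 0 < dist x y / 2 by rewrite divr_gt0.
have [p Hp] : exists p : nat, p.+1%:R^-1 < dist x y / 2.
  exists (Num.truncn (dist x y / 2)^-1).
  rewrite invf_plt ?posrE ?ltr0n//; exact: truncnS_gt.
have p0 : 0 < p.+1%:R^-1 :> R by rewrite invr_gt0.
have [k Hk] := HS x _ p0.
exists k => //; exists p => //; split; first by rewrite /dist_ball/= dC.
rewrite /dist_ball/= => h; have := dtri x (S k) y; apply/negP; rewrite -ltNge.
by rewrite [ltRHS]splitr ltrD// (lt_trans _ Hp).
Qed.

(** * Weights pooled over equal observations *)

Lemma index_undup_map (T : eqType) (f g : nat -> T) (l : seq nat) k :
  (forall i j, i \in k :: l -> j \in k :: l -> (f i == f j) = (g i == g j)) ->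
  index (f k) (undup (map f l)) = index (g k) (undup (map g l)).
Proof.
elim: l => //= a l ih fg.
have mem_map_eq : (f a \in map f l) = (g a \in map g l).
  apply/idP/idP => /mapP[j jl /eqP aj]; apply/mapP; exists j => //; apply/eqP;
  by move: aj; rewrite fg// !inE ?eqxx ?jl ?orbT.
have ih' : index (f k) (undup (map f l)) = index (g k) (undup (map g l)).
  apply: ih => i j; rewrite !inE => il jl; apply: fg; rewrite !inE.
    by case/orP: il => ->; rewrite ?orbT.
  by case/orP: jl => ->; rewrite ?orbT.
rewrite mem_map_eq; case: ifP => // _ /=.
by rewrite ih' fg// !inE ?eqxx ?orbT.
Qed.

Section distinct_values.
Context {R : realType} d (X : measurableType d) dO (Omega : measurableType dO).
Hypothesis diag : measurable [set z : X * X | z.1 = z.2].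
Variables (Zs : nat -> Omega -> X) (n : nat).
Hypothesis mZ : forall k, (k < n)%N -> measurable_fun setT (Zs k).

Let xs w := distinct_vals Zs n w.
Let idx k w := index (Zs k w) (xs w).

Let mem_xs k w : (k < n)%N -> Zs k w \in xs w.
Proof. by move=> kn; rewrite mem_undup; apply: map_f; rewrite mem_iota. Qed.

Let measurable_eqZ i j : (i < n)%N -> (j < n)%N -> measurable [set w | Zs i w = Zs j w].
Proof.
move=> iN jN; have mp := measurable_fun_pair (mZ iN) (mZ jN).
by have := mp measurableT _ diag; rewrite setTI.
Qed.

Let FF : finType := {ffun 'I_n * 'I_n -> bool}.
Let pat w : FF := [ffun p : 'I_n * 'I_n => Zs p.1 w == Zs p.2 w].

(** The position of an item among the distinct values depends only on which items are equal; the
    finitely many equality patterns are events because the diagonal is measurable. *)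
Lemma measurable_index k i : (k < n)%N -> measurable [set w | idx k w = i].
Proof.
move=> kn.
have mcell p : measurable [set w | pat w = p].
  rewrite (_ : [set w | _] = \bigcap_(q in [set: 'I_n * 'I_n])
     (if p q then [set w | Zs q.1 w = Zs q.2 w] else ~` [set w | Zs q.1 w = Zs q.2 w])).
    apply: fin_bigcap_measurable => // q _; case: (p q).
      by apply: measurable_eqZ; exact: ltn_ord.
    by apply: measurableC; apply: measurable_eqZ; exact: ltn_ord.
  apply/seteqP; split => [w /= <- q _|w h].
    by rewrite ffunE; case: eqP.
  apply/ffunP => q; rewrite ffunE; have := h q I.
  by case: (p q) => /= [->|/eqP/negbTE //]; rewrite eqxx.
rewrite (_ : [set w | _] = \bigcup_(p in [set p | exists2 w, pat w = p & idx k w = i])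
    [set w | pat w = p]).
  by apply: fin_bigcup_measurable => // p _; exact: mcell.
apply/seteqP; split => [w /= wi|w /= [p [w' w'p <-]] /= wp].
  by exists (pat w) => //; exists w.
apply: (@index_undup_map _ (Zs ^~ w) (Zs ^~ w')) => a b.
have lt c : c \in k :: iota 0 n -> (c < n)%N.
  by rewrite inE mem_iota add0n => /orP[/eqP ->|].
move=> /lt an /lt bn; have := congr1 (fun p : FF => p (Ordinal an, Ordinal bn)) wp.
by rewrite -w'p !ffunE.
Qed.

Variable a : nat -> Omega -> R.

Definition pooled (i : nat) (w : Omega) : R :=
  \sum_(k < n) (idx k w == i)%:R * a k w.

Lemma measurable_pooled i : (forall k, (k < n)%N -> measurable_fun setT (a k)) ->
  measurable_fun setT (pooled i).
Proof.
move=> ma; apply: measurable_sum => k; apply: measurable_funM; last exact: ma.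
rewrite (_ : (fun w => _) = \1_[set w | idx k w = i]).
  by apply: measurable_indic; exact: measurable_index.
apply/funext => w; rewrite indicE; congr (_%:R); congr nat_of_bool.
by apply/eqP/idP => [h|/set_mem//]; exact/mem_set.
Qed.

Lemma pooled_ge0 i w : (forall k, (k < n)%N -> 0 <= a k w) -> 0 <= pooled i w.
Proof. by move=> a0; apply: sumr_ge0 => k _; rewrite mulr_ge0// a0. Qed.

Lemma sum_pooled w : \sum_(i < size (xs w)) pooled i w = \sum_(k < n) a k w.
Proof.
rewrite /pooled exchange_big/=; apply: eq_bigr => k _.
have ik : (idx k w < size (xs w))%N by rewrite index_mem mem_xs.
rewrite -mulr_suml (bigD1 (Ordinal ik))//= eqxx big1 ?addr0 ?mul1r// => i.
by rewrite -val_eqE/= eq_sym => /negbTE ->.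
Qed.

Lemma esum_pooled w (h : X -> \bar R) : (forall k, (k < n)%N -> 0 <= a k w) ->
  (\sum_(i < size (xs w)) (pooled i w)%:E * h (nth point (xs w) i) =
   \sum_(k < n) (a k w)%:E * h (Zs k w))%E.
Proof.
move=> a0.
under eq_bigr => i _.
  rewrite /pooled -sumEFin ge0_sume_distrl; last first.
    by move=> k _; rewrite lee_fin mulr_ge0// a0.
  over.
rewrite exchange_big/=; apply: eq_bigr => k _.
have ik : (idx k w < size (xs w))%N by rewrite index_mem mem_xs.
rewrite (bigD1 (Ordinal ik))//= eqxx mul1r nth_index ?mem_xs// big1 ?adde0// => i.
by rewrite -val_eqE/= eq_sym => /negbTE ->; rewrite mul0r mul0e.
Qed.

End distinct_values.

Section data_sigma_algebra.
Context {R : realType} d (X : measurableType d) dO (Omega : measurableType dO).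
Variables (Xs Ys : nat -> Omega -> X) (n m : nat).

Variable Ob : nat -> Omega -> X.
Hypothesis Ob_X : forall k, (k < n)%N -> Ob k = Xs k.
Hypothesis Ob_Y : forall k, (k < m)%N -> Ob (n + k)%N = Ys k.

(** The outcome space under the sigma-algebra of the data: measurability with respect to the data
    becomes plain measurability, and the results on pooled weights apply to it as they stand. *)
Definition dataOmega := g_sigma_algebraType (sigma_gen_seq Xs n `|` sigma_gen_seq Ys m).

Let dat (w : Omega) : dataT X (n + m) := fun k => Ob k w.

Lemma measurable_Xs_data k : (k < n)%N -> measurable_fun setT (Xs k : dataOmega -> X).
Proof.
move=> kn _ B mB; rewrite setTI; apply: sub_sigma_algebra; left.
by exists k => //; exists B => //; rewrite setTI.
Qed.

Lemma measurable_Ys_data k : (k < m)%N -> measurable_fun setT (Ys k : dataOmega -> X).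
Proof.
move=> kn _ B mB; rewrite setTI; apply: sub_sigma_algebra; right.
by exists k => //; exists B => //; rewrite setTI.
Qed.

Lemma measurable_dat : measurable_fun setT (dat : dataOmega -> dataT X (n + m)).
Proof.
apply: measurable_dataP => k kN; rewrite /dat; have [kn|nk] := ltnP k n.
  by rewrite Ob_X//; exact: measurable_Xs_data.
have km : (k - n < m)%N by rewrite ltn_subLR.
by rewrite -(subnKC nk) Ob_Y//; exact: measurable_Ys_data.
Qed.

Lemma measurable_wrtP (f : Omega -> R) :
  measurable_fun setT (f : dataOmega -> R) -> measurable_wrt (sigma_data Xs Ys n m) f.
Proof. by move=> mf B mB; have := mf measurableT B mB; rewrite setTI. Qed.

(** The preimages under [dat] form a sigma-algebra that contains the generators; an event of the
    data can thus be handled as a set of data vectors. *)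
Lemma sigma_dataP D : sigma_data Xs Ys n m D ->
  exists2 D' : set (dataT X (n + m)), measurable D' & D = dat @^-1` D'.
Proof.
pose C := [set D | exists2 D' : set (dataT X (n + m)), measurable D' & D = dat @^-1` D'].
apply: (@smallest_sub _ _ _ C); first split.
- by exists set0 => //; rewrite preimage_set0.
- move=> _ [D' mD' ->]; exists (~` D'); first exact: measurableC.
  by rewrite setTD preimage_setC.
- move=> F CF; have /choice[G HG] : forall i, exists D' : set (dataT X (n + m)),
      measurable D' /\ F i = dat @^-1` D'.
    by move=> i; have [D' mD' E] := CF i; exists D'.
  exists (\bigcup_i G i); first by apply: bigcupT_measurable => i; have [] := HG i.
  by rewrite preimage_bigcup; apply: eq_bigcupr => i _; have [] := HG i.
move=> _ [[k kn [B mB <-]]|[k km [B mB <-]]].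
  exists ((fun v : dataT X (n + m) => v k) @^-1` B).
    rewrite -[X in measurable X]setTI; apply: measurable_coord => //.
    exact: leq_trans kn (leq_addr _ _).
  by rewrite setTI -(Ob_X kn).
exists ((fun v : dataT X (n + m) => v (n + k)%N) @^-1` B).
  by rewrite -[X in measurable X]setTI; apply: measurable_coord => //; rewrite ltn_add2l.
by rewrite setTI -(Ob_Y km).
Qed.

End data_sigma_algebra.

(** * The predictive law *)

Section furbi.
Context {R : realType} d (X : measurableType d).
Variables (theta : R).
Hypothesis Htheta : 0 < theta.
Variables (G0 : probability (X * X)%type R) (P0 : probability X R).
Hypothesis HG0marg : forall A : set X, measurable A ->
      G0 (A `*` setT) = P0 A /\ G0 (setT `*` A) = P0 A.
Variable rho : {measure set (measurableTypeR R * measurableTypeR R)%type -> \bar R}.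
Hypothesis Hrho_supp : rho (~` ([set s | 0 <= s.1 /\ 0 <= s.2] `\` [set (0, 0)])) = 0%E.
Hypothesis Hrho_int : (\int[rho]_s (Num.min 1 (s.1 + s.2))%:E < +oo)%E.
Variables (lam : {sigma_finite_measure set X -> \bar R})
  (g0 : X * X -> R) (p0 : X -> R).
Hypotheses (Hg0m : measurable_fun setT g0) (Hg0pos : forall z, 0 <= g0 z).
Hypothesis Hg0 : forall A : set (X * X), measurable A ->
      G0 A = (\int[(lam \x lam)%E]_(z in A) (g0 z)%:E)%E.
Hypotheses (Hp0m : measurable_fun setT p0) (Hp0pos : forall x, 0 <= p0 x).
Hypothesis Hp0 : forall A : set X, measurable A -> P0 A = (\int[lam]_(x in A) (p0 x)%:E)%E.
Variables (dO : measure_display) (Omega : measurableType dO) (P : probability Omega R).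
Variables (mu1 mu2 : Omega -> {measure set (X * X)%type -> \bar R}).
Hypothesis Hmu : completely_random_vector P theta rho G0 mu1 mu2.
Variables Xs Ys : nat -> Omega -> X.
Hypothesis Hsample : cond_iid P mu1 mu2 Xs Ys.

Let SS : measurableType _ := (measurableTypeR R * measurableTypeR R)%type.

Let min_jump_ae : (\int[rho]_s (Num.min 1 (s.1 + s.2))%:E =
  \int[rho]_s (Num.min 1 (pos_jump true s + pos_jump false s))%:E)%E.
Proof.
apply: ae_eq_integral => //.
- apply/measurable_EFinP; apply: measurable_minr => //; exact: measurable_funD.
- apply/measurable_EFinP; apply: measurable_minr => //.
  by apply: measurable_funD; exact: measurable_pos_jump.
have [N [mN N0 NS]] := ae_pos_jump Hrho_supp; exists N; split => //.
apply: subset_trans NS; apply: subsetC => s [h1 [h2 _]] _.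
by have [-> ->] := pos_jumpE h1 h2.
Qed.

(** The levels min (1, s1 + s2) >= 1/(k+1) have finite mass by Markov's inequality and exhaust the
    punctured quadrant; its null complement is added to each of them. The uses of Tonelli's theorem
    rely on this. *)
Let sigma_finite_rho : sigma_finite setT rho.
Proof.
pose q (s : SS) : R := pos_jump true s + pos_jump false s.
have mq : measurable_fun setT q by apply: measurable_funD; exact: measurable_pos_jump.
have q0 s : 0 <= q s by rewrite addr_ge0// pos_jump_ge0.
pose f (s : SS) : R := Num.min 1 (q s).
have mf : measurable_fun setT f by exact: measurable_minr.
pose bad : set SS := ~` ([set s | 0 <= s.1 /\ 0 <= s.2] `\` [set (0, 0)]).
have mbad : measurable bad by apply: measurableC; exact: measurable_quadrant.
pose F (k : nat) : set SS := bad `|` [set s | k.+1%:R^-1 <= f s].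
have mlev k : measurable [set s | k.+1%:R^-1 <= f s].
  rewrite (_ : [set s | _] = f @^-1` `[k.+1%:R^-1, +oo[).
    by rewrite -[X in measurable X]setTI; apply: mf.
  by apply/seteqP; split => s /=; rewrite in_itv/= andbT.
exists F.
  apply/esym/seteqP; split => // s _.
  have [sb|sb] := pselect (bad s); first by exists 0%N => //; left.
  have {sb} [[s1 s2] s0] : ([set s | 0 <= s.1 /\ 0 <= s.2] `\` [set (0, 0)]) s.
    by apply: contrapT.
  have fpos : 0 < f s.
    rewrite lt_min ltr01/= /q; have [-> ->] := pos_jumpE s1 s2.
    rewrite lt_neqAle addr_ge0// andbT eq_sym paddr_eq0//.
    apply/negP => /andP[/eqP h1 /eqP h2]; apply: s0.
    by case: s h1 h2 {s1 s2} => a b /= -> ->.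
  exists (Num.truncn (f s)^-1) => //; right => /=.
  rewrite invf_ple ?posrE ?ltr0n//; apply/ltW; exact: truncnS_gt.
move=> k; split; first by apply: measurableU.
apply: (@le_lt_trans _ _ (rho bad + rho [set s | (k.+1%:R^-1 <= f s)%R])%E).
  exact: measureU2.
rewrite (_ : rho bad = 0%E); last exact: Hrho_supp.
rewrite add0e.
apply: (@le_lt_trans _ _ (k.+1%:R%:E * \int[rho]_s (f s)%:E)%E); last first.
  by rewrite lte_mul_pinfty// -?min_jump_ae// ?lee_fin// ltry.
have f0 s : 0 <= f s by rewrite le_min ler01 q0.
rewrite -ge0_integralZl//; last 2 first.
- exact/measurable_EFinP.
- by move=> s _; rewrite lee_fin.
apply: (@le_trans _ _ (\int[rho]_s (\1_[set s | (k.+1%:R^-1 <= f s)%R] s)%:E)%E).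
  by rewrite integral_indic// setIT.
apply: ge0_le_integral => //.
- exact/measurable_EFinP/measurable_indic.
- by apply/measurable_EFinP; exact: measurable_funM.
move=> s _; rewrite -EFinM lee_fin indicE.
have [/set_mem/= h|_] := boolP (s \in _); last by rewrite mulr_ge0.
by rewrite -ler_pdivrMl ?ltr0n// mulr1.
Qed.

Let rhos : {sigma_finite_measure set SS -> \bar R} := sf_measure sigma_finite_rho.
Let mu (e : bool) := if e then mu1 else mu2.

Let mmu e A : measurable A -> measurable_fun setT (fun w => mu e w A).
Proof. by move=> mA; have [h _ _] := Hmu; have [? ?] := h A mA; case: e. Qed.

Let share_ptilde1 w A : share mu true w (cyl true A) = ptilde1 mu1 w A.
Proof.
rewrite /share /ptilde1/=; congr (fine (mu1 w _) / _).
by apply/seteqP; split => [z|z []].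
Qed.

Let share_ptilde2 w A : share mu false w (cyl false A) = ptilde2 mu2 w A.
Proof.
rewrite /share /ptilde2/=; congr (fine (mu2 w _) / _).
by apply/seteqP; split => [z|z []].
Qed.

Let sample (n m : nat) (A B : nat -> set X) :
  (forall i, measurable (A i)) -> (forall j, measurable (B j)) ->
  P ((\bigcap_(i in `I_n) (Xs i @^-1` A i)) `&` (\bigcap_(j in `I_m) (Ys j @^-1` B j))) =
  (\int[P]_w ((\prod_(i < n) share mu true w (cyl true (A i))) *
              (\prod_(j < m) share mu false w (cyl false (B j))))%:E)%E.
Proof.
move=> mA mB; have [_ [_ H]] := Hsample.
have E : sigma_ptilde mu1 mu2 setT.
  have [s0 sC _] := smallest_sigma_algebra setT
    [set E | exists A (B : set R), [/\ measurable A, measurable B &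
          (E = [set w | B (ptilde1 mu1 w A)] \/ E = [set w | B (ptilde2 mu2 w A)])]].
  by have := sC _ s0; rewrite setD0.
have := H n m A B setT mA mB E; rewrite setTI => ->.
apply: eq_integral => w _; congr EFin; congr (_ * _); apply: eq_bigr => i _.
  by rewrite share_ptilde1.
by rewrite share_ptilde2.
Qed.

(** By the conventions on [fine] and inverses, the share of the whole space is the indicator that
    the mass is positive and finite. An observation of either kind lies in the whole space with
    probability 1, so this indicator has expectation 1. *)
Let mass_ae : {ae P, forall w, forall e, (0 < mu e w setT < +oo)%E}.
Proof.
pose G e := [set w | (0 < mu e w setT < +oo)%E].
have mG e : measurable (G e).
  rewrite (_ : G e = [set w | (cst 0 w < mu e w setT)%E] `&` [set w | (mu e w setT < cst +oo w)%E]).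
    rewrite -[X in measurable (X `&` _)]setTI -[X in measurable (_ `&` X)]setTI.
    by apply: measurableI; apply: measurable_lte => //; exact: mmu.
  by apply/seteqP; split => [w /andP[]|w [/= h1 h2]] //; apply/andP.
have shareG e w : share mu e w setT = \1_(G e) w.
  rewrite indicE /share; case: (boolP (w \in G e)) => [/set_mem/andP[T0 Ty]|/negP nG].
    by rewrite divff// gt_eqF// fine_gt0// T0.
  have : ~~ (0 < mu e w setT < +oo)%E by apply/negP => h; apply: nG; exact/mem_set.
  rewrite negb_and -leNgt -leNgt leye_eq => /orP[T0|/eqP ->]; last by rewrite /= invr0 mulr0.
  have -> : mu e w setT = 0%E by apply/eqP; rewrite eq_le T0 measure_ge0.
  by rewrite /= mul0r.
have PG e : P (G e) = 1%E.
  have cylT e' : cyl e' [set: X] = setT by apply/seteqP; split.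
  have h : (\int[P]_w (share mu e w setT)%:E = 1)%E.
    case: e {mG shareG}.
    - have := @sample 1 0 (fun=> setT) (fun=> setT) (fun=> measurableT) (fun=> measurableT).
      rewrite (_ : _ `&` _ = setT); last by apply/seteqP; split.
      rewrite probability_setT => ->; apply: eq_integral => w _.
      by rewrite big_ord1 big_ord0 mulr1 cylT.
    - have := @sample 0 1 (fun=> setT) (fun=> setT) (fun=> measurableT) (fun=> measurableT).
      rewrite (_ : _ `&` _ = setT); last by apply/seteqP; split.
      rewrite probability_setT => ->; apply: eq_integral => w _.
      by rewrite big_ord1 big_ord0 mul1r cylT.
  rewrite -h; under eq_integral do rewrite shareG.
  by rewrite integral_indic// setIT.
have PGC e : P (~` G e) = 0%E.
  by rewrite probability_setC// PG subee.
exists (~` G true `|` ~` G false); split.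
- by apply: measurableU; exact: measurableC.
- apply/eqP; rewrite -measure_le0; apply: le_trans (measureU2 _ _ _) _;
    [exact: measurableC|exact: measurableC|].
  by rewrite [X in (X + _)%E]PGC [X in (_ + X)%E]PGC adde0.
- move=> w /= h; apply: contrapT => /not_orP[/contrapT h1 /contrapT h2].
  by apply: h => -[].
Qed.

Section next_item.
Variables (n m : nat) (eN : bool).
Hypotheses (Hn : (0 < n)%N) (Hm : (0 < m)%N).
Hypothesis diag : measurable [set z : X * X | z.1 = z.2].

Let N := (n + m)%N.
Let e (k : nat) := if (k < n)%N then true else if (k < N)%N then false else eN.
(** One list of items serves both predictions: [n] observations of the first kind, [m] of the
    second, and the item to predict. Indices start at 0, hence [Xs n] and [Ys m] are the next
    observations. *)
Let Ob (k : nat) : Omega -> X :=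
  if (k < n)%N then Xs k else if (k < N)%N then Ys (k - n)%N
  else if eN then Xs n else Ys m.

Let mOb k : measurable_fun setT (Ob k).
Proof.
have [mX [mY _]] := Hsample.
by rewrite /Ob; case: (k < n)%N; case: (k < N)%N; case: eN.
Qed.

Let ObX i : (i < n)%N -> Ob i = Xs i.
Proof. by move=> iN; rewrite /Ob iN. Qed.

Let ObY j : (j < m)%N -> Ob (n + j)%N = Ys j.
Proof. by move=> jm; rewrite /Ob /N ltn_add2l jm ltnNge leq_addr/= addKn. Qed.

Let ObN : Ob N = if eN then Xs n else Ys m.
Proof. by rewrite /Ob ltnn ltnNge leq_addr. Qed.

Let item_sum (U : Type) (idx : U) (op : Monoid.com_law idx) (F : nat -> U) :
  \big[op/idx]_(k < N.+1) F k =
  op (op (\big[op/idx]_(i < n) F i) (\big[op/idx]_(j < m) F (n + j)%N)) (F N).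
Proof. by rewrite big_ord_recr/= big_split_ord/=. Qed.

Let e_X (i : 'I_n) : e i = true. Proof. by rewrite /e ltn_ord. Qed.
Let e_Y (j : 'I_m) : e (n + j)%N = false.
Proof. by rewrite /e ltnNge leq_addr/= /N ltn_add2l ltn_ord. Qed.
Let e_N : e N = eN. Proof. by rewrite /e ltnNge leq_addr ltnn. Qed.

(** The counts are put in successor form, which the gamma weights require; positive [n] and [m]
    ensure it for both kinds whichever item is predicted. *)
Let count1 : (\sum_(k < N.+1) e k = (n + eN).-1.+1)%N.
Proof.
rewrite (item_sum _ (fun k => nat_of_bool (e k))) e_N/=.
under eq_bigr do rewrite e_X; under [X in (_ + X + _)%N]eq_bigr do rewrite e_Y.
rewrite !sum_nat_const !card_ord muln1 muln0 addn0 prednK//.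
by rewrite addn_gt0 Hn.
Qed.

Let count2 : (\sum_(k < N.+1) ~~ e k = (m + ~~ eN).-1.+1)%N.
Proof.
rewrite (item_sum _ (fun k => nat_of_bool (~~ e k))) e_N/=.
under eq_bigr do rewrite e_X; under [X in (_ + X + _)%N]eq_bigr do rewrite e_Y.
rewrite !sum_nat_const !card_ord muln1 muln0 add0n prednK//.
by rewrite addn_gt0 Hm.
Qed.

Let law_share (A : nat -> set X) : (forall k, measurable (A k)) ->
  P (\bigcap_(k in `I_N.+1) (Ob k @^-1` A k)) =
  (\int[P]_w (\prod_(k < N.+1) share mu (e k) w (cyl (e k) (A k)))%:E)%E.
Proof.
move=> mA.
(* The sampling law counts each kind separately, with [n + eN] and [m + ~~ eN] items. Index [n] of
   the first kind, or [m] of the second, receives the set of the item to predict; only one of the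
   two is in range. *)
pose A' i := if (i < n)%N then A i else A N.
pose B' j := if (j < m)%N then A (n + j)%N else A N.
have mA' i : measurable (A' i) by rewrite /A'; case: ifP.
have mB' j : measurable (B' j) by rewrite /B'; case: ifP.
transitivity (P ((\bigcap_(i in `I_(n + eN)) (Xs i @^-1` A' i)) `&`
                 (\bigcap_(j in `I_(m + ~~ eN)) (Ys j @^-1` B' j)))).
  congr (P _); apply/seteqP; split => [w h|w [h1 h2] k /= kN].
    split => [i /= iN|j /= jN].
      rewrite /preimage /A' /=; case: ifP => iltn.
        by have := h i; rewrite /preimage/= ObX//; apply; rewrite ltnS /N (leq_trans (ltnW iltn))// leq_addr.
      have iE : i = n by move: iN iltn; case: eN; rewrite /= ?addn1 ?addn0 ?ltnS; lia.
      have eT : eN by move: iN iltn; case: eN; rewrite /= ?addn0; lia.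
      by have := h N (ltnSn N); rewrite /preimage/= ObN eT iE.
    rewrite /preimage /B' /=; case: ifP => jltn.
      by have := h (n + j)%N; rewrite /preimage/= ObY//; apply; rewrite ltnS /N leq_add2l ltnW.
    have jE : j = m by move: jN jltn; case: eN; rewrite /= ?addn1 ?addn0 ?ltnS; lia.
    have eF : eN = false by move: jN jltn; case: eN; rewrite /= ?addn0; lia.
    by have := h N (ltnSn N); rewrite /preimage/= ObN eF jE.
  have [kn|nk] := ltnP k n.
    by rewrite /preimage/= ObX//; have := h1 k; rewrite /preimage/= /A' kn; apply; rewrite (leq_trans kn)// leq_addr.
  have [km|mk] := ltnP (k - n) m.
    have kE : k = (n + (k - n))%N by rewrite subnKC.
    rewrite kE /preimage/= ObY//; have := h2 (k - n)%N; rewrite /preimage/= /B' km.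
    by apply; rewrite (leq_trans km)// leq_addr.
  have kE : k = N by rewrite /N; move: kN; rewrite /N; lia.
  rewrite kE /preimage/= ObN; case: eN h1 h2 => h1 h2.
    by have := h1 n; rewrite /preimage/= /A' ltnn; apply; rewrite addn1.
  by have := h2 m; rewrite /preimage/= /B' ltnn; apply; rewrite addn1.
rewrite sample//; apply: eq_integral => w _; congr EFin.
rewrite (item_sum _ (fun k => share mu (e k) w (cyl (e k) (A k)))) e_N/=.
under [X in _ = X * _ * _]eq_bigr do rewrite e_X.
under [X in _ = _ * X * _]eq_bigr do rewrite e_Y.
have big1' : \prod_(i < n) share mu true w (cyl true (A' i)) =
    \prod_(i < n) share mu true w (cyl true (A i)).
  by apply: eq_bigr => i _; rewrite /A' ltn_ord.
have big2' : \prod_(j < m) share mu false w (cyl false (B' j)) =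
    \prod_(j < m) share mu false w (cyl false (A (n + j)%N)).
  by apply: eq_bigr => i _; rewrite /B' ltn_ord.
case: eN => /=.
  rewrite addn1 addn0 big_ord_recr/= big1' big2' /A' ltnn; ring.
by rewrite addn1 addn0 big_ord_recr/= big1' big2' /B' ltnn mulrA.
Qed.

Let law_configs : exists wt : seq (seq nat) -> R, (forall r, 0 <= wt r) /\
  forall A : nat -> set X, (forall k, measurable (A k)) ->
  P (\bigcap_(k in `I_N.+1) (Ob k @^-1` A k)) =
  (\sum_(c <- configs N.+1) wt c *
    \prod_(b <- c) fine (G0 (capE (fun k => cyl (e k) (A k)) b)))%:E.
Proof.
have [leb2 Hleb2] := @gamma_product R (n + eN).-1 (m + ~~ eN).-1.
have Hint : (\int[rhos]_s (Num.min 1 (pos_jump true s + pos_jump false s))%:E < +oo)%E.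
  by rewrite (@eq_measure_integral _ _ _ setT rho)// -min_jump_ae.
have [_ indep laplace] := Hmu.
have laplace' (A : set (X * X)) (l1 l2 : R) : measurable A -> 0 <= l1 -> 0 <= l2 ->
  (\int[P]_w (expmE (l1%:E * mu true w A + l2%:E * mu false w A)%E)%:E)%E =
  (expR (- (theta * fine (G0 A) *
     fine (\int[rhos]_s (1 - expR (- (l1 * s.1 + l2 * s.2)))%:E)%E)))%:E.
  by move=> mA l10 l20; exact: laplace.
have [wt [wt0 H]] := share_moments (ltW Htheta) (Hrho_supp : rhos _ = 0%E) Hint mmu
  indep laplace' mass_ae count1 count2 Hleb2.
exists wt; split => // A mA; rewrite law_share// (H (fun k => cyl (e k) (A k)))// => k.
exact: measurable_cyl.
Qed.

Let SK e' y C := seen_kernel lam g0 p0 e' eN y C.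

Lemma predictive : exists (xi0 : Omega -> R) (xix xiy : nat -> Omega -> R),
  let F := sigma_data Xs Ys n m in
  [/\ measurable_wrt F xi0 /\ (forall i, measurable_wrt F (xix i))
        /\ (forall j, measurable_wrt F (xiy j)),
      (forall w, 0 <= xi0 w /\ (forall i, 0 <= xix i w) /\ (forall j, 0 <= xiy j w)),
      (forall w, xi0 w + \sum_(i < size (distinct_vals Xs n w)) xix i w
                       + \sum_(j < size (distinct_vals Ys m w)) xiy j w = 1) &
      forall C : set X, measurable C -> forall D : set Omega, F D ->
        P (D `&` ((if eN then Xs n else Ys m) @^-1` C)) =
        (\int[P]_(w in D)
           ((xi0 w)%:E * P0 C
            + \sum_(i < size (distinct_vals Xs n w))
                 (xix i w)%:E * SK true (nth point (distinct_vals Xs n w) i) C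
            + \sum_(j < size (distinct_vals Ys m w))
                 (xiy j w)%:E * SK false (nth point (distinct_vals Ys m w) j) C))%E].
Proof.
have [wt [wt0 law]] := law_configs.
have [rho0 [rhok [[mr0 mrk] [r00 rk0] rsum H]]] :=
  posterior HG0marg Hg0m Hg0pos Hg0 Hp0m Hp0pos Hp0 mOb wt0 law.
pose dat (w : Omega) : dataT X N := fun k => Ob k w.
pose aX k w := rhok k (dat w); pose aY k w := rhok (n + k)%N (dat w).
have mdat : measurable_fun setT (dat : dataOmega Xs Ys n m -> dataT X N).
  exact: (measurable_dat ObX ObY).
exists (rho0 \o dat), (pooled Xs n aX), (pooled Ys m aY); split.
- split; first by apply: measurable_wrtP; exact: (measurableT_comp mr0 mdat).
  split => i; apply: measurable_wrtP.
    apply: (@measurable_pooled R d X _ (dataOmega Xs Ys n m) diag Xs n).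
      by move=> k kn; exact: measurable_Xs_data.
    by move=> k kn; exact: (measurableT_comp (mrk k) mdat).
  apply: (@measurable_pooled R d X _ (dataOmega Xs Ys n m) diag Ys m).
    by move=> k kn; exact: measurable_Ys_data.
  by move=> k kn; exact: (measurableT_comp (mrk (n + k)%N) mdat).
- by move=> w; split; [exact: r00|split => i; apply: pooled_ge0 => k _; exact: rk0].
- move=> w; rewrite !sum_pooled -[RHS](rsum (dat w)) -addrA; congr (_ + _).
  by rewrite big_split_ord.
move=> C mC D /(sigma_dataP ObX ObY)[D' mD' ->].
rewrite -ObN; have := H C D' mC mD'; rewrite -/dat => ->.
apply: eq_integral => w _; rewrite -addeA; congr (_ + _)%E.
rewrite (esum_pooled _ (SK true ^~ C)); last by move=> k _; exact: rk0.
rewrite (esum_pooled _ (SK false ^~ C)); last by move=> k _; exact: rk0.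
rewrite big_split_ord/=; congr (_ + _)%E; apply: eq_bigr => k _; rewrite e_N.
  by rewrite e_X ObX.
by rewrite e_Y ObY.
Qed.

End next_item.
End furbi.

Theorem theorem2
  (R : realType) (d : measure_display) (X : measurableType d)
  (HX : polish_space R X)
  (theta : R) (Htheta : 0 < theta)
  (G0 : probability (X * X)%type R) (P0 : probability X R)
  (HG0na : forall z : X * X, G0 [set z] = 0%E)
  (HG0marg : forall A : set X, measurable A ->
      G0 (A `*` setT) = P0 A /\ G0 (setT `*` A) = P0 A)
  (rho : {measure set (measurableTypeR R * measurableTypeR R)%type -> \bar R})
  (Hrho_supp : rho (~` ([set s | 0 <= s.1 /\ 0 <= s.2] `\` [set (0, 0)])) = 0%E)
  (Hrho_int : (\int[rho]_s (Num.min 1 (s.1 + s.2))%:E < +oo)%E)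
  (Hrho_marg : forall A : set R, measurable A -> A `<=` `]0, +oo[ ->
      rho (A `*` setT) = rho (setT `*` A))
  (Hrho_inf : rho [set s | 0 < s.1] = +oo%E)
  (lam : {sigma_finite_measure set X -> \bar R})
  (g0 : X * X -> R) (p0 : X -> R)
  (Hg0m : measurable_fun setT g0) (Hg0pos : forall z, 0 <= g0 z)
  (Hg0 : forall A : set (X * X), measurable A ->
      G0 A = (\int[(lam \x lam)%E]_(z in A) (g0 z)%:E)%E)
  (Hp0m : measurable_fun setT p0) (Hp0pos : forall x, 0 <= p0 x)
  (Hp0 : forall A : set X, measurable A -> P0 A = (\int[lam]_(x in A) (p0 x)%:E)%E)
  (dO : measure_display) (Omega : measurableType dO) (P : probability Omega R)
  (mu1 mu2 : Omega -> {measure set (X * X)%type -> \bar R})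
  (Hmu : completely_random_vector P theta rho G0 mu1 mu2)
  (Xs Ys : nat -> Omega -> X)
  (Hsample : cond_iid P mu1 mu2 Xs Ys)
  (n m : nat) (Hn : (0 < n)%N) (Hm : (0 < m)%N) :
  let F := sigma_data Xs Ys n m in
  let xs := distinct_vals Xs n in
  let ys := distinct_vals Ys m in
  (exists (xi0 : Omega -> R) (xix xiy : nat -> Omega -> R),
    [/\ measurable_wrt F xi0 /\ (forall i, measurable_wrt F (xix i))
          /\ (forall j, measurable_wrt F (xiy j)),
        (forall w, 0 <= xi0 w /\ (forall i, 0 <= xix i w) /\ (forall j, 0 <= xiy j w)),
        (forall w, xi0 w + \sum_(i < size (xs w)) xix i w
                         + \sum_(j < size (ys w)) xiy j w = 1) &
        forall C : set X, measurable C -> forall D : set Omega, F D ->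
          P (D `&` (Xs n @^-1` C)) =
          (\int[P]_(w in D)
             ((xi0 w)%:E * P0 C
              + \sum_(i < size (xs w)) (xix i w)%:E * \d_(nth point (xs w) i) C
              + \sum_(j < size (ys w)) (xiy j w)%:E * Rker lam g0 p0 (nth point (ys w) j) C))%E])
  /\
  (exists (eta0 : Omega -> R) (etay etax : nat -> Omega -> R),
    [/\ measurable_wrt F eta0 /\ (forall j, measurable_wrt F (etay j))
          /\ (forall i, measurable_wrt F (etax i)),
        (forall w, 0 <= eta0 w /\ (forall j, 0 <= etay j w) /\ (forall i, 0 <= etax i w)),
        (forall w, eta0 w + \sum_(j < size (ys w)) etay j w
                          + \sum_(i < size (xs w)) etax i w = 1) &
        forall C : set X, measurable C -> forall D : set Omega, F D ->
          P (D `&` (Ys m @^-1` C)) =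
          (\int[P]_(w in D)
             ((eta0 w)%:E * P0 C
              + \sum_(j < size (ys w)) (etay j w)%:E * \d_(nth point (ys w) j) C
              + \sum_(i < size (xs w)) (etax i w)%:E * Qker lam g0 p0 (nth point (xs w) i) C))%E]).
Proof.
have diag := measurable_diagonal HX.
have pred eN := @predictive R d X theta Htheta G0 P0 HG0marg rho Hrho_supp Hrho_int
  lam g0 p0 Hg0m Hg0pos Hg0 Hp0m Hp0pos Hp0 dO Omega P mu1 mu2 Hmu Xs Ys Hsample
  n m eN Hn Hm diag.
split.
  have [xi0 [xix [xiy H]]] := pred true.
  by exists xi0, xix, xiy.
have [xi0 [xix [xiy [h1 h2 h3 h4]]]] := pred false.
(* With [eN = false] the Dirac masses sit at the values of [Ys], so the weights of [Ys] come first
   and the two sums are exchanged. *)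
exists xi0, xiy, xix; split.
- by case: h1 => ? [? ?].
- by move=> w; have [? [? ?]] := h2 w.
- by move=> w; rewrite -[RHS](h3 w) addrAC.
move=> C mC D FD; rewrite h4//; apply: eq_integral => w _.
by rewrite addeAC.
Qed.
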